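(* Let $p\ge1$, let $g_1=(g_{1j})_{1\le j\le2^p}$, $g_2=(g_{2j})_{1\le j\le2^p}\in(\mathfrak{H}\oplus\mathfrak{H})^{\odot p}$, and consider the complex random variable $I_p(g_1)+\mathrm{i}I_p(g_2)$, where $I_p(\cdot)$ is the $p$-th real multiple Wiener-Itô integral with respect to $W$. Then $$I_p(g_1)+\mathrm{i}I_p(g_2)=\sum_{k=0}^p\mathcal{I}_{k,p-k}(g_{k,p-k}),$$ where $g_{k,p-k}\in\mathfrak{H}_{\mathbb{C}}^{\odot k}\otimes\mathfrak{H}_{\mathbb{C}}^{\odot(p-k)}$, $0\le k\le p$, are defined as $$g_{k,p-k}=\frac{2^{-p/2}\,p!}{k!(p-k)!}\sum_{j=1}^{2^p}V_{kj}(g_{1j}+\mathrm{i}g_{2j}).$$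
   Context: $\mathfrak{H}$ is a real separable Hilbert space, $\mathfrak{H}_{\mathbb{C}}$ its complexification (inner product linear in the first variable), $\mathfrak{H}\oplus\mathfrak{H}$ the Hilbert direct sum; $^{\odot n}$ is the $n$-th symmetric tensor power, $\mathrm{symm}$ the symmetrization. $X$, $Y$ are two independent isonormal Gaussian processes over $\mathfrak{H}$ (centered Gaussian families with $\mathbb{E}[X(h)X(g)]=\langle h,g\rangle_{\mathfrak{H}}$, likewise $Y$). $W(h,f)=X(h)+Y(f)$ is an isonormal Gaussian process over $\mathfrak{H}\oplus\mathfrak{H}$. For $\mathfrak{h}=f+\mathrm{i}g\in\mathfrak{H}_{\mathbb{C}}$ put $X_{\mathbb{C}}(\mathfrak{h})=X(f)+\mathrm{i}X(g)$, similarly $Y_{\mathbb{C}}$, and $Z(\mathfrak{h})=(X_{\mathbb{C}}(\mathfrak{h})+\mathrm{i}Y_{\mathbb{C}}(\mathfrak{h}))/\sqrt2$ (complex isonormal Gaussian process). $\Lambda$ is the set of sequences $\mathbf{a}=\{a_k\}_{k\ge1}$ of non-negative integers with finite sum $|\mathbf{a}|$. Real integrals: Hermite polynomials are defined by $\exp\{tx-t^2/2\}=\sum_n \frac{t^n}{n!}H_n(x)$. For a complete orthonormal system $\{\eta_k\}$ of $\mathfrak{H}\oplus\mathfrak{H}$, $I_n$ is the linear isometry from $(\mathfrak{H}\oplus\mathfrak{H})^{\odot n}$ with norm $\sqrt{n!}\|\cdot\|$ onto the $n$-th Wiener chaos of $W$ given by $I_n(\mathrm{symm}(\otimes_k\eta_k^{\otimes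 m_k}))=\prod_kH_{m_k}(W(\eta_k))$, $\mathbf m\in\Lambda$, $|\mathbf{m}|=n$. Complex integrals: complex Hermite polynomials are defined by $\exp\{\lambda\bar z+\bar\lambda z-2|\lambda|^2\}=\sum_{p,q\ge0}\frac{\bar\lambda^p\lambda^q}{p!q!}J_{p,q}(z)$. For a complete orthonormal system $\{\xi_k\}$ of $\mathfrak{H}_{\mathbb{C}}$, $\mathcal{I}_{p,q}$ is the linear isometry from $\mathfrak{H}_{\mathbb{C}}^{\odot p}\otimes\mathfrak{H}_{\mathbb{C}}^{\odot q}$ with norm $\sqrt{p!q!}\|\cdot\|$ into $L^2_{\mathbb{C}}(\Omega)$ given by $\mathcal{I}_{p,q}(\mathrm{symm}(\otimes_k\xi_k^{\otimes p_k})\otimes\mathrm{symm}(\otimes_k\overline{\xi}_k^{\otimes q_k}))=\prod_k2^{-(p_k+q_k)/2}J_{p_k,q_k}(\sqrt2Z(\xi_k))$, $\mathbf p,\mathbf q\in\Lambda$, $|\mathbf p|=p,|\mathbf q|=q$. For $1\le j\le2^p$ write $j-1=\sum_{l=1}^pa_{jl}2^{l-1}$ with $a_{jl}\in\{0,1\}$. An element $g\in(\mathfrak{H}\oplus\mathfrak{H})^{\otimes p}$ is identified with the column $(g_j)_{1\le j\le2^p}$ of its components $g_j\in\mathfrak{H}^{\otimes p}$, $g_j$ being the component whose $l$-th tensor factor lies in the first copy of $\mathfrak{H}$ if $a_{jl}=0$ and in the second copy if $a_{jl}=1$ (for each $l$). For $0\le k\le p$ let $b_{kj}$ be the number of $1$'s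 in $\{a_{j1},\dots,a_{jk}\}$ (counted with multiplicity, $b_{0j}=0$) and $c_{kj}$ the number of $1$'s in $\{a_{j,k+1},\dots,a_{jp}\}$ ($c_{pj}=0$), and put $V_{kj}=(-\mathrm{i})^{b_{kj}}\,\mathrm{i}^{c_{kj}}$. In $\mathfrak{H}_{\mathbb{C}}^{\odot k}\otimes\mathfrak{H}_{\mathbb{C}}^{\odot(p-k)}\subseteq\mathfrak{H}_{\mathbb{C}}^{\otimes p}$ the first $k$ tensor factors form the $\mathfrak{H}_{\mathbb{C}}^{\odot k}$ part. *)

(* Defs.v *)
From HB Require Import structures.
From mathcomp Require Import all_boot all_order all_algebra perm.
From mathcomp Require Import finmap multiset complex.
From mathcomp Require Import all_classical all_reals all_analysis.

Set Implicit Arguments.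
Unset Strict Implicit.
Unset Printing Implicit Defensive.

Import Order.TTheory GRing.Theory Num.Theory.
Import numFieldNormedType.Exports.

Local Open Scope classical_set_scope.
Local Open Scope ring_scope.
Local Open Scope complex_scope.

(* A real Hilbert space is a complete normed space whose norm comes from an
   inner product. *)
Record inner_product (R : realType) (H : completeNormedModType R)
    (dot : H -> H -> R) : Prop := {
  dot_sym : forall x y, dot x y = dot y x;
  dot_linear : forall a x y z, dot (a *: x + y) z = a * dot x z + dot y z;
  dot_norm : forall x, dot x x = `|x| ^+ 2
}.

Definition separable_space (S : topologicalType) : Prop :=
  exists2 D : set S, countable D & dense D.

Definition dsum_dot (R : realType) (V : lmodType R) (dot : V -> V -> R)
    (x y : (V * V)%type) : R :=
  dot x.1 y.1 + dot x.2 y.2.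

(* The pair (f, g) stands for f + i g. *)
Definition complexification (R : realType) (V : lmodType R) : Type :=
  (V * V)%type.

Section Complexification.
Variables (R : realType) (V : lmodType R).
Implicit Types (a b : R[i]) (x y : complexification V).

HB.instance Definition _ := GRing.Zmodule.on (complexification V).

Definition cscale a x : complexification V :=
  (complex.Re a *: x.1 - complex.Im a *: x.2,
   complex.Re a *: x.2 + complex.Im a *: x.1).

Fact cscaleA a b x : cscale a (cscale b x) = cscale (a * b) x.
Proof.
case: a b x => [a1 a2] [b1 b2] [f g]; rewrite /cscale /=.
rewrite !scalerBr !scalerDr !scalerA !scalerBl !scalerDl.
by congr pair; rewrite -!addrA; congr (_ + _); rewrite ?opprD addrA addrC.
Qed.

Fact cscale1 : left_id 1 cscale.
Proof. by case=> f g; rewrite /cscale /= !scale1r !scale0r subr0 addr0. Qed.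

Fact cscaleDr : right_distributive cscale +%R.
Proof.
move=> [a1 a2] [f g] [f' g']; rewrite /cscale /= !scalerDr.
by congr pair => /=; rewrite ?opprD addrACA.
Qed.

Fact cscaleDl x : {morph cscale^~ x : a b / a + b}.
Proof.
move: x => [f g] [a1 a2] [b1 b2]; rewrite /cscale /= !scalerDl.
by congr pair => /=; rewrite ?opprD addrACA.
Qed.

HB.instance Definition _ := GRing.Zmodule_isLmodule.Build R[i]
  (complexification V) cscaleA cscale1 cscaleDr cscaleDl.

Definition cconj x : complexification V := (x.1, - x.2).

Definition complex_dot (dot : V -> V -> R) x y : R[i] :=
  (dot x.1 y.1 + dot x.2 y.2) +i* (dot x.2 y.1 - dot x.1 y.2).

End Complexification.

(* The scalar field is K (R or R[i]) with conjugation cj and modulus nm. *)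
Section Tensors.
Variables (R : realType) (K : numFieldType) (cj : K -> K) (nm : K -> R).
Variables (E : lmodType K) (dot : E -> E -> K).

Definition orthonormal (I : eqType) (e : I -> E) : Prop :=
  forall k l, dot (e k) (e l) = (k == l)%:R.

(* The index type is countable, finite when E has finite dimension; complete
   means that the linear span is dense. *)
Definition complete_orthonormal (I : countType) (e : I -> E) : Prop :=
  orthonormal e /\
  forall (x : E) (eps : K), 0 < eps ->
    exists (s : seq I) (c : I -> K),
      let r := x - \sum_(k <- s) c k *: e k in dot r r < eps.

(* The Hilbert space tensor power E^{(x) n} is realized as the space of
   Hilbert-Schmidt n-antilinear functionals on E, u_1 (x) ... (x) u_n being
   the functional x |-> \prod_l <u_l, x_l>. *)
Definition functional (n : nat) : Type := ('I_n -> E) -> K.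

Definition antilinear n (f : functional n) : Prop :=
  forall (x : 'I_n -> E) (l : 'I_n) (a : K) (u v : E),
    f [eta x with l |-> a *: u + v] =
    cj a * f [eta x with l |-> u] + f [eta x with l |-> v].

(* Squared norm of a tensor: sum of the |f(e_{k_1}, ..., e_{k_n})|^2 along a
   complete orthonormal system e, equivalently the supremum of these sums over
   finite orthonormal systems. *)
Definition hs_norm2 n (f : functional n) : \bar R :=
  ereal_sup [set r | exists (m : nat) (e : 'I_m -> E), orthonormal e /\
    r = (\sum_(t : {ffun 'I_n -> 'I_m}) nm (f (e \o t)) ^+ 2)%:E].

Definition tensor_power n : set (functional n) :=
  [set f | antilinear f /\ (hs_norm2 f < +oo)%E].

Definition pure_tensor n (u : 'I_n -> E) : functional n :=
  fun x => \prod_(l < n) dot (u l) (x l).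

Definition symm n (f : functional n) : functional n :=
  fun x => (n`!)%:R^-1 * \sum_(s : 'S_n) f (x \o s).

Definition symmetric_power n : set (functional n) :=
  [set f | tensor_power f /\ forall (s : 'S_n) x, f (x \o s) = f x].

Definition tensor_product p q (f : functional p) (g : functional q) :
    functional (p + q) :=
  fun x => f (x \o lshift q) * g (x \o @rshift p q).

Definition concat p q (x : 'I_p -> E) (y : 'I_q -> E) : 'I_(p + q) -> E :=
  fun l => match fintype.split l with inl i => x i | inr i => y i end.

(* E^{(.) p} (x) E^{(.) q} as a subspace of E^{(x) (p + q)}. *)
Definition bisymmetric_power p q : set (functional (p + q)) :=
  [set f | tensor_power f /\
    forall (s : 'S_p) (t : 'S_q) x y,
      f (concat (x \o s) (y \o t)) = f (concat x y)].

End Tensors.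

(* {mset I} is the type of finitely supported multi-indices m : I -> nat;
   size m is |m|, and m coerces to a sequence where k occurs m k times. *)
Definition multi_tensor (K : numFieldType) (E : lmodType K)
    (dot : E -> E -> K) (I : choiceType) (e : I -> E) (m : {mset I}%mset) :
    functional E (size m) :=
  symm (pure_tensor dot (fun l => e (tnth (in_tuple m) l))).
Arguments multi_tensor {K E} dot {I} e m _.

Section RealAndComplexTensors.
Variables (R : realType).

Definition real_symmetric_power (E : lmodType R) (dot : E -> E -> R) n :=
  @symmetric_power R R idfun Num.norm E dot n.

Definition real_norm2 (E : lmodType R) (dot : E -> E -> R) n :=
  @hs_norm2 R R Num.norm E dot n.

Definition complex_bisymmetric_power (E : lmodType R[i])
    (dot : E -> E -> R[i]) p q :=
  @bisymmetric_power R R[i] conjc (@Normc.normc R) E dot p q.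

Definition complex_norm2 (E : lmodType R[i]) (dot : E -> E -> R[i]) n :=
  @hs_norm2 R R[i] (@Normc.normc R) E dot n.

(* For f, g in V^{(x) n}, the element f + i g of the n-th tensor power of the
   complexification of V: the antilinear extension of f + i g, expanded in
   the real and imaginary parts of its arguments (A is the set of positions
   where the imaginary part is taken). *)
Definition complex_tensor (V : lmodType R) n (f g : functional V n) :
    functional (complexification V) n :=
  fun x => \sum_(A : {set 'I_n}) (- 'i%C) ^+ #|A| *
    let y l := if l \in A then (x l).2 else (x l).1 in f y +i* g y.

(* a_{jl} and V_{kj}, with j and l counted from 0. *)
Definition bit (j l : nat) : bool := odd (j %/ 2 ^ l).

Definition Vcoef (p k j : nat) : R[i] :=
  (- 'i%C) ^+ (\sum_(0 <= l < k) bit j l)%N *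
  'i%C ^+ (\sum_(k <= l < p) bit j l)%N.

(* The component g_j in V^{(x) p} of g in (V (+) V)^{(x) p}. *)
Definition component (V : lmodType R) p (g : functional (V * V)%type p)
    (j : nat) : functional V p :=
  fun x => g (fun l => if bit j l then (0, x l) else (x l, 0)).

(* The kernel g_{k,p-k}; the cast identifies 'I_p with 'I_(k + (p - k)). *)
Definition chaos_kernel (V : lmodType R) p (g1 g2 : functional (V * V)%type p)
    (k : 'I_p.+1) : functional (complexification V) (k + (p - k)) :=
  fun x =>
    ((Num.sqrt 2)^- p * ((p`!)%:R / ((k`!)%:R * ((p - k)`!)%:R)))%:C *
    \sum_(j < 2 ^ p)
      Vcoef p k j * complex_tensor (component g1 j) (component g2 j)
        (x \o cast_ord (esym (subnKC (leq_ord k)))).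

End RealAndComplexTensors.
Arguments chaos_kernel {R V p} g1 g2 k _.

Definition hermite_polynomials (R : realType) (He : nat -> R -> R) : Prop :=
  forall t x : R,
    series (fun n => t ^+ n / (n`!)%:R * He n x) @ \oo -->
      expR (t * x - t ^+ 2 / 2).

Definition has_sum (R : realType) (I : choiceType) (u : I -> R[i])
    (s : R[i]) : Prop :=
  forall eps : R, 0 < eps -> exists A0 : {fset I}, forall A : {fset I},
    (A0 `<=` A)%fset -> Normc.normc (\sum_(i <- A) u i - s) < eps.

(* The exponent is real, so the real exponential applies to its real part. *)
Definition complex_hermite_polynomials (R : realType)
    (J : nat -> nat -> R[i] -> R[i]) : Prop :=
  forall l z : R[i],
    has_sum (fun pq : nat * nat => l^* ^+ pq.1 * l ^+ pq.2 /
               ((pq.1`!)%:R * (pq.2`!)%:R) * J pq.1 pq.2 z)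
      (expR (complex.Re (l * z^* + l^* * z - 2 * `|l| ^+ 2)))%:C.

Section Gaussian.
Variables (d : measure_display) (T : measurableType d) (R : realType).
Variable P : probability T R.

(* The degenerate case s = 0 is needed: X 0 = 0. *)
Definition gaussian (F : T -> R) : Prop :=
  exists m s : R, forall A : set R, measurable A ->
    P (F @^-1` A) = if s == 0 then \d_m A else normal_prob m s A.

Definition gaussian_family (I : Type) (X : I -> {RV P >-> R}) : Prop :=
  forall (n : nat) (a : 'I_n -> R) (h : 'I_n -> I),
    gaussian (fun w => \sum_(i < n) a i * X (h i) w).

Definition isonormal (V : Type) (dot : V -> V -> R) (X : V -> {RV P >-> R}) :
    Prop :=
  [/\ gaussian_family X,
      forall h, ('E_P[X h] = 0)%E &
      forall h g, ('E_P[(fun w => X h w * X g w)%R] = (dot h g)%:E)%E].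

Definition generated_sigma_algebra (I : Type) (X : I -> {RV P >-> R}) :
    set (set T) :=
  <<s [set U | exists h (A : set R), measurable A /\ U = X h @^-1` A] >>.

Definition independent_processes (I J : Type) (X : I -> {RV P >-> R})
    (Y : J -> {RV P >-> R}) : Prop :=
  forall A B, generated_sigma_algebra X A -> generated_sigma_algebra Y B ->
    P (A `&` B) = (P A * P B)%E.

Definition sum_process (V : Type) (X Y : V -> {RV P >-> R})
    (hf : (V * V)%type) (w : T) : R :=
  X hf.1 w + Y hf.2 w.

Definition complex_process (V : lmodType R) (X : V -> {RV P >-> R})
    (h : complexification V) (w : T) : R[i] :=
  X h.1 w +i* X h.2 w.

Definition complex_isonormal (V : lmodType R) (X Y : V -> {RV P >-> R})
    (h : complexification V) (w : T) : R[i] :=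
  (complex_process X h w + 'i%C * complex_process Y h w) / (Num.sqrt 2)%:C.

(* In n f represents the n-th integral of f in (V (+) V)^{(.) n}, as an element
   of L^2 determined up to P-a.e. equality. *)
Record wiener_ito (V : lmodType R) (dot : V -> V -> R)
    (X Y : V -> {RV P >-> R}) (He : nat -> R -> R)
    (I : countType) (eta : I -> (V * V)%type)
    (In : forall n, functional (V * V)%type n -> T -> R) : Prop := {
  wiener_ito_measurable : forall n f,
    real_symmetric_power (dsum_dot dot) f -> measurable_fun setT (In n f);
  wiener_ito_linear : forall n a f g,
    real_symmetric_power (dsum_dot dot) f ->
    real_symmetric_power (dsum_dot dot) g ->
    {ae P, forall w, In n (fun x => a * f x + g x) w = a * In n f w + In n g w};
  wiener_ito_isometry : forall n f,
    real_symmetric_power (dsum_dot dot) f ->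
    (\int[P]_w (In n f w ^+ 2)%:E =
      (n`!)%:R%:E * real_norm2 (dsum_dot dot) f)%E;
  wiener_ito_hermite : forall m : {mset I}%mset,
    {ae P, forall w, In (size m) (multi_tensor (dsum_dot dot) eta m) w =
      \prod_(k <- finsupp m) He (m k) (sum_process X Y (eta k) w)}
}.

Record complex_wiener_ito (V : lmodType R) (dot : V -> V -> R)
    (X Y : V -> {RV P >-> R}) (J : nat -> nat -> R[i] -> R[i])
    (I : countType) (xi : I -> complexification V)
    (Ipq : forall p q, functional (complexification V) (p + q) -> T -> R[i]) :
    Prop := {
  complex_wiener_ito_measurable : forall p q f,
    complex_bisymmetric_power (complex_dot dot) f ->
    measurable_fun setT (fun w => complex.Re (Ipq p q f w)) /\
    measurable_fun setT (fun w => complex.Im (Ipq p q f w));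
  complex_wiener_ito_linear : forall p q a f g,
    complex_bisymmetric_power (complex_dot dot) f ->
    complex_bisymmetric_power (complex_dot dot) g ->
    {ae P, forall w,
      Ipq p q (fun x => a * f x + g x) w = a * Ipq p q f w + Ipq p q g w};
  complex_wiener_ito_isometry : forall p q f,
    complex_bisymmetric_power (complex_dot dot) f ->
    (\int[P]_w (Normc.normc (Ipq p q f w) ^+ 2)%:E =
      (p`! * q`!)%:R%:E * complex_norm2 (complex_dot dot) f)%E;
  complex_wiener_ito_hermite : forall m n : {mset I}%mset,
    {ae P, forall w,
      Ipq (size m) (size n)
        (tensor_product (multi_tensor (complex_dot dot) xi m)
           (multi_tensor (complex_dot dot) (fun k => cconj (xi k)) n)) w =
      \prod_(k <- (finsupp m `|` finsupp n)%fset)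
        ((Num.sqrt 2)%:C ^- (m k + n k) *
         J (m k) (n k) ((Num.sqrt 2)%:C * complex_isonormal X Y (xi k) w))}
}.

End Gaussian.

(* Main.v *)
Require Import Defs.
From mathcomp Require Import all_boot all_order all_algebra perm ring lra zify.
From mathcomp Require Import finmap multiset complex.
From mathcomp Require Import all_classical all_reals all_analysis.
From mathcomp Require Import measurable_realfun.

Set Implicit Arguments.
Unset Strict Implicit.
Unset Printing Implicit Defensive.

Import Order.TTheory GRing.Theory Num.Theory.
Import numFieldNormedType.Exports.

Local Open Scope classical_set_scope.
Local Open Scope ring_scope.
Local Open Scope complex_scope.

(** Both sides are linear and L^2-continuous in the kernel, so it suffices to
    treat g = v^{(x) p} with v = (f, h) in a dense subspace: the kernels
    e_{s 1} (x) ... (x) e_{s p} over an orthonormal basis span a dense subspace,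
    and polarization turns their symmetrizations into powers. Put u = f - i h,
    so that W(v) = sqrt 2 Re Z(u) and
      g_{k,p-k} = 2^{-p/2} C(p,k) u^{(x) k} (x) conj(u)^{(x) (p-k)}.
    For v of norm 1, I_p(v^{(x) p}) = H_p(W(v)), and I_{k,p-k} maps
    u^{(x) k} (x) conj(u)^{(x) (p-k)} to 2^{-p/2} J_{k,p-k}(sqrt 2 Z(u)), so the
    claim becomes 2^p H_p(sqrt 2 Re z) = sum_k C(p,k) J_{k,p-k}(sqrt 2 z), the
    coefficient of t^p in the generating functions at lambda = t real.

    The integrals are prescribed on two unrelated bases, eta and xi. The complex
    side is computed exactly when u is a finite combination of the xi_k; the
    real side is computed exactly on finite combinations of the eta_k and then
    carried over to every v by an almost sure limit. *)

(** * Hermite polynomials and sums over words *)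

(** No vector is ever normalized: the variance is carried as an extra argument of the Hermite
    polynomials, so the integral of the p-th power of v is [hermite p (W v w) (D v v)]. Powers of
    linear combinations are expanded over words, that is maps from positions to letters, instead of
    multi-indices. The integral of a symmetrized word depends only on its letter counts, and the
    three-term recursion sums these values in closed form.

    The dense subspace has to be adapted to the complex side. The conjugates of the vectors xi_k and
    i xi_k form a real orthonormal basis of the direct sum, and for v finite in it the vector u is
    finite in xi, although v need not be finite in eta.

    The integrals are known only up to null sets. Approximations are therefore chosen at a geometric
    rate, so that their squared errors have a summable expectation and almost sure limits exist
    without passing to subsequences. The Hilbert-Schmidt norm is a supremum over orthonormal
    systems; complex and real norms are compared through families that merely satisfy Bessel's
    inequality. *)

Section FunctionsOnOrdinals.
Variables (A : Type) (n : nat).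

Definition fcons (a : A) (x : 'I_n -> A) (l : 'I_n.+1) : A :=
  if unlift ord0 l is Some i then x i else a.

Lemma fcons0 a x : fcons a x ord0 = a.
Proof. by rewrite /fcons unlift_none. Qed.

Lemma fconsS a x i : fcons a x (lift ord0 i) = x i.
Proof. by rewrite /fcons liftK. Qed.

Lemma fcons_eta (x : 'I_n.+1 -> A) : fcons (x ord0) (x \o lift ord0) = x.
Proof.
by apply/funext => l; case: (unliftP ord0 l) => [i|] ->; rewrite ?fcons0 ?fconsS.
Qed.

End FunctionsOnOrdinals.

Lemma comp_fcons (A B : Type) n (f : A -> B) a (x : 'I_n -> A) :
  f \o fcons a x = fcons (f a) (f \o x).
Proof. by apply/funext => l /=; rewrite /fcons; case: unlift. Qed.

Lemma sum_fcons (V : nmodType) (J : finType) n (G : ('I_n.+1 -> J) -> V) :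
  \sum_(t : {ffun 'I_n.+1 -> J}) G t =
  \sum_j \sum_(t : {ffun 'I_n -> J}) G (fcons j t).
Proof.
rewrite pair_big /= (reindex (fun p : J * {ffun 'I_n -> J} =>
  [ffun l => fcons p.1 p.2 l])) /=; last first.
  exists (fun t : {ffun 'I_n.+1 -> J} => (t ord0, [ffun i => t (lift ord0 i)])).
    move=> [j t] _ /=; rewrite ffunE fcons0; congr pair.
    by apply/ffunP => i; rewrite !ffunE fconsS.
  move=> t _; apply/ffunP => l; rewrite ffunE /=.
  by case: (unliftP ord0 l) => [i|] ->; rewrite ?fcons0 ?fconsS ?ffunE.
apply: eq_bigr => -[j t] _ /=; congr G.
by apply/funext => l; rewrite ffunE.
Qed.

Lemma sum_ffun0 (V : nmodType) (J : finType) (G : ('I_0 -> J) -> V) (x : 'I_0 -> J) :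
  \sum_(t : {ffun 'I_0 -> J}) G t = G x.
Proof.
rewrite (big_pred1 [ffun i => x i]) => [|t].
  by congr G; apply/funext => -[].
by apply/esym/eqP/ffunP => -[].
Qed.

Section HermitePolynomials.
Variable K : comNzRingType.
Implicit Types (x z w r : K).

(* The coefficient of [t^n / n!] in [exp (t x - r t^2 / 2)]; the variance [r]
   makes the polynomials homogeneous. *)
Fixpoint hermite n x r : K :=
  if n is n1.+1 then
    x * hermite n1 x r -
      (if n1 is n2.+1 then n1%:R * r * hermite n2 x r else 0)
  else 1.

Lemma hermiteS n x r :
  hermite n.+1 x r = x * hermite n x r - n%:R * r * hermite n.-1 x r.
Proof. by case: n => [|n] //; rewrite /= !mul0r. Qed.

(* The coefficient of [a^p b^q / (p! q!)] in [exp (a z + b w - r a b)]. *)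
Fixpoint chermite p q z w r : K :=
  if p is p1.+1 then
    z * chermite p1 q z w r - q%:R * r * chermite p1 q.-1 z w r
  else w ^+ q.

Lemma chermiteSl p q z w r :
  chermite p.+1 q z w r =
  z * chermite p q z w r - q%:R * r * chermite p q.-1 z w r.
Proof. by []. Qed.

(** [chermite] recurses on [p] only, so the symmetric recursion has to be proved; it amounts to
    differentiating exp (a z + b w - r a b) in b instead of a. *)
Lemma chermiteSr p q z w r :
  chermite p q.+1 z w r =
  w * chermite p q z w r - p%:R * r * chermite p.-1 q z w r.
Proof.
elim: p q => [|p IH] q; first by rewrite /= exprS !mul0r subr0.
(* The factors [q%:R] and [p%:R] annihilate the boundary cases in which the predecessor is
   truncated. *)
have E1 : q%:R * chermite p q z w r =
    q%:R * (w * chermite p q.-1 z w r - p%:R * r * chermite p.-1 q.-1 z w r).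
  by case: q => [|q]; rewrite ?mul0r // IH.
have E2 : p%:R * (z * chermite p.-1 q z w r) =
    p%:R * (chermite p q z w r + q%:R * r * chermite p.-1 q.-1 z w r).
  by case: p {IH E1} => [|p]; rewrite ?mul0r // chermiteSl subrK.
rewrite !chermiteSl IH /= -!natr1.
transitivity (z * w * chermite p q z w r - r * (p%:R * (z * chermite p.-1 q z w r))
  - r * (q%:R * chermite p q z w r) - r * chermite p q z w r); first by ring.
by rewrite E1 E2; ring.
Qed.

Lemma hermite_homog n a x r : hermite n (a * x) (a ^+ 2 * r) = a ^+ n * hermite n x r.
Proof.
elim/ltn_ind: n => -[|n] IH; first by rewrite /= mul1r.
rewrite !hermiteS IH //.
case: n IH => [|n] IH; first by rewrite !mul0r !subr0 exprS; ring.
by rewrite IH //= !exprS; ring.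
Qed.

Lemma chermite_homog p q a b z w r :
  chermite p q (a * z) (b * w) (a * b * r) = a ^+ p * b ^+ q * chermite p q z w r.
Proof.
elim: p q => [|p IH] q; first by rewrite /= exprMn mul1r.
rewrite !chermiteSl !IH.
by case: q => [|q] /=; rewrite ?mul0r ?subr0 !exprS; ring.
Qed.

(** * Sums over words and addition formulas *)

Section Words.
Variables (I : finType) (c : I -> K).
Implicit Types (m : I -> nat) (G : (I -> nat) -> K).

Definition incr k m i := (m i + (i == k))%N.
Definition decr k m i := (m i - (i == k))%N.

Lemma incrE k m : incr k m k = (m k).+1.
Proof. by rewrite /incr eqxx addn1. Qed.

Lemma decrE k m : decr k m k = (m k).-1.
Proof. by rewrite /decr eqxx subn1. Qed.

Lemma incrN k m i : i != k -> incr k m i = m i.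
Proof. by move=> /negbTE ik; rewrite /incr ik addn0. Qed.

Lemma decrN k m i : i != k -> decr k m i = m i.
Proof. by move=> /negbTE ik; rewrite /decr ik subn0. Qed.

(** A sum over all words of length [n], weighted by the product of the [c] of their letters, of a
    function of the letter counts. Each multi-index is reached as often as its multinomial
    coefficient says, so none has to be written. *)
Fixpoint word_sum n G : K :=
  if n is n'.+1 then \sum_k c k * word_sum n' (fun m => G (incr k m))
  else G (fun=> 0%N).

Lemma word_sumE n G :
  word_sum n G = \sum_(s : {ffun 'I_n -> I})
    (\prod_l c (s l)) * G (fun k => \sum_l (s l == k))%N.
Proof.
elim: n G => [|n IH] G.
  rewrite (@sum_ffun0 _ _ (fun s => (\prod_l c (s l)) * G (fun k => \sum_l (s l == k))%N)
    (fun i => False_rect _ (notF (valP i)))) big_ord0 mul1r.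
  by congr G; apply/funext => k; rewrite big_ord0.
rewrite (@sum_fcons _ _ _ (fun s => (\prod_l c (s l)) * G (fun k => \sum_l (s l == k))%N)).
rewrite [LHS]/=; apply: eq_bigr => k _; rewrite IH mulr_sumr; apply: eq_bigr => s _.
rewrite big_ord_recl fcons0 mulrA; congr (_ * _ * G _).
  by apply: eq_bigr => l _; rewrite fconsS.
apply/funext => j; rewrite big_ord_recl fcons0 addnC /incr eq_sym; congr (_ + _)%N.
by apply: eq_bigr => l _; rewrite fconsS.
Qed.

Lemma word_sumD n G1 G2 :
  word_sum n (fun m => G1 m + G2 m) = word_sum n G1 + word_sum n G2.
Proof.
elim: n G1 G2 => [|n IH] G1 G2 //=.
by rewrite -big_split; apply: eq_bigr => k _; rewrite IH mulrDr.
Qed.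

Lemma word_sumZ n a G : word_sum n (fun m => a * G m) = a * word_sum n G.
Proof.
elim: n G => [|n IH] G //=.
by rewrite mulr_sumr; apply: eq_bigr => k _; rewrite IH mulrCA.
Qed.

(** Weighting by the count of [k] amounts to marking one of [n] positions; deleting the marked
    letter leaves a word of length [n.-1] and releases the factor [c k]. *)
Lemma word_sum_count n k G :
  word_sum n (fun m => (m k)%:R * G (decr k m)) = n%:R * c k * word_sum n.-1 G.
Proof.
have decrK m : decr k (incr k m) = m by apply/funext => i; rewrite /decr /incr addnK.
elim: n G => [|n IH] G /=; first by rewrite !mul0r.
(* The new letter [j] is either the marked one, deleted at once, or it commutes with the deletion of
   an older [k]. *)
have E j m : (incr j m k)%:R * G (decr k (incr j m)) =
    (if j == k then G m else 0) + (m k)%:R * G (incr j (decr k m)).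
  rewrite {1}/incr natrD mulrDl addrC.
  rewrite eq_sym; case: (eqVneq j k) => [->|jk].
    rewrite decrK mul1r; congr (_ + _).
    case mk : (m k) => [|a]; first by rewrite !mul0r.
    congr (_ * G _); apply/funext => i; rewrite /incr /decr.
    by case: eqVneq => [->|]; rewrite ?mk ?subn0 ?addn0 //= subn1 addn1.
  rewrite mul0r !add0r; congr (_ * G _).
  apply/funext => i; rewrite /incr /decr.
  by case: (eqVneq i j) => [->|]; rewrite ?(negbTE jk) ?subn0 ?addn0.
rewrite (eq_bigr (fun j => c j * word_sum n (fun m => if j == k then G m else 0) +
    c j * (n%:R * c k * word_sum n.-1 (fun m => G (incr j m))))); last first.
  move=> j _; rewrite -mulrDr -(IH (fun m => G (incr j m))) -word_sumD.
  by congr (_ * word_sum _ _); apply/funext => m; rewrite E.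
rewrite big_split /= (bigD1 k) //= eqxx big1 ?addr0; last first.
  move=> j /negbTE->; rewrite (_ : (fun=> 0) = fun m => 0 * G m).
    by rewrite word_sumZ mul0r mulr0.
  by apply/funext => m; rewrite mul0r.
case: n {IH} => [|n] /=; last first.
  rewrite [X in _ + X = _](eq_bigr (fun j => n.+1%:R * c k * (c j * word_sum n (fun m => G (incr j
    m)))));
    last by move=> j _; rewrite /= mulrCA.
  by rewrite -mulr_sumr /= -(addn1 n.+1) natrD; ring.
by rewrite big1 ?addr0 ?mul1r // => j _; rewrite !mul0r mulr0.
Qed.

(** Addition formula for variables of variances [r k]. The recursion of [hermite] in slot [k]
    produces a count times a deletion, which [word_sum_count] converts into the correction term of
    the recursion at the sum. *)
Lemma word_sum_hermite n (y r : I -> K) :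
  word_sum n (fun m => \prod_k hermite (m k) (y k) (r k)) =
  hermite n (\sum_k c k * y k) (\sum_k c k ^+ 2 * r k).
Proof.
set G := fun m => _.
have GE k m : G (incr k m) = y k * G m - r k * ((m k)%:R * G (decr k m)).
  rewrite /G (bigD1 k) //= [in y k * _](bigD1 k) //= [in r k * _](bigD1 k) //=.
  rewrite incrE decrE hermiteS.
  rewrite (eq_bigr (fun i => hermite (m i) (y i) (r i))); last first.
    by move=> i ik; rewrite incrN.
  rewrite [X in r k * (_ * (_ * X))](eq_bigr (fun i => hermite (m i) (y i) (r i))); last first.
    by move=> i ik; rewrite decrN.
  by ring.
elim/ltn_ind: n => -[|n] IH; first by rewrite /= /G big1.
rewrite hermiteS -IH //=.
rewrite (eq_bigr (fun k => (c k * y k) * word_sum n G -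
   n%:R * (c k ^+ 2 * r k) * word_sum n.-1 G)); last first.
  move=> k _; rewrite (_ : (fun m => _) = fun m => y k * G m +
     (- r k) * ((m k)%:R * G (decr k m))); last first.
    by apply/funext => m; rewrite GE mulNr.
  by rewrite word_sumD !word_sumZ word_sum_count; ring.
rewrite sumrB -!mulr_suml -mulr_sumr; congr (_ - _).
case: n IH => [|n] IH; first by rewrite !mul0r.
by rewrite IH.
Qed.

End Words.

Lemma word_sum_exp (I : finType) (c : I -> K) n (w : I -> K) :
  word_sum c n (fun m => \prod_k w k ^+ m k) = (\sum_k c k * w k) ^+ n.
Proof.
elim: n => [|n IH]; first by rewrite /= big1.
rewrite /= exprS mulr_suml; apply: eq_bigr => k _; rewrite -IH -mulrA.
congr (_ * _); rewrite -word_sumZ; congr word_sum; apply/funext => m.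
rewrite (bigD1 k) //= [in RHS](bigD1 k) //= incrE exprS mulrA.
by congr (_ * _); apply: eq_bigr => i ik; rewrite incrN.
Qed.

(** A new letter [k] of the first word either multiplies by [z k] or deletes a [k] from the second
    word, whence the product [c k * c' k]. The base case of the induction on [n] is the multinomial
    theorem. *)
Lemma word_sum_chermite (I : finType) (c c' z w r : I -> K) n n' :
  word_sum c n (fun m => word_sum c' n' (fun m' =>
    \prod_k chermite (m k) (m' k) (z k) (w k) (r k))) =
  chermite n n' (\sum_k c k * z k) (\sum_k c' k * w k)
    (\sum_k c k * c' k * r k).
Proof.
set G := fun m m' => \prod_k chermite (m k) (m' k) (z k) (w k) (r k).
have GE k m m' : G (incr k m) m' = z k * G m m' + - r k * ((m' k)%:R * G m (decr k m')).
  rewrite /G (bigD1 k) //= [in z k * _](bigD1 k) //= [in - r k * _](bigD1 k) //=.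
  rewrite incrE decrE chermiteSl.
  rewrite (eq_bigr (fun i => chermite (m i) (m' i) (z i) (w i) (r i))); last first.
    by move=> i ik; rewrite incrN.
  rewrite [X in - r k * (_ * (_ * X))](eq_bigr
      (fun i => chermite (m i) (m' i) (z i) (w i) (r i))); last first.
    by move=> i ik; rewrite decrN.
  by ring.
elim: n n' => [|n IH] n' /=; first exact: word_sum_exp.
rewrite -!IH.
rewrite (eq_bigr (fun k => (c k * z k) * word_sum c n (fun m => word_sum c' n' (G m)) -
   n'%:R * (c k * c' k * r k) * word_sum c n (fun m => word_sum c' n'.-1 (G m)))).
  by rewrite sumrB -!mulr_suml -mulr_sumr.
move=> k _; rewrite (_ : (fun m => _) = fun m => z k * word_sum c' n' (G m) +
     (- r k * (n'%:R * c' k)) * word_sum c' n'.-1 (G m)); last first.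
  apply/funext => m; rewrite -mulrA -word_sum_count -!word_sumZ -word_sumD.
  by congr word_sum; apply/funext => m'; rewrite -GE.
by rewrite word_sumD !word_sumZ; ring.
Qed.

(** The alphabet with two letters brings binomial sums within reach of [word_sum_count]. *)
Lemma word_sum_bool n (u : nat -> nat -> K) :
  word_sum (fun=> 1) n (fun m : bool -> nat => u (m true) (m false)) =
  \sum_(k < n.+1) 'C(n, k)%:R * u k (n - k)%N.
Proof.
elim: n u => [|n IH] u; first by rewrite big_ord1 /= bin0 mul1r.
rewrite /= big_bool /= !mul1r /incr /=.
rewrite (_ : (fun m : bool -> nat => _) = (fun m => (fun a b => u a.+1 b) (m true) (m false)));
  last by apply/funext => m; rewrite addn1 addn0.
rewrite [X in _ + word_sum _ _ X](_ : _ = (fun m => (fun a b => u a b.+1) (m true) (m false)));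
  last by apply/funext => m; rewrite addn1 addn0.
rewrite (IH (fun a b => u a.+1 b)) (IH (fun a b => u a b.+1)).
rewrite [RHS]big_ord_recl [X in _ = _ + X](eq_bigr (fun k : 'I_n.+1 =>
   'C(n, k)%:R * u k.+1 (n - k)%N + 'C(n, k.+1)%:R * u k.+1 (n - k)%N)); last first.
  by move=> k _; rewrite lift0 subSS binS natrD mulrDl addrC.
rewrite big_split /= addrCA; congr (_ + _).
rewrite big_ord_recl [in RHS]big_ord_recr /= (bin_small (ltnSn n)) mul0r addr0 !bin0 !subn0.
by congr (_ + _); apply: eq_bigr => k _; rewrite -subSn ?subSS.
Qed.

(** At a = b = t the generating function exp (a z + b w - r a b) becomes exp (t (z + w) - (2 r) t^2
    / 2). In the recursion, each of the two letters deletes one of the other kind, so the correction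
    term occurs twice. *)
Lemma sum_chermite n z w r :
  \sum_(k < n.+1) 'C(n, k)%:R * chermite k (n - k) z w r =
  hermite n (z + w) (2 * r).
Proof.
rewrite -(word_sum_bool n (fun a b => chermite a b z w r)).
set G := fun m : bool -> nat => chermite (m true) (m false) z w r.
elim/ltn_ind: n => -[|n] IH; first by [].
rewrite hermiteS -IH //= big_bool !mul1r.
have -> : (fun m => G (incr true m)) =
    fun m => z * G m + - r * ((m false)%:R * G (decr false m)).
  by apply/funext => m; rewrite /G /incr /decr /= addn0 addn1 subn0 subn1 chermiteSl; ring.
have -> : (fun m => G (incr false m)) =
    fun m => w * G m + - r * ((m true)%:R * G (decr true m)).
  by apply/funext => m; rewrite /G /incr /decr /= addn0 addn1 subn0 subn1 chermiteSr; ring.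
rewrite !word_sumD !word_sumZ !word_sum_count /=.
case: n IH => [|n] IH; first by ring.
by rewrite -IH //=; ring.
Qed.

End HermitePolynomials.

(** * Generating functions *)

Section PowerSeries.
Variable R : realType.
Implicit Types (c : R^nat) (t x : R).

Lemma cvg_pseries_diffs c : (forall t, cvgn (pseries c t)) ->
  forall t, cvgn (pseries (pseries_diffs c) t).
Proof.
move=> cvg_c t; apply: normed_cvg.
(* The factor 2 absorbs [n.+1 <= 2 ^+ n]; the summand 1 gives [1 <= z], used to pass from [z ^+ n]
   to [z ^+ n.+1]. *)
set z := 2 * `|t| + 1; have z_ge1 : 1 <= z by rewrite /z lerDr mulr_ge0.
have z_ge0 : 0 <= z := le_trans ler01 z_ge1.
have : cvgn (pseries (fun i => `|c i|) z).
  apply: (@is_cvg_pseries_inside_norm _ _ (z + 1)) => //.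
  by rewrite !ger0_norm ?ltrDl //; lra.
rewrite -(@cvg_shiftS _ (pseries _ z)) => cvg_z.
have {}cvg_z : cvgn (series (fun n => `|c n.+1| * z ^+ n.+1)).
  rewrite (_ : series _ = (fun n => pseries (fun i => `|c i|) z n.+1 - `|c 0|)).
    by apply: is_cvgB; [exact: cvgP cvg_z|exact: is_cvg_cst].
  apply/funext => n; rewrite /pseries /series /= big_nat_recl // expr0 mulr1.
  by rewrite [RHS]addrC addKr.
have norm_le n : `|pseries_diffs c n * t ^+ n| <= `|c n.+1| * z ^+ n.+1.
  rewrite /pseries_diffs normrM normrX normrM (ger0_norm (ler0n _ _)).
  rewrite [n.+1%:R * _]mulrC -mulrA ler_wpM2l //.
  have n_le : n.+1%:R <= 2 ^+ n :> R by rewrite -natrX ler_nat ltn_expl.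
  apply: (@le_trans _ _ ((2 * `|t|) ^+ n)).
    by rewrite exprMn ler_wpM2r // exprn_ge0.
  apply: (@le_trans _ _ (z ^+ n)); last by rewrite exprS ler_peMl // exprn_ge0.
  by apply: lerXn2r; rewrite ?nnegrE ?mulr_ge0 // /z lerDl.
apply: (series_le_cvg _ _ norm_le cvg_z) => // n.
by rewrite mulr_ge0 // exprn_ge0.
Qed.

Lemma is_derive_pseries c : (forall t, cvgn (pseries c t)) ->
  forall t, is_derive t 1 (fun x => limn (pseries c x)) (limn (pseries (pseries_diffs c) t)).
Proof.
move=> cvg_c t; have cvg_d := cvg_pseries_diffs cvg_c.
apply: (@pseries_snd_diffs _ c (`|t| + 1)) => //; first exact: cvg_pseries_diffs.
by rewrite [ltRHS]ger0_norm ?ltrDl // addr_ge0.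
Qed.

Lemma cvg_pseries0 c : pseries c 0 @ \oo --> c 0%N.
Proof.
rewrite -cvg_shiftS (_ : [sequence _]_n = cst (c 0%N)); first exact: cvg_cst.
apply/funext => n; rewrite /pseries /series /= big_nat_recl // expr0 mulr1.
by rewrite big1 ?addr0 // => i _; rewrite expr0n mulr0.
Qed.

(** The zero function is differentiated repeatedly: up to a nonzero factor, [c n] is the value at 0
    of its n-th derivative. *)
Lemma pseries_eq0 c : (forall t, pseries c t @ \oo --> 0) -> forall n, c n = 0.
Proof.
have diffs0 b : (forall t, pseries b t @ \oo --> 0) ->
    forall t, pseries (pseries_diffs b) t @ \oo --> 0.
  move=> b0 t; have cvg_b s : cvgn (pseries b s) by apply: cvgP (b0 s).
  have := is_derive_pseries cvg_b t.
  rewrite (_ : (fun x => _) = cst 0); last first.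
    by apply/funext => s; apply/cvg_lim => //; exact: b0.
  move=> /(@derive_val _ _ _ _ _ _ _); rewrite derive_cst => d0.
  rewrite [X in _ --> X]d0; exact: cvg_pseries_diffs.
have coef0 b : (forall t, pseries b t @ \oo --> 0) -> b 0%N = 0.
  by move=> /(_ 0) b0; rewrite -(cvg_lim (@Rhausdorff R) (@cvg_pseries0 b)); exact: cvg_lim.
move=> c0 n; elim: n c c0 => [|n IH] c c0; first exact: coef0.
have /eqP := IH _ (diffs0 _ c0).
by rewrite /pseries_diffs mulf_eq0 pnatr_eq0 /= => /eqP.
Qed.

Lemma pseries_inj c1 c2 (s : R -> R) : (forall t, pseries c1 t @ \oo --> s t) ->
  (forall t, pseries c2 t @ \oo --> s t) -> c1 =1 c2.
Proof.
move=> h1 h2 n; apply/eqP; rewrite -subr_eq0; apply/eqP.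
apply: (@pseries_eq0 (fun n => c1 n - c2 n)) => t.
rewrite -(subrr (s t)) (_ : pseries _ t = (fun n => pseries c1 t n - pseries c2 t n)).
  by apply: cvgB; [exact: h1|exact: h2].
apply/funext => k; rewrite /pseries /series /= -sumrB.
by apply: eq_bigr => i _; rewrite mulrBl.
Qed.

Section Hermite.
Variable He : nat -> R -> R.
Hypothesis He_hermite : hermite_polynomials He.

(** The generating function f solves f' = (x - t) f; comparing coefficients yields the three-term
    recursion of [hermite]. *)
Lemma hermite_polynomialsE n x : He n x = hermite n x 1.
Proof.
pose c n := (n`!)%:R^-1 * He n x; pose f t := expR (t * x - t ^+ 2 / 2).
have cvg_c t : pseries c t @ \oo --> f t.
  rewrite (_ : pseries c t = series (fun n => t ^+ n / n`!%:R * He n x)); first exact: He_hermite.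
  by rewrite /pseries; congr series; apply/funext => k; rewrite /c /= mulrC mulrA.
have df t : is_derive t 1 f ((x - t) * f t).
  have dg : is_derive t 1 (fun s : R => s * x - s ^+ 2 / 2) (x - t).
    by apply: is_derive_eq; rewrite !scaler0 !add0r /GRing.scale /=; field.
  rewrite mulrC; exact: is_derive1_comp.
have cvg_d t : pseries (pseries_diffs c) t @ \oo --> (x - t) * f t.
  have cvg_c' s : cvgn (pseries c s) := cvgP _ (cvg_c s).
  have := is_derive_pseries cvg_c' t.
  rewrite (_ : (fun x => _) = f); last by apply/funext => s; apply/cvg_lim.
  move=> /(@derive_val _ _ _ _ _ _ _); rewrite (@derive_val _ _ _ _ _ _ _ (df t)) => ->; exact:
    cvg_pseries_diffs.
(* Coefficients of (x - t) f: multiplication by t shifts the sequence and leaves 0 in degree 0. *)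
pose d n := x * c n - (if n is n'.+1 then c n' else 0).
have cvg_d' t : pseries d t @ \oo --> (x - t) * f t.
  rewrite -cvg_shiftS.
  rewrite (_ : [sequence _]_n = fun n => x * pseries c t n.+1 - t * pseries c t n).
    rewrite mulrBl; apply: cvgB; apply: cvgMr; last exact: cvg_c.
    by rewrite (@cvg_shiftS _ (pseries c t)); exact: cvg_c.
  apply/funext => k; rewrite /pseries /series /= !mulr_sumr.
  rewrite [X in _ = X - _]big_nat_recl // big_nat_recl //= /d subr0 mulrA -addrA.
  by congr (_ + _); rewrite -sumrB; apply: eq_bigr => i _; rewrite exprS; ring.
have dE := pseries_inj cvg_d cvg_d'.
have He0 : He 0%N x = 1.
  have := cvg_lim (@Rhausdorff R) (cvg_c 0).
  rewrite (cvg_lim (@Rhausdorff R) (@cvg_pseries0 c)).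
  by rewrite /c /f mul0r expr0n mul0r subr0 expR0 fact0 invr1 mul1r => ->.
have HeS k : He k.+1 x = x * He k x - k%:R * He k.-1 x.
  have := dE k; rewrite /pseries_diffs /d /c factS natrM invfM.
  rewrite mulrA mulrA divff ?pnatr_eq0 // mul1r => E.
  have fk : (k`!)%:R != 0 :> R by rewrite pnatr_eq0 -lt0n fact_gt0.
  rewrite -[LHS](mulVKf fk) E.
  case: k fk {E} => [|k] fk; first by rewrite !subr0 mul0r subr0 mulrCA mulVKf.
  rewrite mulrBr mulrCA mulVKf //; congr (_ - _).
  rewrite factS natrM /= -mulrA mulVKf // pnatr_eq0 -lt0n fact_gt0 //.
elim/ltn_ind: n => -[|n] IH //.
rewrite HeS hermiteS !mulr1 IH //; case: n IH => [|n] IH; first by rewrite !mul0r.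
by rewrite IH.
Qed.
End Hermite.

End PowerSeries.

Lemma hermite_rmorph (K L : comNzRingType) (f : {rmorphism K -> L}) n x r :
  f (hermite n x r) = hermite n (f x) (f r).
Proof.
elim/ltn_ind: n => -[|n] IH; first by rewrite rmorph1.
rewrite !hermiteS rmorphB !rmorphM rmorph_nat IH //.
by case: n IH => [|n] IH; rewrite ?mul0r // IH.
Qed.

Section ComplexNumbers.
Variable R : rcfType.
Implicit Types (x y : R[i]).

Lemma normc_sqr x : Normc.normc x ^+ 2 = complex.Re x ^+ 2 + complex.Im x ^+ 2.
Proof. by case: x => a b /=; rewrite sqr_sqrtr // addr_ge0 // sqr_ge0. Qed.

Lemma normc_ge0 x : 0 <= Normc.normc x.
Proof. by case: x => a b; exact: sqrtr_ge0. Qed.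

Lemma Re_le_normc x : `|complex.Re x| <= Normc.normc x.
Proof. by case: x => a b; rewrite /= -sqrtr_sqr ler_wsqrtr // lerDl sqr_ge0. Qed.

Lemma Im_le_normc x : `|complex.Im x| <= Normc.normc x.
Proof. by case: x => a b; rewrite /= -sqrtr_sqr ler_wsqrtr // lerDr sqr_ge0. Qed.

Lemma ReD x y : complex.Re (x + y) = complex.Re x + complex.Re y.
Proof. by case: x y => [a b] [c d]. Qed.

Lemma ImD x y : complex.Im (x + y) = complex.Im x + complex.Im y.
Proof. by case: x y => [a b] [c d]. Qed.

Lemma ReZ (a : R) x : complex.Re (a%:C * x) = a * complex.Re x.
Proof. by case: x => b c /=; rewrite mul0r subr0. Qed.

Lemma ImZ (a : R) x : complex.Im (a%:C * x) = a * complex.Im x.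
Proof. by case: x => b c /=; rewrite mul0r addr0. Qed.

Lemma Re_sum I (s : seq I) (P : pred I) (F : I -> R[i]) :
  complex.Re (\sum_(i <- s | P i) F i) = \sum_(i <- s | P i) complex.Re (F i).
Proof. by apply: (big_morph _ ReD). Qed.

Lemma Im_sum I (s : seq I) (P : pred I) (F : I -> R[i]) :
  complex.Im (\sum_(i <- s | P i) F i) = \sum_(i <- s | P i) complex.Im (F i).
Proof. by apply: (big_morph _ ImD). Qed.

End ComplexNumbers.

(** * Identification of the complex Hermite polynomials *)

Section HermiteSeries.
Variables (R : realType) (He : nat -> R -> R).
Hypothesis He_hermite : hermite_polynomials He.

Lemma cvg_hermite (y s t : R) : s != 0 ->
  pseries (fun n => (n`!)%:R^-1 * hermite n y (s ^+ 2)) t @ \oo -->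
    expR (t * y - t ^+ 2 * s ^+ 2 / 2).
Proof.
move=> s0; have := @He_hermite (t * s) (y / s).
rewrite exprMn (_ : t * s * (y / s) = t * y); last by field.
rewrite (_ : series _ = pseries (fun n => n`!%:R^-1 * hermite n y (s ^+ 2)) t) //.
rewrite /pseries; congr series; apply/funext => n /=.
rewrite (hermite_polynomialsE He_hermite).
have -> : hermite n y (s ^+ 2) = s ^+ n * hermite n (y / s) 1.
  by rewrite -hermite_homog mulr1 mulrC divfK.
by rewrite exprMn; ring.
Qed.

(** An unordered sum may be evaluated along any exhaustion; triangles collect the terms of equal
    total degree and turn the double series into a power series. *)
Lemma has_sum_triangle (u : nat * nat -> R[i]) s : has_sum u s ->
  forall eps : R, 0 < eps -> exists N0, forall N, (N0 <= N)%N ->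
    Normc.normc (\sum_(0 <= n < N) \sum_(k < n.+1) u (nat_of_ord k, n - k)%N - s) < eps.
Proof.
(* One more than the largest total degree in [A0], so that the triangle contains [A0]. *)
move=> us eps /us[A0 HA]; exists (\max_(i <- A0) (i.1 + i.2)).+1 => N leN.
pose tri := [seq (k, n - k)%N | n <- iota 0 N, k <- iota 0 n.+1].
have tri_uniq : uniq tri.
  apply: allpairs_uniq_dep => [|n _|]; try exact: iota_uniq.
  move=> [n k] [n' k'] /allpairsPdep[m [j [_ jm [-> ->]]]].
  move=> /allpairsPdep[m' [j' [_ jm' [-> ->]]]] /= [jj' E].
  rewrite !mem_iota in jm jm'.
  have mm' : m = m' by lia.
  by rewrite mm' jj'.
have := HA [fset x in tri]%fset; rewrite (perm_big tri) /=; last first.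
  by apply: uniq_perm; rewrite ?fset_uniq // => i; rewrite inE.
rewrite big_allpairs_dep /= /index_iota subn0.
rewrite (eq_bigr (fun n => \sum_(k < n.+1) u (nat_of_ord k, n - k)%N)) => [|n _]; last first.
  by rewrite -[0%N :: _]/(index_iota 0 n.+1) big_mkord.
apply; apply/fsubsetP => -[a b] abA; rewrite inE /=; apply/allpairsPdep.
exists (a + b)%N, a; rewrite !mem_iota /= add0n ltnS leq_addr addKn; split => //.
apply: leq_trans leN; rewrite ltnS.
exact: (@leq_bigmax_seq _ (enum_fset A0) predT (fun i => (i.1 + i.2)%N) (a, b)).
Qed.

Variable J : nat -> nat -> R[i] -> R[i].
Hypothesis J_hermite : complex_hermite_polynomials J.

(** The coefficient of t^n in the generating function of [J] at t l, for real t. *)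
Definition hermite_form (l z : R[i]) n : R[i] :=
  \sum_(k < n.+1) l^* ^+ k * l ^+ (n - k) / ((k`!)%:R * ((n - k)`!)%:R) * J k (n - k) z.

Lemma cvg_hermite_form (l z : R[i]) (t : R) :
  let s := expR (t * complex.Re (l * z^* + l^* * z) -
                 t ^+ 2 * (2 * Normc.normc l) ^+ 2 / 2) in
  pseries (fun n => complex.Re (hermite_form l z n)) t @ \oo --> s /\
  pseries (fun n => complex.Im (hermite_form l z n)) t @ \oo --> 0.
Proof.
move=> s; have := @J_hermite (t%:C * l) z.
set u := fun pq : nat * nat => _.
have -> : complex.Re (t%:C * l * z^* + (t%:C * l)^* * z - 2 * `|t%:C * l| ^+ 2) =
    t * complex.Re (l * z^* + l^* * z) - t ^+ 2 * (2 * Normc.normc l) ^+ 2 / 2.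
  have -> : `|t%:C * l| ^+ 2 = (Normc.normc (t%:C * l) ^+ 2)%:C by rewrite rmorphXn.
  rewrite exprMn !normc_sqr; case: l z {s u} => [a b] [c d] /=; field => //.
move=> /has_sum_triangle tri.
have E N : \sum_(0 <= n < N) \sum_(k < n.+1) u (nat_of_ord k, n - k)%N =
    \sum_(0 <= n < N) (t ^+ n)%:C * hermite_form l z n.
  apply: eq_bigr => n _; rewrite /hermite_form mulr_sumr; apply: eq_bigr => k _.
  have conj_tl : Num.conj (t%:C * l) = t%:C * Num.conj l.
    by case: (l) => a b; apply/eqP; rewrite eq_complex /=; apply/andP; split; apply/eqP; ring.
  rewrite /u /= conj_tl !exprMn rmorphXn.
  rewrite -[X in t%:C ^+ X * (_ / _ * _)](subnKC (_ : k <= n)%N) ?exprD; last by rewrite -ltnS.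
  by ring.
split; apply/cvgrPdist_lt => eps /tri[N0 HN]; near=> N.
  have /HN : (N0 <= N)%N by near: N; exact: nbhs_infty_ge.
  rewrite E distrC; apply: le_lt_trans; apply: le_trans; last exact: Re_le_normc.
  rewrite ReD /= Re_sum (eq_bigr (fun n => complex.Re (hermite_form l z n) * t ^+ n)) //.
  by move=> n _; rewrite ReZ mulrC.
have /HN : (N0 <= N)%N by near: N; exact: nbhs_infty_ge.
rewrite E distrC; apply: le_lt_trans; apply: le_trans; last exact: Im_le_normc.
rewrite ImD /= Im_sum (eq_bigr (fun n => complex.Im (hermite_form l z n) * t ^+ n)) ?oppr0 //.
by move=> n _; rewrite ImZ mulrC.
Unshelve. all: by end_near.
Qed.

(** Along t l the exponent is that of a real Hermite series with standard deviation 2 |l|, nonzero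
    as [cvg_hermite] requires. Uniqueness of real power series applies to the real and imaginary
    parts separately. *)
Lemma hermite_formE (l z : R[i]) n : l != 0 ->
  (n`!)%:R * hermite_form l z n =
  hermite n (l * z^* + l^* * z) (2 * (2 * (l * l^*))).
Proof.
move=> l0; set y := complex.Re (l * z^* + l^* * z).
have nl0 : 2 * Normc.normc l != 0.
  by rewrite mulf_neq0 ?pnatr_eq0 //; apply/eqP => /Normc.eq0_normc/eqP; exact/negP.
have ReE m : complex.Re (hermite_form l z m) =
    (m`!)%:R^-1 * hermite m y ((2 * Normc.normc l) ^+ 2).
  move: m; apply: (@pseries_inj _ _ _ (fun t => expR (t * y - t ^+ 2 * (2 * Normc.normc l) ^+ 2 /
    2))) => t.
    exact: (cvg_hermite_form l z t).1.
  exact: cvg_hermite.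
have ImE m : complex.Im (hermite_form l z m) = 0.
  by apply: (@pseries_eq0 _ (fun m => complex.Im (hermite_form l z m))) => t; exact:
    (cvg_hermite_form l z t).2.
have -> : hermite_form l z n = ((n`!)%:R^-1 * hermite n y ((2 * Normc.normc l) ^+ 2))%:C.
  by rewrite -ReE; case: (hermite_form l z n) (ImE n) => a b /= ->.
rewrite rmorphM fmorphV rmorph_nat mulVKf ?pnatr_eq0 -?lt0n ?fact_gt0 //.
rewrite hermite_rmorph /y; congr hermite.
  by rewrite /y; case: l z {l0 nl0 ReE ImE y} => [a b] [c d]; apply/eqP; rewrite eq_complex /=;
    apply/andP; split; apply/eqP; ring.
rewrite exprMn normc_sqr; case: l {l0 nl0 ReE ImE y} => [a b]; apply/eqP; rewrite eq_complex /=;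
  apply/andP; split; apply/eqP; ring.
Qed.

(** In degree n = p + q, [hermite_formE] and [sum_chermite] give an identity that is homogeneous in
    l and its conjugate. Divided by l^n it is a polynomial identity in their ratio, whose
    coefficients are separated by enough values of l. *)
Lemma complex_hermite_polynomialsE p q z : J p q z = chermite p q z z^* 2.
Proof.
pose n := (p + q)%N.
pose dif k := 'C(n, k)%:R * (J k (n - k) z - chermite k (n - k) z z^* 2).
have dif0 l : l != 0 -> \sum_(k < n.+1) dif k * (l^* ^+ k * l ^+ (n - k)) = 0.
  move=> l0; have := hermite_formE z n l0.
  rewrite addrC -sum_chermite => /eqP; rewrite -subr_eq0 => /eqP H.
  rewrite -[RHS]H /hermite_form mulr_sumr -sumrB; apply: eq_bigr => k _.
  have -> : 2 * (l * l^*) = l^* * l * 2 by ring.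
  rewrite chermite_homog /dif.
  have kn : (k <= n)%N by rewrite -ltnS.
  rewrite -(bin_fact kn) !natrM.
  have f0 m : (m`!)%:R != 0 :> R[i] by rewrite pnatr_eq0 -lt0n fact_gt0.
  field; rewrite !f0 //.
pose P : {poly R[i]} := \poly_(k < n.+1) dif k.
(* The ratios of conjugate to number are pairwise distinct for 1 + i j, which gives n + 1 roots of a
   polynomial of degree at most n. *)
pose x (j : nat) : R[i] := 1 +i* j%:R.
have x0 j : x j != 0 by rewrite eq_complex /= oner_eq0.
have P0 : P = 0.
  apply: (@roots_geq_poly_eq0 _ _ [seq (x j)^* / x j | j <- iota 0 n.+1]).
  - apply/allP => _ /mapP[j _ ->]; rewrite /root horner_poly.
    apply/eqP/(mulfI (expf_neq0 n (x0 j))); rewrite mulr0 -[RHS](dif0 _ (x0 j)) mulr_sumr.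
    apply: eq_bigr => k _.
    have kn : (k <= n)%N by rewrite -ltnS.
    rewrite -{1}(subnK kn) exprD exprMn exprVn.
    by field; rewrite expf_neq0.
  - rewrite map_inj_uniq ?iota_uniq // => i j /eqP.
    rewrite eqr_div // /x eq_complex /= => /andP[_ /eqP].
    rewrite !mulr1 !mul1r => /eqP.
    by move=> /eqP E; apply/eqP; rewrite -(eqr_nat R); apply/eqP; lra.
  - by rewrite size_map size_iota size_poly.
have /eqP : dif p = 0.
  by have := coef_poly n.+1 dif p; rewrite -/P P0 coef0 ltnS leq_addr.
rewrite /dif mulf_eq0 pnatr_eq0 -leqn0 leqNgt bin_gt0 leq_addr /= subr_eq0 => /eqP.
by rewrite /n addKn.
Qed.

End HermiteSeries.

(** * Real multilinear functionals *)

(** No norm is attached, so the same lemmas serve on [V] and on [V * V] with [dsum_dot]. *)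
Record real_dot (R : realType) (V : lmodType R) (dot : V -> V -> R) : Prop := {
  real_dotC : forall x y, dot x y = dot y x;
  real_dot_linear : forall a x y z, dot (a *: x + y) z = a * dot x z + dot y z;
  real_dot_ge0 : forall x, 0 <= dot x x;
  real_dot_eq0 : forall x, dot x x = 0 -> x = 0
}.

Section RealInnerProduct.
Variables (R : realType) (V : lmodType R) (dot : V -> V -> R).
Hypothesis dot_real : real_dot dot.
Implicit Types (x y z : V).

Lemma dotC x y : dot x y = dot y x.
Proof. exact: real_dotC. Qed.

Lemma dotDl x y z : dot (x + y) z = dot x z + dot y z.
Proof. by rewrite -{1}[x]scale1r (real_dot_linear dot_real) mul1r. Qed.

Lemma dot0l z : dot 0 z = 0.
Proof. by apply: (addrI (dot 0 z)); rewrite -dotDl !addr0. Qed.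

Lemma dotZl a x z : dot (a *: x) z = a * dot x z.
Proof. by rewrite -[a *: x]addr0 (real_dot_linear dot_real) dot0l addr0. Qed.

Lemma dotDr x y z : dot x (y + z) = dot x y + dot x z.
Proof. by rewrite dotC dotDl ![dot _ x]dotC. Qed.

Lemma dotZr a x z : dot x (a *: z) = a * dot x z.
Proof. by rewrite dotC dotZl [dot _ x]dotC. Qed.

Lemma dotNl x z : dot (- x) z = - dot x z.
Proof. by rewrite -scaleN1r dotZl mulN1r. Qed.

Lemma dotNr x z : dot x (- z) = - dot x z.
Proof. by rewrite dotC dotNl dotC. Qed.

Lemma dotBl x y z : dot (x - y) z = dot x z - dot y z.
Proof. by rewrite dotDl dotNl. Qed.

Lemma dotBr x y z : dot x (y - z) = dot x y - dot x z.
Proof. by rewrite dotDr dotNr. Qed.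

Lemma dot_suml I (r : seq I) (P : pred I) (F : I -> V) z :
  dot (\sum_(i <- r | P i) F i) z = \sum_(i <- r | P i) dot (F i) z.
Proof. by apply: (big_morph (dot^~ z)) => [x y|]; rewrite ?dotDl ?dot0l. Qed.

Lemma dot_sumr I (r : seq I) (P : pred I) (F : I -> V) z :
  dot z (\sum_(i <- r | P i) F i) = \sum_(i <- r | P i) dot z (F i).
Proof. by rewrite dotC dot_suml; apply: eq_bigr => i _; rewrite dotC. Qed.

Section Orthonormal.
Variables (I : finType) (u : I -> V).
Hypothesis u_on : Defs.orthonormal dot u.

Definition orthoproj x := \sum_i dot x (u i) *: u i.

Lemma dot_lin_comb (c : I -> R) i : dot (\sum_j c j *: u j) (u i) = c i.
Proof.
rewrite dot_suml (bigD1 i) //= dotZl u_on eqxx mulr1 big1 ?addr0 // => j ji.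
by rewrite dotZl u_on (negbTE ji) mulr0.
Qed.

Lemma norm_lin_comb (c : I -> R) :
  dot (\sum_j c j *: u j) (\sum_j c j *: u j) = \sum_j c j ^+ 2.
Proof.
rewrite {1}dot_suml; apply: eq_bigr => i _.
by rewrite dotZl [dot (u i) _]dotC dot_lin_comb expr2.
Qed.

Lemma dot_orthoproj x i : dot (orthoproj x) (u i) = dot x (u i).
Proof. exact: dot_lin_comb. Qed.

Lemma norm_sub_orthoproj x :
  dot (x - orthoproj x) (x - orthoproj x) = dot x x - \sum_i dot x (u i) ^+ 2.
Proof.
have E : dot x (orthoproj x) = \sum_i dot x (u i) ^+ 2.
  by rewrite dot_sumr; apply: eq_bigr => i _; rewrite dotZr expr2.
by rewrite dotBl !dotBr [dot (orthoproj x) x]dotC !E norm_lin_comb; ring.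
Qed.

Lemma bessel x : \sum_i dot x (u i) ^+ 2 <= dot x x.
Proof. by rewrite -subr_ge0 -norm_sub_orthoproj real_dot_ge0. Qed.

Lemma norm_orthoproj_le x : dot (orthoproj x) (orthoproj x) <= dot x x.
Proof. by rewrite norm_lin_comb bessel. Qed.

Lemma norm_sub_orthoproj_le x :
  dot (x - orthoproj x) (x - orthoproj x) <= dot x x.
Proof. by rewrite norm_sub_orthoproj gerBl sumr_ge0 // => i _; exact: sqr_ge0. Qed.

Lemma orthoprojB x y : orthoproj (x - y) = orthoproj x - orthoproj y.
Proof. by rewrite -sumrB; apply: eq_bigr => i _; rewrite dotBl scalerBl. Qed.

Lemma orthoproj_linear a x y : orthoproj (a *: x + y) = a *: orthoproj x + orthoproj y.
Proof.
rewrite scaler_sumr -big_split; apply: eq_bigr => i _ /=.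
by rewrite dotDl dotZl scalerDl scalerA.
Qed.

Lemma orthoproj_id i : orthoproj (u i) = u i.
Proof.
rewrite /orthoproj (bigD1 i) //= u_on eqxx scale1r big1 ?addr0 // => j.
by rewrite eq_sym u_on => /negbTE->; rewrite scale0r.
Qed.

End Orthonormal.

(** The equation [x = orthoproj u x] supplies the coordinates of [x] along with its membership in
    the span. A vector with zero remainder adds nothing to the system. *)
Lemma gram_schmidt (s : seq V) : exists m (u : 'I_m -> V),
  Defs.orthonormal dot u /\ forall x, x \in s -> x = orthoproj u x.
Proof.
elim: s => [|x s [m [u [u_on us]]]].
  by exists 0%N, (fun=> 0); split => // -[].
have [r0|r0] := eqVneq (x - orthoproj u x) 0.
  exists m, u; split => // y; rewrite inE => /orP[/eqP->|]; last exact: us.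
  by apply/eqP; rewrite -subr_eq0 r0.
set r := x - orthoproj u x in r0; pose nr := Num.sqrt (dot r r).
have rr_gt0 : 0 < dot r r.
  rewrite lt_def real_dot_ge0 // andbT; apply: contra_neq r0; exact: real_dot_eq0.
have nr0 : nr != 0 by rewrite sqrtr_eq0 -ltNge.
have ru i : dot r (u i) = 0 by rewrite /r dotBl dot_orthoproj ?subrr.
have u'_on : Defs.orthonormal dot (fcons (nr^-1 *: r) u).
  move=> k l.
  case: (unliftP ord0 k) => [i|] ->; case: (unliftP ord0 l) => [j|] ->;
    rewrite ?fcons0 ?fconsS.
  - by rewrite u_on (inj_eq lift_inj).
  - by rewrite dotC dotZl ru mulr0 eq_sym (negbTE (neq_lift _ _)).
  - by rewrite dotZl ru mulr0 (negbTE (neq_lift _ _)).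
  by rewrite dotZl dotZr mulrA -invfM -expr2 sqr_sqrtr ?ltW // eqxx mulVf // gt_eqF.
have projE y : orthoproj (fcons (nr^-1 *: r) u) y =
    (nr^-2 * dot y r) *: r + orthoproj u y.
  rewrite /orthoproj big_ord_recl fcons0 dotZr scalerA mulrAC -invfM -expr2 mulrC.
  by congr (_ + _); last by apply: eq_bigr => i _; rewrite fconsS.
exists m.+1, (fcons (nr^-1 *: r) u); split => // y; rewrite inE projE => /orP[/eqP->|/us yE].
  have -> : dot x r = dot r r.
    rewrite {2}/r dotBl [dot (orthoproj u x) r]dotC dot_sumr big1 ?subr0 // => i _.
    by rewrite dotZr ru mulr0.
  by rewrite sqr_sqrtr ?ltW // mulVf ?scale1r ?subrK ?gt_eqF.
have -> : dot y r = 0.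
  rewrite yE dot_suml big1 // => i _.
  by rewrite dotZl [dot (u i) r]dotC ru mulr0.
by rewrite mulr0 scale0r add0r.
Qed.

(** Weaker than orthonormality: it also holds for the real and imaginary parts of a complex
    orthonormal system, and for n arbitrary vectors of squared length at most 1/n. *)
Definition bessel_family (J : finType) (w : J -> V) : Prop :=
  forall x, \sum_j dot x (w j) ^+ 2 <= dot x x.

End RealInnerProduct.

Section Multilinear.
Variables (R : realType) (V : lmodType R).

Notation multilinear := (@antilinear R idfun V _).

Lemma eta_fcons0 n (x : 'I_n.+1 -> V) u :
  [eta x with ord0 |-> u] = fcons u (x \o lift ord0) :> ('I_n.+1 -> V).
Proof.
apply/funext => l; rewrite /=.
by case: (unliftP ord0 l) => [i|] ->; rewrite ?fcons0 ?fconsS ?eqxx // eq_sym (negbTE (neq_lift _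
  _)).
Qed.

Lemma eta_fconsS n (x : 'I_n -> V) u v (i : 'I_n) :
  [eta (fcons u x) with lift ord0 i |-> v] = fcons u [eta x with i |-> v] :> ('I_n.+1 -> V).
Proof.
apply/funext => l; rewrite /=.
by case: (unliftP ord0 l) => [j|] ->; rewrite ?fcons0 ?fconsS /= ?(inj_eq lift_inj).
Qed.

Section FixedFunctional.
Variables (n : nat) (f : functional V n.+1).
Hypothesis f_lin : multilinear f.

Lemma multilinear_cons a u v x :
  f (fcons (a *: u + v) x) = a * f (fcons u x) + f (fcons v x).
Proof.
have := f_lin (fcons 0 x) ord0 a u v; rewrite !eta_fcons0.
by have -> : fcons 0 x \o lift ord0 = x by apply/funext => i; rewrite /= fconsS.
Qed.

Lemma multilinear_slice u : multilinear (fun x => f (fcons u x)).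
Proof. by move=> x l a v w; rewrite -!eta_fconsS; exact: f_lin. Qed.

Lemma multilinear_cons0 x : f (fcons 0 x) = 0.
Proof.
have := multilinear_cons 1 0 0 x; rewrite scaler0 add0r mul1r => E.
by apply: (addrI (f (fcons 0 x))); rewrite -E addr0.
Qed.

Lemma multilinear_consZ a u x : f (fcons (a *: u) x) = a * f (fcons u x).
Proof. by rewrite -[a *: u]addr0 multilinear_cons multilinear_cons0 addr0. Qed.

Lemma multilinear_consB u v x : f (fcons (u - v) x) = f (fcons u x) - f (fcons v x).
Proof. by rewrite addrC -scaleN1r multilinear_cons mulN1r addrC. Qed.

Lemma multilinear_cons_sum (I : finType) (c : I -> R) (u : I -> V) x :
  f (fcons (\sum_i c i *: u i) x) = \sum_i c i * f (fcons (u i) x).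
Proof.
elim: (index_enum I) => [|i s IH]; first by rewrite !big_nil multilinear_cons0.
by rewrite !big_cons multilinear_cons IH.
Qed.

End FixedFunctional.

Lemma fun_ord0 (A : Type) (x y : 'I_0 -> A) : x = y.
Proof. by apply/funext => -[]. Qed.

Lemma multilinear_scale n (f : functional V n) (a : 'I_n -> R) (x : 'I_n -> V) :
  multilinear f -> f (fun l => a l *: x l) = \prod_l a l * f x.
Proof.
elim: n f a x => [|n IH] f a x f_lin.
  by rewrite big_ord0 mul1r; congr f; exact: fun_ord0.
rewrite -[in LHS](fcons_eta (fun l => a l *: x l)) multilinear_consZ // big_ord_recl.
rewrite -mulrA; congr (_ * _); rewrite -[in RHS](fcons_eta x).
rewrite -(IH _ (fun l => a (lift ord0 l)) (x \o lift ord0) (multilinear_slice f_lin _)).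
by [].
Qed.

(* Tensor powers of a contraction [a] are contractions, one factor at a time. *)
Lemma multilinear_contraction n (f : functional V n) (I J : finType)
    (u : I -> V) (w : J -> V) (a : J -> I -> R) :
  multilinear f -> (forall j, w j = \sum_i a j i *: u i) ->
  (forall c : I -> R, \sum_j (\sum_i a j i * c i) ^+ 2 <= \sum_i c i ^+ 2) ->
  \sum_(t : {ffun 'I_n -> J}) f (w \o t) ^+ 2 <=
  \sum_(s : {ffun 'I_n -> I}) f (u \o s) ^+ 2.
Proof.
move=> f_lin wE a_contr; elim: n f f_lin => [|n IH] f f_lin.
  pose i0 A : 'I_0 -> A := fun i => False_rect _ (notF (valP i)).
  rewrite (sum_ffun0 (fun t => f (w \o t) ^+ 2) (i0 J)).
  rewrite (sum_ffun0 (fun t => f (u \o t) ^+ 2) (i0 I)).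
  by rewrite (fun_ord0 (w \o _) (u \o i0 I)).
rewrite (sum_fcons (fun t => f (w \o t) ^+ 2)) (sum_fcons (fun t => f (u \o t) ^+ 2)).
apply: (@le_trans _ _ (\sum_j \sum_(s : {ffun 'I_n -> I}) f (fcons (w j) (u \o s)) ^+ 2)).
  apply: ler_sum => j _.
  under eq_bigr do rewrite comp_fcons.
  exact: (IH _ (multilinear_slice f_lin (w j))).
rewrite exchange_big /= [leRHS]exchange_big /=; apply: ler_sum => s _.
under eq_bigr do rewrite wE multilinear_cons_sum //.
under [leRHS]eq_bigr do rewrite comp_fcons.
exact: (a_contr (fun i => f (fcons (u i) (u \o s)))).
Qed.

End Multilinear.

(** * Hilbert-Schmidt norms and density of kernels finite in a basis *)

Section HilbertSchmidt.
Variables (R : realType) (V : lmodType R) (dot : V -> V -> R).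
Hypothesis dot_real : real_dot dot.

Notation multilinear := (@antilinear R idfun V _).
Notation hs f := (real_norm2 dot f).

Lemma dot_lin_combC (I : finType) (c : I -> R) (u : I -> V) y :
  dot (\sum_i c i *: u i) y = \sum_i dot y (u i) * c i.
Proof.
rewrite (dot_suml dot_real); apply: eq_bigr => i _.
by rewrite (dotZl dot_real) mulrC [dot (u i) _](dotC dot_real).
Qed.

Lemma orthonormal_bessel (I : finType) (u : I -> V) :
  Defs.orthonormal dot u -> bessel_family dot u.
Proof. by move=> u_on x; exact: bessel. Qed.

Lemma cauchy_schwarz (x y : V) : dot x y ^+ 2 <= dot x x * dot y y.
Proof.
have [y0|y0] := eqVneq (dot y y) 0.
  by rewrite (real_dot_eq0 dot_real y0) [dot x 0](dotC dot_real) !(dot0l dot_real) expr0n mulr0.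
have y_gt0 : 0 < dot y y by rewrite lt_def y0 (real_dot_ge0 dot_real).
have := real_dot_ge0 dot_real (x - (dot x y / dot y y) *: y).
rewrite (dotBl dot_real) !(dotBr dot_real) !(dotZl dot_real) !(dotZr dot_real) [dot y x](dotC
  dot_real).
set a := dot x x; set b := dot x y; set c := dot y y in y0 y_gt0 *.
rewrite (_ : a - _ - _ = (a * c - b ^+ 2) / c); last by field.
by rewrite pmulr_lge0 ?invr_gt0 // subr_ge0.
Qed.

(** A Bessel family is the image of an orthonormal system of its span under the matrix of inner
    products, and Bessel's inequality makes this matrix a contraction. *)
Lemma hs_bessel n (f : functional V n) (J : finType) (w : J -> V) :
  multilinear f -> bessel_family dot w ->
  ((\sum_(t : {ffun 'I_n -> J}) f (w \o t) ^+ 2)%:E <= hs f)%E.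
Proof.
move=> f_lin w_bessel.
have [m [u [u_on uw]]] := gram_schmidt dot_real (codom w).
apply: (@le_trans _ _ (\sum_(s : {ffun 'I_n -> 'I_m}) f (u \o s) ^+ 2)%:E).
  rewrite lee_fin.
  apply: (@multilinear_contraction _ _ _ _ _ _ u w (fun j i => dot (w j) (u i))) => //.
    by move=> j; apply: uw; exact: codom_f.
  move=> c; rewrite -(norm_lin_comb dot_real u_on).
  apply: le_trans (w_bessel (\sum_i c i *: u i)); apply: ler_sum => j _.
  by rewrite dot_lin_combC.
apply: ereal_sup_ubound; exists m, u; split => //; congr EFin.
by apply: eq_bigr => s _; rewrite real_normK ?num_real.
Qed.

Lemma hs_ge0 n (f : functional V n) : (0 <= hs f)%E.
Proof.
apply: (@le_trans _ _ (\sum_(t : {ffun 'I_n -> 'I_0}) `|f ((fun=> 0) \o t)| ^+ 2)%:E).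
  by rewrite lee_fin sumr_ge0 // => t _; exact: sqr_ge0.
apply: ereal_sup_ubound; exists 0%N, (fun=> 0); split => // -[//].
Qed.

Lemma hs_bessel_fine n (f : functional V n) (J : finType) (w : J -> V) :
  multilinear f -> (hs f < +oo)%E -> bessel_family dot w ->
  \sum_(t : {ffun 'I_n -> J}) f (w \o t) ^+ 2 <= fine (hs f).
Proof.
move=> f_lin f_fin w_bessel; rewrite -lee_fin fineK ?hs_bessel //.
by rewrite ge0_fin_numE // hs_ge0.
Qed.

Definition bounded_functional n (C : R) (f : functional V n) : Prop :=
  forall x, f x ^+ 2 <= C * \prod_l dot (x l) (x l).

(** A crude constant suffices for continuity. Scaled to squared length 1/n, the arguments form a
    Bessel family by Cauchy-Schwarz; undoing the scaling in all n arguments costs n^n. *)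
Lemma hs_bound n (f : functional V n) : multilinear f -> (hs f < +oo)%E ->
  bounded_functional ((n ^ n)%:R * fine (hs f)) f.
Proof.
move=> f_lin f_fin x.
pose s l := Num.sqrt (n%:R * dot (x l) (x l)).
have q0 l : 0 <= n%:R * dot (x l) (x l) by rewrite mulr_ge0 // (real_dot_ge0 dot_real).
have sE l : s l ^+ 2 = n%:R * dot (x l) (x l) by rewrite sqr_sqrtr.
pose w l := (s l)^-1 *: x l.
have xE : x = fun l => s l *: w l.
  apply/funext => l; rewrite /w scalerA.
  (* [s l = 0] forces [x l = 0], so the division by zero in [w] is harmless. *)
  have [sl0|sl0] := eqVneq (s l) 0; last by rewrite divff // scale1r.
  have n0 : n%:R != 0 :> R by rewrite pnatr_eq0; case: (n) l {sl0} => [[]|].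
  have := sE l; rewrite sl0 expr0n => /esym/eqP; rewrite mulf_eq0 (negbTE n0) /=.
  by move=> /eqP /(real_dot_eq0 dot_real) ->; rewrite scaler0.
have w_bessel : bessel_family dot w.
  move=> y; apply: (@le_trans _ _ (\sum_(l < n) dot y y / n%:R)).
    apply: ler_sum => l _; apply: le_trans (cauchy_schwarz _ _) _.
    rewrite ler_wpM2l ?(real_dot_ge0 dot_real) // /w (dotZl dot_real) (dotZr dot_real) mulrA
      -invfM -expr2 sE.
    have [->|x0] := eqVneq (dot (x l) (x l)) 0; first by rewrite mulr0 invr_ge0.
    by rewrite invfM mulfVK.
  rewrite sumr_const card_ord -[X in X <= _]mulr_natr -mulrA.
  case: (n) => [|m]; first by rewrite mulr0 mulr0 (real_dot_ge0 dot_real).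
  by rewrite mulVf ?mulr1.
have fw : f w ^+ 2 <= fine (hs f).
  apply: le_trans (hs_bessel_fine f_lin f_fin w_bessel).
  rewrite (bigD1 [ffun l => l]) //= (_ : w \o _ = w) ?lerDl ?sumr_ge0 //; last first.
    by apply/funext => l; rewrite /= ffunE.
  by move=> t _; exact: sqr_ge0.
have -> : f x = \prod_l s l * f w by rewrite {1}xE multilinear_scale.
rewrite exprMn -prodrXl.
rewrite (eq_bigr _ (fun l _ => sE l)) big_split /= prodr_const card_ord -natrX.
rewrite mulrAC ler_wpM2r //.
  by rewrite prodr_ge0 // => l _; rewrite (real_dot_ge0 dot_real).
by rewrite ler_wpM2l.
Qed.

(** Arguments are exchanged one at a time, each exchange costing [Num.sqrt C * delta] since the
    others have length at most 1. *)
Lemma multilinear_continuous n C (f : functional V n) (x y : 'I_n -> V) (delta : R) :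
  multilinear f -> 0 <= C -> 0 <= delta -> bounded_functional C f ->
  (forall l, dot (x l) (x l) <= 1) -> (forall l, dot (y l) (y l) <= 1) ->
  (forall l, dot (x l - y l) (x l - y l) <= delta ^+ 2) ->
  `|f x - f y| <= n%:R * Num.sqrt C * delta.
Proof.
move=> + C0 delta0; elim: n f x y => [|n IH] f x y f_lin fC x1 y1 xy.
  by rewrite (fun_ord0 x y) subrr normr0 !mul0r.
have prod_le1 (z : 'I_n -> V) : (forall l, dot (z l) (z l) <= 1) ->
    \prod_l dot (z l) (z l) <= 1.
  by move=> z1; apply: prodr_ile1 => l _; rewrite (real_dot_ge0 dot_real) ?z1.
have -> : f x - f y = f (fcons (x ord0 - y ord0) (x \o lift ord0)) +
    (f (fcons (y ord0) (x \o lift ord0)) - f (fcons (y ord0) (y \o lift ord0))).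
  by rewrite multilinear_consB // -[in LHS](fcons_eta x) -[in LHS](fcons_eta y); ring.
apply: le_trans (ler_normD _ _) _.
rewrite (_ : n.+1%:R * _ * _ = Num.sqrt C * delta + n%:R * Num.sqrt C * delta); last first.
  by rewrite -natr1; ring.
apply: lerD.
  rewrite -sqrtr_sqr -[delta]ger0_norm // -sqrtr_sqr -sqrtrM // ler_wsqrtr //.
  apply: le_trans (fC _) _; rewrite ler_wpM2l // big_ord_recl fcons0.
  rewrite -[leRHS]mulr1 ler_pM ?(real_dot_ge0 dot_real) ?prodr_ge0 //.
    by move=> l _; rewrite (real_dot_ge0 dot_real).
  by under eq_bigr do rewrite fconsS; apply: prod_le1 => l; exact: x1.
apply: (IH (fun z => f (fcons (y ord0) z))) => //; try by move=> l /=.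
  exact: multilinear_slice.
move=> z; apply: le_trans (fC _) _; rewrite ler_wpM2l // big_ord_recl fcons0.
rewrite -[leRHS]mul1r ler_pM ?(real_dot_ge0 dot_real) ?prodr_ge0 //.
  by move=> l _; rewrite (real_dot_ge0 dot_real).
by rewrite (eq_bigr (fun l => dot (z l) (z l))) // => l _; rewrite !fconsS.
Qed.

Section Density.
Variables (I : countType) (e : I -> V).
Hypothesis e_cons : complete_orthonormal dot e.

Definition fproj (S : {fset I}) : V -> V := orthoproj dot (fun k : S => e (val k)).

Lemma fset_orthonormal (S : {fset I}) : Defs.orthonormal dot (fun k : S => e (val k)).
Proof. by move=> k l; rewrite e_cons.1. Qed.

Lemma fproj_basis (S : {fset I}) k : fproj S (e k) = if k \in S then e k else 0.
Proof.
case: ifPn => kS.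
  exact: (orthoproj_id (fset_orthonormal (S := S)) [` kS]%fset).
rewrite /fproj /orthoproj big1 // => l _; rewrite e_cons.1.
by case: eqVneq kS => [->|]; rewrite ?(valP l) // scale0r.
Qed.

Lemma fproj_cvg x (eps : R) : 0 < eps -> exists S0 : {fset I},
  forall S, (S0 `<=` S)%fset -> dot (x - fproj S x) (x - fproj S x) <= eps.
Proof.
move=> eps0; have [s [c /= xs]] := e_cons.2 x eps eps0.
exists [fset k in s]%fset => S /fsubsetP sS.
set r := \sum_(k <- s) _ in xs.
have rE : fproj S r = r.
  rewrite /r; elim: s sS {xs r} => [|k s IH] sS.
    by rewrite big_nil /fproj /orthoproj big1 // => i _; rewrite (dot0l dot_real) scale0r.
  rewrite big_cons [LHS]orthoproj_linear // -!/(fproj _ _) fproj_basis IH ?sS ?inE ?eqxx //.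
  by move=> j js; apply: sS; move: js; rewrite !inE => ->; rewrite orbT.
have -> : x - fproj S x = (x - r) - fproj S (x - r).
  by rewrite [fproj S (x - r)]orthoprojB // -!/(fproj _ _) rE opprB addrA subrK.
by apply: le_trans (ltW xs); exact: norm_sub_orthoproj_le (@fset_orthonormal S) _.
Qed.

Lemma fproj_cvg_family (J : finType) (x : J -> V) (eps : R) : 0 < eps ->
  exists S0 : {fset I}, forall S, (S0 `<=` S)%fset -> forall j,
    dot (x j - fproj S (x j)) (x j - fproj S (x j)) <= eps.
Proof.
move=> eps0; have /choice[S0 HS0] := fun j => fproj_cvg (x j) eps0.
exists (\big[fsetU/fset0]_(j <- index_enum J) S0 j) => S leS j; apply: HS0.
by apply: fsubset_trans leS; apply: (@bigfcup_sup _ _ _ _ xpredT S0); rewrite ?mem_index_enum.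
Qed.

Lemma fproj_norm_le (S : {fset I}) x : dot (fproj S x) (fproj S x) <= dot x x.
Proof. exact: norm_orthoproj_le (@fset_orthonormal S) x. Qed.

Lemma antilinear_fproj n (f : functional V n) S :
  multilinear f -> multilinear (fun x => f (fproj S \o x)).
Proof.
move=> f_lin x l a u v.
have E z : fproj S \o [eta x with l |-> z] = [eta (fproj S \o x) with l |-> fproj S z].
  by apply/funext => j /=; case: eqP.
by rewrite !E [fproj S (a *: u + v)](orthoproj_linear dot_real) f_lin.
Qed.

(* If the sum of [f ^+ 2] over the words in [S0] is within [eps] of its
   supremum, [f - f \o fproj S] only retains words that leave [S0]. *)
Lemma hs_density n (f : functional V n) (eps : R) :
  multilinear f -> (hs f < +oo)%E -> 0 < eps ->
  exists S0 : {fset I}, forall S, (S0 `<=` S)%fset ->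
    (hs (fun x => (f x - f (fproj S \o x))%R) <= eps%:E)%E.
Proof.
move=> f_lin f_fin eps0.
pose A (S : {fset I}) := \sum_(s : {ffun 'I_n -> S}) f ((e \o val) \o s) ^+ 2.
have A_le S : A S <= fine (hs f).
  by apply: hs_bessel_fine => //; apply: orthonormal_bessel; exact: fset_orthonormal.
have A_sup : has_sup (range A).
  by split; [exists (A fset0); exists fset0|exists (fine (hs f)) => _ [S _ <-]].
have [_ [S0 _ <-] S0_gt] := sup_adherent eps0 A_sup.
exists S0 => S leS; apply: ge_ereal_sup => _ [m [w [w_on ->]]]; rewrite lee_fin.
under eq_bigr do rewrite real_normK ?num_real //.
pose D x := f x - f (fproj S \o x).
pose C := (n ^ n)%:R * fine (hs f).
have C0 : 0 <= C by rewrite mulr_ge0 // fine_ge0 // hs_ge0.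
have f_bound : bounded_functional C f by exact: hs_bound.
have fP_bound : bounded_functional C (fun x => f (fproj S \o x)).
  move=> x; apply: le_trans (f_bound _) _; rewrite ler_wpM2l //.
  by apply: ler_prod => l _; rewrite (real_dot_ge0 dot_real) //= fproj_norm_le.
have D_lin : multilinear D.
  move=> x l a u v; rewrite /D f_lin (antilinear_fproj _ f_lin) /=; ring.
have sqr_sub_le (a b : R) : (a - b) ^+ 2 <= 2 * a ^+ 2 + 2 * b ^+ 2.
  by rewrite -subr_ge0 (_ : _ - _ = (a + b) ^+ 2) ?sqr_ge0 //; ring.
have D_bound : bounded_functional (4 * C) D.
  move=> x; apply: le_trans (sqr_sub_le _ _) _.
  by have := f_bound x; have := fP_bound x; rewrite -mulrA; lra.
have D_fin S' : (S `<=` S')%fset ->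
    \sum_(s : {ffun 'I_n -> S'}) D ((e \o val) \o s) ^+ 2 <= eps.
  move=> leS'.
  (* On a word over [S] the difference [D] vanishes; on a word leaving [S] the projected term does.
     Either way the square of the difference is the difference of the squares. *)
  have De (s : {ffun 'I_n -> S'}) : D ((e \o val) \o s) ^+ 2 =
      f ((e \o val) \o s) ^+ 2 - f ((fproj S \o (e \o val)) \o s) ^+ 2.
    rewrite /D -[fproj S \o _]/((fproj S \o (e \o val)) \o s).
    have [/forallP sS|] := boolP [forall l, val (s l) \in S].
      rewrite (_ : (fproj S \o (e \o val)) \o s = (e \o val) \o s) ?subrr ?expr0n //.
      by apply/funext => l /=; rewrite fproj_basis sS.
    rewrite negb_forall => /existsP[l /negbTE sl].
    rewrite (_ : f ((fproj S \o (e \o val)) \o s) = 0) ?subr0 ?expr0n ?subr0 //.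
    rewrite (_ : _ \o s = fun j => (val (s j) \in S)%:R *: e (val (s j))).
      by rewrite multilinear_scale // (bigD1 l) //= sl !mul0r.
    apply/funext => j /=; rewrite fproj_basis.
    by case: ifP => _; rewrite ?scale1r ?scale0r.
  rewrite (eq_bigr _ (fun s _ => De s)) sumrB -/(A S').
  have A_ge : A S0 <= \sum_(s : {ffun 'I_n -> S'}) f ((fproj S \o (e \o val)) \o s) ^+ 2.
    apply: (multilinear_contraction (a := fun k s => (val k == val s)%:R)) => //.
      move=> k.
      have kS : val k \in S by apply: (fsubsetP leS); exact: valP.
      have kS' : val k \in S' by exact: (fsubsetP leS').
      rewrite (bigD1 [` kS']%fset) //= eqxx scale1r fproj_basis kS big1 ?addr0 //.
      move=> s; rewrite -val_eqE eq_sym /= => /negbTE ->; by rewrite scale0r.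
    move=> c; rewrite -(norm_lin_comb dot_real (@fset_orthonormal S')).
    apply: le_trans (bessel dot_real (@fset_orthonormal S0) _).
    apply: ler_sum => k _; rewrite dot_lin_combC.
    by under eq_bigr do rewrite -e_cons.1.
  have A'_le : A S' <= sup (range A) by apply: ub_le_sup; [exact: A_sup.2|exists S'].
  by lra.
(* [D_fin] tests basis words only, whereas the norm runs over every orthonormal [w]; projecting [w]
   to a larger [S'] costs at most [eta]. *)
apply/ler_addgt0Pr => eta eta0.
(* Total, over all words, of the bound on |a - b| |a + b| per unit of [delta]; dividing by [K + 1]
   avoids a zero denominator. *)
pose K : R := \sum_(t : {ffun 'I_n -> 'I_m}) (2 * Num.sqrt (4 * C) * (n%:R * Num.sqrt (4 * C))).
have K0 : 0 <= K by rewrite sumr_ge0 // => t _; rewrite !mulr_ge0 ?sqrtr_ge0.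
pose delta := eta / (K + 1).
have K1 : 0 < K + 1 by rewrite ltr_wpDl.
have delta0 : 0 < delta by rewrite divr_gt0.
have [S1 HS1] := @fproj_cvg_family _ w (delta ^+ 2) (exprn_gt0 2 delta0).
pose S' := (S `|` S1)%fset.
have leS' : (S `<=` S')%fset by exact: fsubsetUl.
have wS' j := HS1 S' (fsubsetUr _ _) j.
have w1 j : dot (w j) (w j) <= 1 by rewrite w_on eqxx.
have Pw1 j : dot (fproj S' (w j)) (fproj S' (w j)) <= 1.
  by apply: le_trans (fproj_norm_le _ _) (w1 j).
have C40 : 0 <= 4 * C by rewrite mulr_ge0.
have D_le1 (x : 'I_n -> V) : (forall l, dot (x l) (x l) <= 1) -> `|D x| <= Num.sqrt (4 * C).
  move=> x1; rewrite -sqrtr_sqr ler_wsqrtr //; apply: le_trans (D_bound x) _.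
  by apply: (ler_piMr C40); apply: prodr_ile1 => l _; rewrite (real_dot_ge0 dot_real) ?x1.
have D_close (t : {ffun 'I_n -> 'I_m}) : D (w \o t) ^+ 2 <=
    D ((fproj S' \o w) \o t) ^+ 2 + 2 * Num.sqrt (4 * C) * (n%:R * Num.sqrt (4 * C) * delta).
  set a := D (w \o t); set b := D (_ \o t).
  have ab : `|a - b| <= n%:R * Num.sqrt (4 * C) * delta.
    apply: (multilinear_continuous D_lin C40 (ltW delta0) D_bound) => l /=;
      [exact: w1|exact: Pw1|exact: wS'].
  have a1 : `|a| <= Num.sqrt (4 * C) by apply: D_le1 => l; exact: w1.
  have b1 : `|b| <= Num.sqrt (4 * C) by apply: D_le1 => l; exact: Pw1.
  rewrite -lerBlDl subr_sqr mulrC; apply: le_trans (ler_norm _) _; rewrite normrM.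
  apply: ler_pM => //; apply: le_trans (ler_normD _ _) _; lra.
apply: le_trans; first by apply: ler_sum => t _; exact: D_close.
rewrite big_split /=.
apply: lerD.
  apply: le_trans (D_fin _ leS').
  apply: (multilinear_contraction (a := fun j k => dot (w j) (e (val k)))) => // c.
  rewrite -(norm_lin_comb dot_real (@fset_orthonormal S')).
  apply: le_trans (orthonormal_bessel w_on _); apply: ler_sum => j _.
  by rewrite dot_lin_combC.
rewrite (_ : \sum_t _ = K * delta); last by rewrite /K mulr_suml; apply: eq_bigr => t _; rewrite
  !mulrA.
by rewrite /delta mulrA ler_pdivrMr // mulrDr mulr1 mulrC lerDl ltW.
Qed.

End Density.

End HilbertSchmidt.

(** * Tensor powers *)

(** Common ground of the real tensors and of the complex ones. The Bessel field asks for some bound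
    only, which is enough to make pure tensors Hilbert-Schmidt. *)
Record sesquilinear_setting (R : realType) (K : numFieldType) (cj : K -> K)
    (nm : K -> R) (E : lmodType K) (dot : E -> E -> K) : Prop := {
  setting_nm1 : nm 1 = 1;
  setting_nmM : forall a b, nm (a * b) = nm a * nm b;
  setting_nmD : forall a b, nm (a + b) <= nm a + nm b;
  setting_nm_ge0 : forall a, 0 <= nm a;
  setting_dotl : forall a x y z, dot (a *: x + y) z = a * dot x z + dot y z;
  setting_dotr : forall a x y z, dot z (a *: x + y) = cj a * dot z x + dot z y;
  setting_bessel : forall x, exists C, 0 <= C /\ forall m (e : 'I_m -> E),
    Defs.orthonormal dot e -> \sum_j nm (dot x (e j)) ^+ 2 <= C
}.

Section Tensors.
Variables (R : realType) (K : numFieldType) (cj : K -> K) (nm : K -> R).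
Variables (E : lmodType K) (dot : E -> E -> K).
Hypothesis setting : sesquilinear_setting cj nm dot.

Notation tensor_power := (@tensor_power R K cj nm E dot _).
Notation symmetric_power := (@symmetric_power R K cj nm E dot _).
Notation bisymmetric_power := (@bisymmetric_power R K cj nm E dot _ _).
Notation hs := (@hs_norm2 R K nm E dot _).
Notation pure := (@pure_tensor K E dot _).

Lemma hs_linear_le n a (f g : functional E n) :
  (hs (fun x => (a * f x + g x)%R) <= (2 * nm a ^+ 2)%:E * hs f + 2%:E * hs g)%E.
Proof.
apply: ge_ereal_sup => _ [m [e [e_on ->]]].
have le_hs h : ((\sum_(t : {ffun 'I_n -> 'I_m}) nm (h (e \o t)) ^+ 2)%:E <= hs h)%E.
  by apply: ereal_sup_ubound; exists m, e.
apply: (@le_trans _ _ ((2 * nm a ^+ 2)%:E *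
    (\sum_(t : {ffun 'I_n -> 'I_m}) nm (f (e \o t)) ^+ 2)%:E +
    2%:E * (\sum_(t : {ffun 'I_n -> 'I_m}) nm (g (e \o t)) ^+ 2)%:E)%E); last first.
  by apply: leeD; rewrite lee_wpmul2l // lee_fin mulr_ge0 // exprn_ge0 // (setting_nm_ge0 setting).
rewrite -!EFinM -EFinD lee_fin !mulr_sumr -big_split /=; apply: ler_sum => t _.
have := setting_nmD setting (a * f (e \o t)) (g (e \o t)).
have := setting_nm_ge0 setting (a * f (e \o t) + g (e \o t)).
rewrite (setting_nmM setting); set u := nm a * _; set v := nm (g _); set w := nm _.
move=> w0 wle; have -> : 2 * nm a ^+ 2 * nm (f (e \o t)) ^+ 2 = 2 * u ^+ 2.
  by rewrite /u; ring.
apply: (@le_trans _ _ ((u + v) ^+ 2)); first by rewrite lerXn2r ?nnegrE // (le_trans w0).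
by rewrite -subr_ge0 (_ : _ - _ = (u - v) ^+ 2) ?sqr_ge0 //; ring.
Qed.

Lemma tensor_power_linear n a (f g : functional E n) : tensor_power f -> tensor_power g ->
  tensor_power (fun x => a * f x + g x).
Proof.
move=> [f_lin f_fin] [g_lin g_fin]; split.
  by move=> x l b u v; rewrite f_lin g_lin; ring.
apply: le_lt_trans (hs_linear_le a f g) _.
by rewrite lte_add_pinfty ?lte_mul_pinfty // lee_fin mulr_ge0 // exprn_ge0 // (setting_nm_ge0
  setting).
Qed.

Lemma symmetric_power_linear n a (f g : functional E n) :
  symmetric_power f -> symmetric_power g -> symmetric_power (fun x => a * f x + g x).
Proof.
move=> [f_pow f_sym] [g_pow g_sym]; split; first exact: tensor_power_linear.
by move=> s x; rewrite f_sym g_sym.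
Qed.

Lemma bisymmetric_power_linear p q a (f g : functional E (p + q)) :
  bisymmetric_power f -> bisymmetric_power g -> bisymmetric_power (fun x => a * f x + g x).
Proof.
move=> [f_pow f_sym] [g_pow g_sym]; split; first exact: tensor_power_linear.
by move=> s t x y; rewrite f_sym g_sym.
Qed.

Lemma pure_antilinear n (u : 'I_n -> E) : antilinear cj (pure u).
Proof.
move=> x l a v w; rewrite /pure_tensor (bigD1 l) //= [X in _ = _ * X + _](bigD1 l) //=.
rewrite [X in _ = _ + X](bigD1 l) //= !eqxx (setting_dotr setting).
rewrite mulrDl -mulrA; congr (_ * (_ * _) + _ * _).
  by apply: eq_bigr => i /negbTE ->.
by apply: eq_bigr => i /negbTE ->.
Qed.

Lemma pure_hs_fin n (u : 'I_n -> E) : (hs (pure u) < +oo)%E.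
Proof.
have /choice[C HC] := setting_bessel setting.
apply: (@le_lt_trans _ _ (\prod_l C (u l))%:E); last exact: ltry.
apply: ge_ereal_sup => _ [m [e [e_on ->]]]; rewrite lee_fin.
rewrite (eq_bigr (fun t : {ffun 'I_n -> 'I_m} => \prod_l nm (dot (u l) (e (t l))) ^+ 2)).
  rewrite -(bigA_distr_bigA (fun l j => nm (dot (u l) (e j)) ^+ 2)) /=.
  apply: ler_prod => l _; rewrite (HC (u l)).2 // sumr_ge0 // => j _; exact: sqr_ge0.
move=> t _; rewrite /pure_tensor prodrXl; congr (_ ^+ 2).
exact: (big_morph nm (setting_nmM setting) (setting_nm1 setting)).
Qed.

Lemma pure_tensor_power n (u : 'I_n -> E) : tensor_power (pure u).
Proof. by split; [exact: pure_antilinear|exact: pure_hs_fin]. Qed.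

Lemma pure_perm n (u : 'I_n -> E) (s : 'S_n) x : pure u (x \o s) = pure (u \o (s^-1)%g) x.
Proof.
rewrite /pure_tensor [RHS](reindex_perm s); apply: eq_bigr => l _ /=.
by rewrite permK.
Qed.

Lemma symm_perm n (f : functional E n) (s : 'S_n) x : symm f (x \o s) = symm f x.
Proof.
rewrite /symm; congr (_ * _); rewrite [RHS](reindex_inj (mulIg s)) /=.
by apply: eq_bigr => t _; congr f; apply/funext => l /=; rewrite permM.
Qed.

Lemma symm_id n (f : functional E n) : (forall (s : 'S_n) x, f (x \o s) = f x) -> symm f = f.
Proof.
move=> f_sym; apply/funext => x; rewrite /symm (eq_bigr (fun=> f x)) //.
rewrite sumr_const card_Sn -[f x *+ _]mulr_natl mulrA mulVf ?mul1r //.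
Qed.

Lemma symm_sum n (I : finType) (c : I -> K) (f : I -> functional E n) x :
  symm (fun x => \sum_i c i * f i x) x = \sum_i c i * symm (f i) x.
Proof.
rewrite /symm exchange_big mulr_sumr; apply: eq_bigr => i _ /=.
by rewrite -mulr_sumr mulrCA.
Qed.

Lemma symmetric_power_pure n (u : E) : symmetric_power (pure (fun _ : 'I_n => u)).
Proof. by split; [exact: pure_tensor_power|move=> s x; rewrite pure_perm]. Qed.

Lemma tensor_power_zero n : tensor_power (fun _ : 'I_n -> E => 0).
Proof.
have -> : (fun _ : 'I_n -> E => 0) = (fun x => -1 * pure (fun=> 0) x + pure (fun=> 0) x).
  by apply/funext => x; rewrite mulN1r addNr.
by apply: tensor_power_linear; exact: pure_tensor_power.
Qed.

Lemma symmetric_power_zero n : symmetric_power (fun _ : 'I_n -> E => 0).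
Proof. by split => //; exact: tensor_power_zero. Qed.

Lemma bisymmetric_power_zero p q : bisymmetric_power (fun _ : 'I_(p + q) -> E => 0).
Proof. by split => //; exact: tensor_power_zero. Qed.

Lemma tensor_power_sum n (I : Type) (r : seq I) (c : I -> K) (f : I -> functional E n) :
  (forall i, tensor_power (f i)) -> tensor_power (fun x => \sum_(i <- r) c i * f i x).
Proof.
move=> f_pow; elim: r => [|i r IH].
  by under eq_fun do rewrite big_nil; exact: tensor_power_zero.
by under eq_fun do rewrite big_cons; exact: tensor_power_linear.
Qed.

Lemma symm_pure_symmetric_power n (u : 'I_n -> E) : symmetric_power (symm (pure u)).
Proof.
split; last by move=> s x; rewrite symm_perm.
have -> : symm (pure u) = (fun x => \sum_(s : 'S_n) (n`!)%:R^-1 * pure (u \o (s^-1)%g) x).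
  by apply/funext => x; rewrite /symm mulr_sumr; apply: eq_bigr => s _; rewrite pure_perm.
by apply: tensor_power_sum => s; exact: pure_tensor_power.
Qed.

Lemma concat_lshift p q (x : 'I_p -> E) (y : 'I_q -> E) i : concat x y (lshift q i) = x i.
Proof. by rewrite /concat -[lshift q i]/(unsplit (inl i)) unsplitK. Qed.

Lemma concat_rshift p q (x : 'I_p -> E) (y : 'I_q -> E) i : concat x y (rshift p i) = y i.
Proof. by rewrite /concat -[rshift p i]/(unsplit (inr i)) unsplitK. Qed.

Lemma tensor_product_concat p q (f : functional E p) (g : functional E q) x y :
  tensor_product f g (concat x y) = f x * g y.
Proof.
by congr (f _ * g _); apply/funext => i /=; rewrite ?concat_lshift ?concat_rshift.
Qed.

Lemma tensor_product_pure p q (u : 'I_p -> E) (v : 'I_q -> E) :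
  tensor_product (pure u) (pure v) = pure (concat u v).
Proof.
apply/funext => x; rewrite /tensor_product /pure_tensor big_split_ord /=.
by congr (_ * _); apply: eq_bigr => i _; rewrite ?concat_lshift ?concat_rshift.
Qed.

Lemma symm_pureE n (u : 'I_n -> E) x :
  symm (pure u) x = \sum_(s : 'S_n) (n`!)%:R^-1 * pure (u \o (s^-1)%g) x.
Proof. by rewrite /symm mulr_sumr; apply: eq_bigr => s _; rewrite pure_perm. Qed.

Lemma tensor_product_symm_pure p q (u : 'I_p -> E) (v : 'I_q -> E) :
  bisymmetric_power (tensor_product (symm (pure u)) (symm (pure v))).
Proof.
split; last by move=> s t x y; rewrite !tensor_product_concat !symm_perm.
have -> : tensor_product (symm (pure u)) (symm (pure v)) = (fun x =>
    \sum_(s : 'S_p * 'S_q) ((p`!)%:R^-1 * (q`!)%:R^-1) *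
      pure (concat (u \o (s.1^-1)%g) (v \o (s.2^-1)%g)) x).
  apply/funext => x; rewrite {1}/tensor_product !symm_pureE mulr_suml.
  rewrite -(pair_bigA _ (fun (s : 'S_p) (t : 'S_q) => (p`!)%:R^-1 * (q`!)%:R^-1 * pure (concat (u
    \o (s^-1)%g) (v \o (t^-1)%g)) x)) /=.
  apply: eq_bigr => s _; rewrite mulr_sumr; apply: eq_bigr => t _.
  by rewrite -tensor_product_pure /tensor_product; ring.
by apply: tensor_power_sum => s; exact: pure_tensor_power.
Qed.

(** The left side is symmetric, so each word may be symmetrized, the form in which the integrals are
    prescribed. *)
Lemma pure_lin_comb n (I : finType) (c : I -> K) (u : I -> E) :
  pure (fun _ : 'I_n => \sum_k c k *: u k) =
  (fun x => \sum_(s : {ffun 'I_n -> I}) (\prod_l c (s l)) * symm (pure (u \o s)) x).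
Proof.
have dot_sum z : dot (\sum_k c k *: u k) z = \sum_k c k * dot (u k) z.
  have dot0 : dot 0 z = 0.
    by have := setting_dotl setting (-1) 0 0 z; rewrite scaler0 addr0 mulN1r addNr.
  by elim/big_rec2: _ => // k _ y _ <-; rewrite (setting_dotl setting).
set v := \sum_k _; apply/funext => x.
rewrite -(symm_id (f := pure (fun=> v))); last by move=> s z; rewrite pure_perm.
rewrite -symm_sum; congr (symm _ x); apply/funext => z; rewrite /pure_tensor.
under eq_bigr do rewrite dot_sum.
rewrite (bigA_distr_bigA (fun l k => c k * dot (u k) (z l))) /=.
by apply: eq_bigr => s _; rewrite big_split.
Qed.

(** When the powers are expanded over maps f from positions to indices, f receives the signed sum
    over the sets containing its image. This is 1 for a permutation, and 0 if f misses an index k,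
    because toggling k changes the sign. *)
Lemma polarization n (u : 'I_n -> E) :
  symm (pure u) = (fun x => \sum_(A : {set 'I_n})
    ((n`!)%:R^-1 * (-1) ^+ (n - #|A|)) * pure (fun=> \sum_(l in A) u l) x).
Proof.
apply/funext => x; rewrite /symm.
pose d k l := dot (u k) (x l).
have dot_sum (A : {set 'I_n}) l : dot (\sum_(k in A) u k) (x l) = \sum_(k in A) d k l.
  have dot0 : dot 0 (x l) = 0.
    by have := setting_dotl setting (-1) 0 0 (x l); rewrite scaler0 addr0 mulN1r addNr.
  apply: (big_morph (dot^~ (x l))) => // y z.
  by have := setting_dotl setting 1 y z (x l); rewrite scale1r mul1r.
under [RHS]eq_bigr do rewrite -mulrA; rewrite -mulr_sumr; congr (_ * _).
transitivity (\sum_(A : {set 'I_n}) \sum_(f : {ffun 'I_n -> 'I_n} | f \in ffun_on (mem A))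
    (-1) ^+ (n - #|A|) * \prod_l d (f l) l); last first.
  apply: eq_bigr => A _; rewrite /pure_tensor.
  rewrite [in RHS](eq_bigr (fun l => \sum_(k in A) d k l)) => [|l _]; last exact: dot_sum.
  by rewrite bigA_distr_big mulr_sumr.
pose sgnsum (f : {ffun 'I_n -> 'I_n}) : K :=
  \sum_(A : {set 'I_n} | f \in ffun_on (mem A)) (-1) ^+ (n - #|A|).
transitivity (\sum_(f : {ffun 'I_n -> 'I_n}) sgnsum f * \prod_l d (f l) l); last first.
  rewrite [RHS](exchange_big_dep predT) //=; apply: eq_bigr => f _.
  by rewrite mulr_suml.
rewrite [RHS](bigID (fun f : {ffun 'I_n -> 'I_n} => injectiveb f)) /=.
rewrite [X in _ = _ + X]big1 ?addr0 => [|f Uf].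
  rewrite [RHS](reindex (@pval _)) /=; last first.
    pose in_Sn := insubd (1%g : 'S_n).
    by exists in_Sn => /= f Uf; first apply: val_inj; apply: insubdK.
  (* [symm] permutes the arguments [x] while the expansion permutes the vectors [u]; inversion
     relates the two. *)
  have inv_inj : injective (fun s : 'S_n => (s^-1)%g) by exact: invg_inj.
  rewrite [RHS](reindex_inj inv_inj) /=; apply: eq_big => /= [s | s _]; first by rewrite (valP
    s^-1%g).
  have -> : sgnsum (pval s^-1%g) = 1.
    rewrite /sgnsum (big_pred1 (finset.setTfor 'I_n)) ?finset.cardsT ?card_ord ?subnn // => A.
    apply/ffun_onP/eqP => [sA|-> l]; last by rewrite inE.
    by apply/finset.setP => l; rewrite inE; have := sA (s l); rewrite pvalE permK.
  rewrite mul1r /pure_tensor [LHS](reindex_perm s^-1%g) /=; apply: eq_bigr => l _.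
  by rewrite permKV /d pvalE.
have [k kf] : exists k, forall l, f l != k.
  have [|nsurj] := boolP [exists k, [forall l, f l != k]].
    by move=> /existsP[k /forallP kf]; exists k.
  pose g k := odflt k [pick l | f l == k].
  have gK : cancel g f.
    move=> k; rewrite /g; case: pickP => [l /eqP //|fk] /=.
    case/negP: nsurj; apply/existsP; exists k; apply/forallP => l.
    by rewrite fk.
  by case/injectiveP: Uf; exact: can_inj (canF_sym gK).
apply/eqP; rewrite mulf_eq0; apply/orP; left; apply/eqP.
pose flip (A : {set 'I_n}) := if k \in A then A :\ k else k |: A.
have flipK : involutive flip.
  move=> A; rewrite /flip; have [kA|kA] := boolP (k \in A).
    by rewrite finset.setD11 finset.setD1K.
  by rewrite finset.setU11 finset.setU1K.
have flip_on A : (f \in ffun_on (mem (flip A))) = (f \in ffun_on (mem A)).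
  apply/ffun_onP/ffun_onP => fA l; have := fA l; rewrite /flip;
    by case: ifP => _; rewrite !inE (negbTE (kf l)).
have flip_sign A : (-1) ^+ (n - #|flip A|) = - (-1) ^+ (n - #|A|) :> K.
  have le_n (B : {set 'I_n}) : (#|B| <= n)%N by rewrite -[leqRHS]card_ord max_card.
  have := le_n A; have := le_n (flip A); rewrite /flip; case: ifPn => kA.
    rewrite (cardsD1 k A) kA add1n => _ lt_n.
    by rewrite -(subnSK lt_n) exprS mulN1r.
  by rewrite cardsU1 kA add1n => lt_n _; rewrite -(subnSK lt_n) exprS mulN1r opprK.
have : sgnsum f = - sgnsum f.
  rewrite {1}/sgnsum (reindex_inj (can_inj flipK)) /= -sumrN.
  by apply: eq_big => A; rewrite ?flip_on // => _; exact: flip_sign.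
move=> /eqP; rewrite -subr_eq0 opprK -mulr2n mulrn_eq0 /= => /eqP //.
Qed.

End Tensors.

(** * Chaos kernels *)

Lemma real_setting (R : realType) (V : lmodType R) (dot : V -> V -> R) :
  real_dot dot -> sesquilinear_setting (K := R) idfun (@Num.norm R R) dot.
Proof.
move=> dot_real; split.
- by rewrite normr1.
- exact: normrM.
- exact: ler_normD.
- exact: normr_ge0.
- exact: real_dot_linear.
- by move=> a x y z; rewrite (dotDr dot_real) (dotZr dot_real).
move=> x; exists (dot x x); split; first exact: real_dot_ge0.
move=> m e e_on; under eq_bigr do rewrite real_normK ?num_real //.
exact: bessel.
Qed.

Section Complexification.
Variables (R : realType) (V : lmodType R) (dot : V -> V -> R).
Hypothesis dot_real : real_dot dot.

Notation D := (dsum_dot dot).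
Notation cdot := (complex_dot dot).
Implicit Types (x y z : (V * V)%type).

Lemma dsum_real_dot : real_dot D.
Proof.
split.
- by move=> x y; rewrite /dsum_dot ![dot (y.1) _](dotC dot_real) ![dot (y.2) _](dotC dot_real).
- move=> a x y z; rewrite /dsum_dot /= !(real_dot_linear dot_real); ring.
- by move=> x; rewrite addr_ge0 ?real_dot_ge0.
move=> [x1 x2]; rewrite /dsum_dot /= => /eqP.
rewrite paddr_eq0 ?(real_dot_ge0 dot_real) // => /andP[/eqP x10 /eqP x20].
by rewrite (real_dot_eq0 dot_real x10) (real_dot_eq0 dot_real x20).
Qed.

Definition mul_i x : (V * V)%type := (- x.2, x.1).

Lemma complex_dotE x y : cdot x y = D x y +i* D x (mul_i y).
Proof. by rewrite /complex_dot /dsum_dot /= (dotNr dot_real) [- _ + _]addrC. Qed.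

Lemma dsum_dot_mul_i x y : D (mul_i x) (mul_i y) = D x y.
Proof. by rewrite /dsum_dot /= (dotNl dot_real) (dotNr dot_real) opprK addrC. Qed.

Lemma dsum_dot_mul_il x y : D (mul_i x) y = - D x (mul_i y).
Proof. by rewrite /dsum_dot /= (dotNl dot_real) (dotNr dot_real) opprD opprK addrC. Qed.

Lemma normc_complex_dot x y :
  Normc.normc (cdot x y) ^+ 2 = D x y ^+ 2 + D x (mul_i y) ^+ 2.
Proof. by rewrite normc_sqr complex_dotE. Qed.

(** The real and imaginary parts of the complex product with e_k are the real products with e_k and
    with i e_k. *)
Lemma orthonormal_realify (I : eqType) (e : I -> complexification V) :
  Defs.orthonormal cdot e ->
  Defs.orthonormal D (fun p : I * bool => if p.2 then mul_i (e p.1) else e p.1).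
Proof.
move=> e_on.
have eE j k : D (e j) (e k) = (j == k)%:R /\ D (e j) (mul_i (e k)) = 0.
  have := e_on j k; rewrite complex_dotE => /eqP; rewrite eq_complex => /andP[/eqP E1 /eqP E2].
  by move: E1 E2 => /= -> ->; case: eqP.
move=> [j a] [k b] /=; rewrite xpair_eqE.
have [E1 E2] := eE j k.
by case: a; case: b; rewrite ?dsum_dot_mul_i ?dsum_dot_mul_il
  ?E1 ?E2 ?oppr0 ?andbT ?andbF.
Qed.

Lemma complex_bessel (I : finType) (e : I -> complexification V) x :
  Defs.orthonormal cdot e -> \sum_j Normc.normc (cdot x (e j)) ^+ 2 <= D x x.
Proof.
move=> /orthonormal_realify e_on.
apply: le_trans (bessel dsum_real_dot e_on x).
rewrite -(pair_bigA _ (fun j b => D x (if b then mul_i (e j) else e j) ^+ 2)) /=.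
by apply: ler_sum => j _; rewrite big_bool normc_complex_dot addrC.
Qed.

Lemma complex_setting :
  sesquilinear_setting (K := R[i]) conjc (@Normc.normc R) (E := complexification V) cdot.
Proof.
split.
- exact: Normc.normc1.
- exact: Normc.normcM.
- exact: le_normcD.
- exact: normc_ge0.
- case=> a b x y z; apply/eqP; rewrite eq_complex /= !(dotDl dot_real, dotNl dot_real, dotZl
  dot_real).
  by apply/andP; split; apply/eqP; ring.
- case=> a b x y z; apply/eqP; rewrite eq_complex /= !(dotDr dot_real, dotNr dot_real, dotZr
  dot_real).
  by apply/andP; split; apply/eqP; ring.
move=> x; exists (D x x); split; first exact: real_dot_ge0 dsum_real_dot _.
by move=> m e; exact: complex_bessel.
Qed.

End Complexification.

Lemma bit_inj p (j j' : nat) : (j < 2 ^ p)%N -> (j' < 2 ^ p)%N ->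
  (forall l, (l < p)%N -> bit j l = bit j' l) -> j = j'.
Proof.
elim: p j j' => [|p IH] j j'; first by rewrite expn0 !ltnS !leqn0 => /eqP-> /eqP->.
move=> jp jp' E.
have half_lt i : (i < 2 ^ p.+1)%N -> (i./2 < 2 ^ p)%N.
  by rewrite expnS mul2n ltn_half_double.
have bitS i l : bit i l.+1 = bit i./2 l by rewrite /bit expnS divnMA divn2.
have bit0 i : bit i 0 = odd i by rewrite /bit divn1.
rewrite -(odd_double_half j) -(odd_double_half j') -!bit0 E //.
congr (_ + _.*2)%N; apply: IH; rewrite ?half_lt // => l lp.
by rewrite -!bitS E.
Qed.

(** Binary expansion is a bijection onto two-letter words; a sum over words can be distributed over
    the positions. *)
Lemma sum_bits (U : nmodType) p (G : ('I_p -> bool) -> U) :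
  \sum_(j < 2 ^ p) G (fun l : 'I_p => bit j l) = \sum_(b : {ffun 'I_p -> bool}) G b.
Proof.
pose h (j : 'I_(2 ^ p)) : {ffun 'I_p -> bool} := [ffun l : 'I_p => bit j l].
have h_inj : injective h.
  move=> j j' /ffunP E; apply: val_inj; apply: (bit_inj (ltn_ord j) (ltn_ord j')) => l lp.
  by have := E (Ordinal lp); rewrite !ffunE.
have h_bij : bijective h.
  by apply: inj_card_bij => //; rewrite card_ffun card_bool !card_ord.
rewrite [RHS](reindex h); last exact: onW_bij.
by apply: eq_bigr => j _; congr G; apply/funext => l; rewrite ffunE.
Qed.

Lemma sum_sets (U : nmodType) (I : finType) (G : (I -> bool) -> U) :
  \sum_(A : {set I}) G (fun l => l \in A) = \sum_(a : {ffun I -> bool}) G a.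
Proof.
rewrite [RHS](reindex (fun A : {set I} => [ffun l => l \in A])) /=; last first.
  exists (fun a : {ffun I -> bool} => [set l | a l]%SET) => [A _|a _].
    by apply/finset.setP => l; rewrite inE ffunE.
  by apply/ffunP => l; rewrite ffunE inE.
by apply: eq_bigr => A _; congr G; apply/funext => l; rewrite ffunE.
Qed.

Lemma ler_sum_inj (R : realDomainType) (I J : finType) (h : I -> J) (F : J -> R) :
  injective h -> (forall j, 0 <= F j) -> \sum_i F (h i) <= \sum_j F j.
Proof.
move=> h_inj F0; rewrite (bigID (fun j => j \in codom h)) /= -[leLHS]addr0 lerD ?sumr_ge0 //.
have -> : \sum_i F (h i) = \sum_(j in [set h i | i : I]%SET) F j.
  by rewrite big_imset //= => i j _ _; exact: h_inj.
rewrite (eq_bigl (fun j => j \in codom h)) // => j.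
by apply/imsetP/codomP => [[i _ ->]|[i ->]]; exists i.
Qed.

Section ChaosKernel.
Variables (R : realType) (V : lmodType R) (dot : V -> V -> R).
Hypothesis dot_real : real_dot dot.
Variables (p : nat) (k : 'I_p.+1).

Notation D := (dsum_dot dot).
Notation cdot := (complex_dot dot).
Notation N := (k + (p - k))%N.
Notation kernel_cast := (cast_ord (esym (subnKC (leq_ord k)))).

Definition kernel_coef : R := (Num.sqrt 2)^- p * ((p`!)%:R / ((k`!)%:R * ((p - k)`!)%:R)).

(** The share of one position in [Vcoef], as [im_weight] is in [complex_tensor]. Coefficients that
    are products over positions make the kernel of a pure power factorize. *)
Definition bit_weight (l : 'I_p) (b : bool) : R[i] :=
  if b then (if (l < k)%N then - 'i%C else 'i%C) else 1.

Definition im_weight (a : bool) : R[i] := if a then - 'i%C else 1.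

(* The real vector on which [g] is evaluated: the real or imaginary part of
   [z], placed in the first or second copy of [V]. *)
Definition real_part (b a : bool) (z : complexification V) : (V * V)%type :=
  let y := if a then z.2 else z.1 in if b then (0, y) else (y, 0).

Definition kernel_sum (g : functional (V * V)%type p) (x : 'I_p -> complexification V) : R[i] :=
  \sum_(b : {ffun 'I_p -> bool}) \sum_(a : {ffun 'I_p -> bool})
    (\prod_l (bit_weight l (b l) * im_weight (a l))) *
    (g (fun l => real_part (b l) (a l) (x l)))%:C.

Lemma prod_bit_weight (b : nat -> bool) :
  (- 'i%C) ^+ (\sum_(0 <= l < k) b l)%N * 'i%C ^+ (\sum_(k <= l < p) b l)%N =
  \prod_(l < p) bit_weight l (b l).
Proof.
rewrite !expr_sum -(big_mkord predT (fun l => if b l then (if (l < k)%N then - 'i%C else 'i%C)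
  else 1)).
rewrite (big_cat_nat (leq0n k) (leq_ord k)) /=.
congr (_ * _); apply: eq_big_nat => l /andP[kl lk].
  by rewrite lk; case: (b l).
by rewrite ltnNge kl; case: (b l).
Qed.

Lemma prod_im_weight (A : {set 'I_p}) :
  (- 'i%C) ^+ #|A| = \prod_(l < p) im_weight (l \in A).
Proof. by rewrite -prodr_const [LHS]big_mkcond. Qed.

Lemma chaos_kernelE (g : functional (V * V)%type p) x :
  chaos_kernel g (fun=> 0) k x = kernel_coef%:C * kernel_sum g (x \o kernel_cast).
Proof.
rewrite /chaos_kernel; congr (_ * _).
rewrite /kernel_sum -(sum_bits (fun b => \sum_(a : {ffun 'I_p -> bool})
   (\prod_l (bit_weight l (b l) * im_weight (a l))) * (g (fun l => real_part (b l) (a l) ((x \o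
     kernel_cast) l)))%:C)).
apply: eq_bigr => j _; rewrite /Vcoef prod_bit_weight /complex_tensor mulr_sumr.
rewrite -(sum_sets (fun a => (\prod_l (bit_weight l (bit j l) * im_weight (a l))) *
   (g (fun l => real_part (bit j l) (a l) ((x \o kernel_cast) l)))%:C)).
apply: eq_bigr => A _; rewrite prod_im_weight mulrA -big_split /=; congr (_ * _).
Qed.

Lemma chaos_kernel_split (g1 g2 : functional (V * V)%type p) x :
  chaos_kernel g1 g2 k x =
  'i%C * chaos_kernel g2 (fun=> 0) k x + chaos_kernel g1 (fun=> 0) k x.
Proof.
rewrite /chaos_kernel [X in _ = X + _]mulrCA -mulrDr; congr (_ * _).
rewrite mulr_sumr -big_split /=; apply: eq_bigr => j _.
rewrite [X in _ = X + _]mulrCA -mulrDr; congr (_ * _).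
rewrite /complex_tensor mulr_sumr -big_split /=; apply: eq_bigr => A _.
rewrite [X in _ = X + _]mulrCA -mulrDr; congr (_ * _).
by apply/eqP; rewrite eq_complex /component /=; apply/andP; split; apply/eqP; ring.
Qed.

Lemma chaos_kernel_linear c (g h : functional (V * V)%type p) x :
  chaos_kernel (fun y => c * g y + h y) (fun=> 0) k x =
  c%:C * chaos_kernel g (fun=> 0) k x + chaos_kernel h (fun=> 0) k x.
Proof.
rewrite !chaos_kernelE [X in _ = X + _]mulrCA -mulrDr; congr (_ * _).
rewrite mulr_sumr -big_split /=; apply: eq_bigr => b _.
rewrite mulr_sumr -big_split /=; apply: eq_bigr => a _.
by rewrite rmorphD rmorphM /=; ring.
Qed.

(** The sums distribute over the positions. At each one the four terms (first or second copy, real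
    or imaginary part) assemble into a complex inner product with [v], conjugated where the second
    copy has weight -i. *)
Lemma kernel_sum_pure (v : (V * V)%type) x :
  kernel_sum (pure_tensor D (fun=> v)) x =
  \prod_(l < p) cdot (if (l < k)%N then (v.1, - v.2) else v) (x l).
Proof.
rewrite /kernel_sum /pure_tensor.
under eq_bigr => b _ do under eq_bigr => a _ do
  rewrite rmorph_prod -big_split /=.
under eq_bigr => b _ do rewrite -(bigA_distr_bigA (fun (l : 'I_p) (a : bool) =>
   bit_weight l (b l) * im_weight a * (D v (real_part (b l) a (x l)))%:C)) /=.
rewrite -(bigA_distr_bigA (fun (l : 'I_p) (b : bool) => \sum_a
   bit_weight l b * im_weight a * (D v (real_part b a (x l)))%:C)) /=.
apply: eq_bigr => l _; rewrite !big_bool /bit_weight /im_weight /real_part /dsum_dot /complex_dot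
  /=.
case: (l < k)%N; apply/eqP; rewrite eq_complex /= ?(dotNl dot_real) !(dotC dot_real _ 0) !(dot0l
  dot_real).
  by apply/andP; split; apply/eqP; ring.
by apply/andP; split; apply/eqP; ring.
Qed.

Lemma chaos_kernel_pure (v : (V * V)%type) :
  chaos_kernel (pure_tensor D (fun=> v)) (fun=> 0) k =
  (fun x => kernel_coef%:C *
    tensor_product (pure_tensor cdot (fun _ : 'I_k => ((v.1, - v.2) : complexification V)))
      (pure_tensor cdot (fun _ : 'I_(p - k) => (v : complexification V))) x).
Proof.
apply/funext => x; rewrite chaos_kernelE kernel_sum_pure; congr (_ * _).
rewrite (reindex (cast_ord (subnKC (leq_ord k)))) /=; last first.
  by exists kernel_cast => i _; apply: val_inj.
rewrite big_split_ord /= /tensor_product /pure_tensor; congr (_ * _).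
  apply: eq_bigr => i _; rewrite ltn_ord; congr (cdot _ (x _)); exact: val_inj.
apply: eq_bigr => i _; rewrite ltnNge leq_addr /=; congr (cdot _ (x _)); exact: val_inj.
Qed.

End ChaosKernel.

Lemma sum_sqr_le (R : realDomainType) (I : finType) : exists C : R, 0 <= C /\
  forall x : I -> R, (\sum_i x i) ^+ 2 <= C * \sum_i x i ^+ 2.
Proof.
elim: (index_enum I) => [|i s [C [C0 HC]]].
  by exists 0; split => // x; rewrite !big_nil expr0n mul0r.
exists (2 + 2 * C); split; first by rewrite addr_ge0 // mulr_ge0.
move=> x; rewrite !big_cons; have := HC x.
set S := \sum_(j <- s) x j; set Q := \sum_(j <- s) _ => SQ.
have Q0 : 0 <= Q by rewrite sumr_ge0 // => j _; exact: sqr_ge0.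
have : 0 <= (x i - S) ^+ 2 by exact: sqr_ge0.
have : 0 <= C * x i ^+ 2 by rewrite mulr_ge0 // sqr_ge0.
rewrite !expr2 mulrDr !mulrDl in SQ *; lra.
Qed.

Lemma sum_ffun_perm (U : nmodType) (J : finType) p (s : 'S_p) (G : {ffun 'I_p -> J} -> U) :
  \sum_b G b = \sum_(b : {ffun 'I_p -> J}) G [ffun l => b (s l)].
Proof.
apply: reindex; exists (fun b : {ffun 'I_p -> J} => [ffun l => b ((s^-1)%g l)]) => b _;
  by apply/ffunP => l; rewrite !ffunE ?permK ?permKV.
Qed.

(** * Symmetry, antilinearity and norm bound of the chaos kernels *)

Section ChaosKernelMembership.
Variables (R : realType) (V : lmodType R) (dot : V -> V -> R).
Hypothesis dot_real : real_dot dot.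
Variables (p : nat) (k : 'I_p.+1).

Notation D := (dsum_dot dot).
Notation cdot := (complex_dot dot).
Notation N := (k + (p - k))%N.
Notation kernel_cast := (cast_ord (esym (subnKC (leq_ord k)))).

Lemma kernel_sum_perm (g : functional (V * V)%type p) (s : 'S_p) x :
  (forall (t : 'S_p) y, g (y \o t) = g y) ->
  (forall l, (s l < k)%N = (l < k)%N) -> kernel_sum k g (x \o s) = kernel_sum k g x.
Proof.
move=> g_sym sk; rewrite /kernel_sum.
rewrite [LHS](sum_ffun_perm s); apply: eq_bigr => b _.
rewrite [LHS](sum_ffun_perm s); apply: eq_bigr => a _.
congr (_ * (_)%:C).
  rewrite [RHS](reindex_perm s); apply: eq_bigr => l _.
  by rewrite !ffunE /bit_weight sk.
rewrite -[in RHS](g_sym s); congr g; apply/funext => l /=.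
by rewrite !ffunE.
Qed.

(** Transported through the cast, the pair (s, t) is a permutation preserving [l < k], the only
    feature of a position seen by [bit_weight]. *)
Lemma chaos_kernel_sym (g : functional (V * V)%type p) (s : 'S_k) (t : 'S_(p - k)) x y :
  (forall (t : 'S_p) y, g (y \o t) = g y) ->
  chaos_kernel g (fun=> 0) k (concat (x \o s) (y \o t)) =
  chaos_kernel g (fun=> 0) k (concat x y).
Proof.
move=> g_sym; rewrite !chaos_kernelE; congr (_ * _).
pose c l : 'I_p := cast_ord (subnKC (leq_ord k)) l.
pose h (l : 'I_p) : 'I_p :=
  c (match fintype.split (kernel_cast l) with
     | inl i => lshift (p - k) (s i) | inr i => rshift k (t i) end).
have cK : cancel kernel_cast c by move=> l; exact: val_inj.
have Kc : cancel c kernel_cast by move=> l; exact: val_inj.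
have hE z : concat (x \o s) (y \o t) (kernel_cast z) = concat x y (kernel_cast (h z)).
  rewrite /h Kc {1}/concat.
  by case: (fintype.split (kernel_cast z)) => i; rewrite ?concat_lshift ?concat_rshift.
have h_inj : injective h.
  move=> i j /(can_inj Kc); rewrite -{2}(cK i) -{2}(cK j).
  case: (split_ordP (kernel_cast i)) => a -> ; case: (split_ordP (kernel_cast j)) => b ->.
  - by move=> /lshift_inj/perm_inj ->.
  - by move=> /eqP; rewrite eq_lrshift.
  - by move=> /eqP; rewrite eq_rlshift.
  - by move=> /rshift_inj/perm_inj ->.
have -> : concat (x \o s) (y \o t) \o kernel_cast = (concat x y \o kernel_cast) \o perm h_inj.
  by apply/funext => l /=; rewrite permE hE.
apply: kernel_sum_perm => // l; rewrite permE /h.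
rewrite -[in RHS](cK l).
case: (split_ordP (kernel_cast l)) => i _ /=; first by rewrite ltn_ord.
by rewrite ltnNge leq_addr.
Qed.

(** As [g] is only linear over the reals, real scalars and i are treated separately; together they
    give every complex scalar. *)
Lemma kernel_sum_antilinear (g : functional (V * V)%type p) :
  @antilinear R idfun _ _ g -> @antilinear R[i] conjc (complexification V) _ (kernel_sum k g).
Proof.
move=> g_lin x l.
pose gam (b a : {ffun 'I_p -> bool}) u :=
  g [eta (fun j => real_part (b j) (a j) (x j)) with l |-> u].
pose W (b a : {ffun 'I_p -> bool}) : R[i] :=
  \prod_j (bit_weight R k j (b j) * im_weight R (a j)).
pose Phi z := kernel_sum k g [eta x with l |-> z].
have PhiE z : Phi z = \sum_b \sum_a W b a * (gam b a (real_part (b l) (a l) z))%:C.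
  apply: eq_bigr => b _; apply: eq_bigr => a _; congr (_ * (g _)%:C).
  by apply/funext => j /=; case: eqP => // ->.
have gam_lin b a r u v : gam b a (r *: u + v) = r * gam b a u + gam b a v by exact: g_lin.
have PhiR (r : R) u v : Phi (r%:C *: u + v) = r%:C * Phi u + Phi v.
  rewrite !PhiE mulr_sumr -big_split; apply: eq_bigr => b _ /=.
  rewrite mulr_sumr -big_split; apply: eq_bigr => a _ /=.
  have -> : real_part (b l) (a l) (r%:C *: u + v) =
      r *: real_part (b l) (a l) u + real_part (b l) (a l) v.
    rewrite /real_part; case: (a l); case: (b l); apply/eqP; rewrite xpair_eqE /=;
      by rewrite !scale0r ?scaler0 ?addr0 ?subr0 !eqxx.
  by rewrite gam_lin rmorphD rmorphM /=; ring.
have PhiI u : Phi ('i%C *: u) = - 'i%C * Phi u.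
  rewrite !PhiE mulr_sumr; apply: eq_bigr => b _.
  (* Multiplication by i exchanges the real and imaginary parts of argument [l] up to a sign;
     toggling [a l] matches the terms. *)
  pose fl (a : {ffun 'I_p -> bool}) : {ffun 'I_p -> bool} := [ffun j => a j (+) (j == l)].
  have flK : involutive fl by move=> a; apply/ffunP => j; rewrite !ffunE -addbA addbb addbF.
  rewrite (reindex_inj (can_inj flK)) mulr_sumr; apply: eq_bigr => a _.
  have -> : gam b (fl a) = gam b a.
    apply/funext => u'; congr g; apply/funext => j /=.
    by case: eqP => // /eqP/negbTE jl; rewrite ffunE jl addbF.
  have fll : fl a l = ~~ a l by rewrite ffunE eqxx addbT.
  have -> : real_part (b l) (fl a l) ('i%C *: u) =
      (if a l then -1 else 1) *: real_part (b l) (a l) u + 0.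
    rewrite fll /real_part; case: (a l); case: (b l); apply/eqP; rewrite xpair_eqE /=;
      by rewrite !scale0r !scale1r ?scaler0 ?addr0 ?subr0 ?sub0r ?add0r ?scaleN1r ?eqxx.
  rewrite gam_lin; have -> : gam b a 0 = 0.
    by have := gam_lin b a (-1) 0 0; rewrite scaler0 addr0 mulN1r addNr.
  rewrite /W (bigD1 l) //= [in RHS](bigD1 l) //= fll.
  rewrite (eq_bigr (fun j => bit_weight R k j (b j) * im_weight R (a j))); last first.
    by move=> j /negbTE jl; rewrite ffunE jl addbF.
  rewrite addr0 rmorphM /= /im_weight; case: (a l) => /=; rewrite ?rmorphN1 ?rmorph1.
    have i2 : 'i%C * 'i%C = -1 :> R[i] by rewrite -expr2 sqr_i.
    by rewrite -[RHS]opprK; ring: i2.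
  by ring.
move=> [al be] u v.
have -> : (al +i* be) *: u + v = al%:C *: u + (be%:C *: ('i%C *: u) + v).
  by rewrite scalerA addrA -scalerDl; congr (_ *: _ + _); apply/eqP; rewrite eq_complex /=;
    apply/andP; split; apply/eqP; ring.
rewrite -![kernel_sum _ _ _]/(Phi _) !PhiR PhiI addrA mulrA -mulrDl; congr (_ * _ + _).
by apply/eqP; rewrite eq_complex /=; apply/andP; split; apply/eqP; ring.
Qed.

Lemma chaos_kernel_antilinear (g : functional (V * V)%type p) :
  @antilinear R idfun _ _ g ->
  @antilinear R[i] conjc (complexification V) _ (chaos_kernel g (fun=> 0) k).
Proof.
move=> g_lin x l a u v; rewrite !chaos_kernelE.
have E z : [eta x with l |-> z] \o kernel_cast =
    [eta (x \o kernel_cast) with cast_ord (subnKC (leq_ord k)) l |-> z].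
  by apply/funext => j /=; congr (if _ then _ else _).
by rewrite !E (kernel_sum_antilinear g_lin); ring.
Qed.

(** These parts are not orthonormal in general, but the complex Bessel inequality at (y, 0) controls
    real and imaginary parts together, separately in each copy of [V]. *)
Lemma bessel_family_real_part m (e : 'I_m -> complexification V) :
  Defs.orthonormal cdot e ->
  bessel_family D (fun j : bool * bool * 'I_m => real_part j.1.1 j.1.2 (e j.2)).
Proof.
move=> e_on x.
rewrite -(pair_bigA _ (fun ba i => D x (real_part ba.1 ba.2 (e i)) ^+ 2)) /=.
rewrite -(pair_bigA _ (fun b a => \sum_i D x (real_part b a (e i)) ^+ 2)) /= !big_bool /=.
have half (y : V) : \sum_i dot y (e i).2 ^+ 2 + \sum_i dot y (e i).1 ^+ 2 <= dot y y.
  have <- : D (y, 0) (y, 0) = dot y y by rewrite /dsum_dot /= (dot0l dot_real) addr0.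
  apply: le_trans (complex_bessel dot_real (y, 0) e_on).
  rewrite -big_split; apply: ler_sum => i _.
  by rewrite (normc_complex_dot dot_real) /dsum_dot /= !(dot0l dot_real) !addr0 (dotNr dot_real)
    sqrrN addrC.
have := half x.1; have := half x.2; rewrite /dsum_dot /real_part /=.
have d0 y : dot y 0 = 0 by rewrite (dotC dot_real) (dot0l dot_real).
rewrite -(eq_bigr _ (fun i _ => congr1 (fun r => r ^+ 2) (add0r (dot x.2 (e i).2)))).
rewrite -(eq_bigr _ (fun i _ => congr1 (fun r => r ^+ 2) (add0r (dot x.2 (e i).1)))).
rewrite -(eq_bigr _ (fun i _ => congr1 (fun r => r ^+ 2) (addr0 (dot x.1 (e i).2)))).
rewrite -(eq_bigr _ (fun i _ => congr1 (fun r => r ^+ 2) (addr0 (dot x.1 (e i).1)))).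
rewrite !d0; lra.
Qed.

Lemma normc_kernel_weight (b a : {ffun 'I_p -> bool}) :
  Normc.normc (\prod_l (bit_weight R k l (b l) * im_weight R (a l))) = 1.
Proof.
have i1 : Normc.normc ('i%C : R[i]) = 1 by rewrite /= expr0n add0r expr1n sqrtr1.
have ni1 : Normc.normc (- 'i%C : R[i]) = 1 by rewrite normcN.
rewrite (big_morph _ (@Normc.normcM R) (Normc.normc1 R)) big1 // => l _.
rewrite Normc.normcM /bit_weight /im_weight.
by case: (b l); case: (a l); case: (l < k)%N; rewrite ?i1 ?ni1 ?Normc.normc1 ?mulr1.
Qed.

(** Continuity of the kernel in [g]: only the uniformity of [C] matters. The kernel is a finite sum
    over pairs (b, a) with weights of modulus 1, and for a fixed pair the words in [e] inject into
    words in a Bessel family. *)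
Lemma chaos_kernel_hs_le : exists C : R, 0 <= C /\
  forall g : functional (V * V)%type p, @antilinear R idfun _ _ g ->
  (complex_norm2 cdot (chaos_kernel g (fun=> 0%R) k) <= C%:E * real_norm2 D g)%E.
Proof.
pose B : finType := ({ffun 'I_p -> bool} * {ffun 'I_p -> bool})%type.
have [C0 [C0_ge0 HC0]] := sum_sqr_le R B.
pose nB : R := \sum_(ba : B) 1.
have nB0 : 0 <= nB by exact: sumr_ge0.
exists (kernel_coef R k ^+ 2 * C0 * nB); split.
  by rewrite !mulr_ge0 // sqr_ge0.
move=> g g_lin; apply: ge_ereal_sup => _ [m [e [e_on ->]]].
pose w (j : bool * bool * 'I_m) := real_part j.1.1 j.1.2 (e j.2).
pose S := \sum_(T : {ffun 'I_p -> bool * bool * 'I_m}) g (w \o T) ^+ 2.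
have S_le : (S%:E <= real_norm2 D g)%E.
  exact: (hs_bessel (dsum_real_dot dot_real) g_lin (bessel_family_real_part e_on)).
apply: (@le_trans _ _ (kernel_coef R k ^+ 2 * C0 * nB * S)%:E); last first.
  by rewrite EFinM lee_wpmul2l // lee_fin !mulr_ge0 // sqr_ge0.
rewrite lee_fin.
pose term (t : {ffun 'I_N -> 'I_m}) (ba : B) : R :=
  g (fun l => real_part (ba.1 l) (ba.2 l) (e (t (kernel_cast l)))).
have norm_le (t : {ffun 'I_N -> 'I_m}) :
    Normc.normc (chaos_kernel g (fun=> 0) k (e \o t)) ^+ 2 <=
    kernel_coef R k ^+ 2 * C0 * \sum_ba term t ba ^+ 2.
  rewrite chaos_kernelE Normc.normcM exprMn.
  rewrite normc_sqr /= [0 ^+ 2]expr0n addr0 -mulrA ler_wpM2l ?sqr_ge0 //.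
  pose z (ba : B) : R[i] := (\prod_l (bit_weight R k l (ba.1 l) * im_weight R (ba.2 l))) * (term t
    ba)%:C.
  have -> : kernel_sum k g ((e \o t) \o kernel_cast) = \sum_ba z ba.
    by rewrite /kernel_sum pair_bigA.
  apply: (@le_trans _ _ ((\sum_ba `|term t ba|) ^+ 2)).
    rewrite lerXn2r ?nnegrE ?normc_ge0 ?sumr_ge0 //.
    apply: (big_rec2 (fun u v => Normc.normc u <= v)); first by rewrite Normc.normc0.
    move=> ba u v _ uv; apply: le_trans (le_normcD _ _) _; apply: lerD => //.
    by rewrite Normc.normcM normc_kernel_weight mul1r /= expr0n addr0 sqrtr_sqr.
  apply: le_trans (HC0 _) _; rewrite ler_wpM2l //.
  by apply: ler_sum => ba _; rewrite real_normK ?num_real.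
apply: le_trans; first by apply: ler_sum => t _; exact: norm_le.
rewrite -mulr_sumr -[leRHS]mulrA ler_wpM2l ?mulr_ge0 ?sqr_ge0 // exchange_big /=.
rewrite /nB mulr_suml; apply: ler_sum => -[b a] _; rewrite mul1r.
pose h (t : {ffun 'I_N -> 'I_m}) : {ffun 'I_p -> bool * bool * 'I_m} :=
  [ffun l => (b l, a l, t (kernel_cast l))].
have h_inj : injective h.
  move=> t t' /ffunP E; apply/ffunP => l.
  have := E (cast_ord (subnKC (leq_ord k)) l); rewrite !ffunE => -[].
  by rewrite (_ : kernel_cast _ = l) //; exact: val_inj.
rewrite (eq_bigr (fun t => g (w \o h t) ^+ 2)).
  apply: (le_trans (@ler_sum_inj R _ _ h (fun T : {ffun 'I_p -> bool * bool * 'I_m} => g (w \o T)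
    ^+ 2) h_inj _)) => // T.
  exact: sqr_ge0.
move=> t _; congr (g _ ^+ 2); apply/funext => l.
by rewrite /w /= ffunE.
Qed.

Lemma chaos_kernel_bisymmetric (g1 g2 : functional (V * V)%type p) :
  real_symmetric_power D g1 -> real_symmetric_power D g2 ->
  complex_bisymmetric_power cdot (chaos_kernel g1 g2 k).
Proof.
have one (g : functional (V * V)%type p) : real_symmetric_power D g ->
    complex_bisymmetric_power cdot (chaos_kernel g (fun=> 0) k).
  move=> [[g_lin g_fin] g_sym]; split; last by move=> s t x y; exact: chaos_kernel_sym.
  split; first exact: chaos_kernel_antilinear.
  have [C [C0 HC]] := chaos_kernel_hs_le.
  by apply: le_lt_trans (HC _ g_lin) _; rewrite lte_mul_pinfty ?lee_fin.
move=> g1_sym g2_sym.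
have -> : chaos_kernel g1 g2 k = (fun x => 'i%C * chaos_kernel g2 (fun=> 0) k x +
    chaos_kernel g1 (fun=> 0) k x).
  by apply/funext => x; exact: chaos_kernel_split.
by apply: (bisymmetric_power_linear (complex_setting dot_real)); exact: one.
Qed.

End ChaosKernelMembership.

(** * Wiener-Ito integrals *)

Section AlmostEverywhere.
Context (d : measure_display) (T : measurableType d) (R : realType).
Variable P : probability T R.

(** The bounds are summable, so the sum of the squares is integrable, hence finite almost
    everywhere, and its terms tend to 0. *)
Lemma ae_cvg0 (f : nat -> T -> R) :
  (forall n, measurable_fun setT (f n)) ->
  (forall n, (\int[P]_w (f n w ^+ 2)%:E <= ((2^-1) ^+ n)%:E)%E) ->
  {ae P, forall w, f n w @[n --> \oo] --> (0 : R)}.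
Proof.
move=> f_meas f_le.
pose F n : T -> \bar R := EFin \o (fun w => f n w ^+ 2).
have F_meas n : measurable_fun setT (F n).
  by apply/measurable_EFinP; exact: measurable_funX.
have F0 n w : (0 <= F n w)%E by rewrite lee_fin sqr_ge0.
have sum_le : (\int[P]_w (\sum_(0 <= n <oo) F n w) <= 2%:E)%E.
  rewrite integral_nneseries //.
  apply: (@le_trans _ _ (\sum_(0 <= n <oo) ((2^-1) ^+ n)%:E)%E).
    by apply: lee_nneseries => n *; [exact: integral_ge0|exact: f_le].
  have half k : (2^-1) ^+ k = 2 / (2 ^ (k + 1))%:R :> R.
    by rewrite natrX exprD expr1 invfM mulrCA divff // mulr1 exprVn.
  under eq_eseriesr do rewrite half.
  have := cvg_lim (@ereal_hausdorff R) (@cvg_geometric_eseries_half R 2 0).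
  by rewrite expr0 divr1 /eseries /= => ->.
have F_int : P.-integrable setT (fun w => \sum_(0 <= n <oo) F n w)%E.
  apply/integrableP; split; first exact: ge0_emeasurable_sum.
  under eq_integral do rewrite gee0_abs ?nneseries_ge0 //.
  exact: le_lt_trans sum_le (ltry _).
apply: filterS (integrable_ae measurableT F_int) => w /(_ Logic.I) Fw.
have sq_cvg : f n w ^+ 2 @[n --> \oo] --> (0 : R).
  apply: cvg_series_cvg_0; apply: nondecreasing_is_cvgn.
    by apply: nondecreasing_series => n _ _; exact: sqr_ge0.
  exists (fine (\sum_(0 <= n <oo) F n w)%E) => _ [n _ <-].
  rewrite -lee_fin fineK // /series /= -sumEFin.
  by apply: (@nneseries_lim_ge R (fun k => F k w) xpredT 0 n) => k _ _; exact: F0.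
apply/cvgrPdist_lt => eps eps0; move/cvgrPdist_lt: sq_cvg => /(_ (eps ^+ 2)).
rewrite exprn_gt0 // => /(_ isT); apply: filterS => n.
rewrite !sub0r !normrN normrX; rewrite ltr_pXn2r ?nnegrE //; exact: ltW.
Qed.

End AlmostEverywhere.

Section IsonormalProcess.
Context (d : measure_display) (T : measurableType d) (R : realType).
Variables (P : probability T R) (V : lmodType R) (dot : V -> V -> R).
Hypothesis dot_real : real_dot dot.
Variable X : V -> {RV P >-> R}.
Hypothesis X_isonormal : isonormal dot X.

Lemma isonormal_norm_sum (I : finType) (a : I -> R) (h : I -> V) :
  (\int[P]_w ((\sum_i a i * X (h i) w) ^+ 2)%:E =
  (dot (\sum_i a i *: h i) (\sum_i a i *: h i))%:E)%E.
Proof.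
have cov u v : (\int[P]_w (X u w * X v w)%:E = (dot u v)%:E)%E.
  by case: X_isonormal => _ _ /(_ u v); rewrite unlock.
(* Expanding the square under the integral needs integrable products, which |x y| <= x^2 + y^2
   provides. *)
have prod_int u v : P.-integrable setT (fun w => (X u w * X v w)%:E).
  apply: (@le_integrable _ _ _ _ _ measurableT _
    (fun w => ((X u w * X u w)%:E + (X v w * X v w)%:E)%E)).
  - apply/measurable_EFinP; exact: measurable_funM.
  - move=> w _; rewrite -EFinD !abse_EFin lee_fin.
    rewrite -!expr2 (ger0_norm (addr_ge0 (sqr_ge0 _) (sqr_ge0 _))) normrM.
    have := sqr_ge0 (`|X u w| - `|X v w|); have := sqr_ge0 (X u w); have := sqr_ge0 (X v w).
    rewrite sqrrB -!normrX !(ger0_norm (sqr_ge0 _)) -mulr_natl; lra.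
  have sq_int z : P.-integrable setT (fun w => (X z w * X z w)%:E).
    apply/integrableP; split; first by apply/measurable_EFinP; exact: measurable_funM.
    under eq_integral do rewrite abse_EFin -expr2 (ger0_norm (sqr_ge0 _)) expr2.
    by rewrite cov ltry.
  by apply: integrableD => //; exact: sq_int.
rewrite (eq_integral (fun w => \sum_(ij : I * I) (a ij.1 * a ij.2)%:E * (X (h ij.1) w * X (h ij.2)
  w)%:E)%E).
  rewrite integral_sum // => [|ij]; last exact: integrableZl.
  rewrite (eq_bigr (fun ij => (a ij.1 * a ij.2 * dot (h ij.1) (h ij.2))%:E)); last first.
    by move=> ij _; rewrite integralZl // cov -EFinM.
  rewrite sumEFin (dot_suml dot_real) -(pair_bigA _ (fun i j => a i * a j * dot (h i) (h j))) /=.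
  congr EFin; apply: eq_bigr => i _; rewrite (dotZl dot_real) (dot_sumr dot_real) mulr_sumr.
  by apply: eq_bigr => j _; rewrite (dotZr dot_real) mulrA.
move=> w _; rewrite expr2 mulr_suml.
under eq_bigr do rewrite mulr_sumr.
rewrite pair_bigA -sumEFin /=; apply: eq_bigr => ij _.
by rewrite -EFinM; congr EFin; ring.
Qed.

Lemma isonormal_norm (u v : V) :
  (\int[P]_w ((X u w - X v w) ^+ 2)%:E = (dot (u - v) (u - v))%:E)%E.
Proof.
have := isonormal_norm_sum (fun b : bool => if b then 1 else -1) (fun b => if b then u else v).
rewrite big_bool scale1r scaleN1r => <-; apply: eq_integral => w _.
by rewrite big_bool /= mul1r mulN1r.
Qed.

(** [isonormal] prescribes covariances, not linearity. Almost sure linearity follows because the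
    difference of the two sides has the L^2 norm of the zero vector. *)
Lemma isonormal_sum (I : finType) (a : I -> R) (h : I -> V) :
  {ae P, forall w, X (\sum_i a i *: h i) w = \sum_i a i * X (h i) w}.
Proof.
pose Z w := X (\sum_i a i *: h i) w - \sum_i a i * X (h i) w.
have Z_norm : (\int[P]_w (Z w ^+ 2)%:E = 0)%E.
  have := isonormal_norm_sum (fun o : unit + I => if o is inr i then - a i else 1)
    (fun o => if o is inr i then h i else \sum_i a i *: h i).
  rewrite big_sumType /= big_const card_unit /= scale1r addr0.
  have -> : \sum_i - a i *: h i = - \sum_i a i *: h i.
    by rewrite -sumrN; apply: eq_bigr => i _; rewrite scaleNr.
  rewrite subrr (dot0l dot_real) => E; rewrite -[RHS]/(0%:E) -E.
  apply: eq_integral => w _; rewrite big_sumType /= big_const card_unit /= mul1r addr0.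
  rewrite /Z -sumrN; congr ((_ + _) ^+ 2)%:E.
  by apply: eq_bigr => i _; rewrite mulNr.
have Z_meas : measurable_fun setT Z.
  apply: measurable_funB => //; apply: measurable_sum => i.
  exact: measurable_funM.
(* A constant sequence turns the vanishing norm into almost sure vanishing. *)
have : {ae P, forall w, Z w @[_ --> \oo] --> (0 : R)}.
  by apply: (ae_cvg0 (f := fun=> Z)) => // n; rewrite Z_norm lee_fin exprn_ge0.
apply: filterS => w cvgZ.
apply/eqP; rewrite -subr_eq0 -/(Z w); apply/eqP.
rewrite -(cvg_lim (@Rhausdorff R) cvgZ); apply/esym/cvg_lim => //; exact: cvg_cst.
Qed.

End IsonormalProcess.

Section MultiTensor.
Variables (K : numFieldType) (E : lmodType K) (dot : E -> E -> K).

Lemma symm_pure_perm n (u : 'I_n -> E) (s : 'S_n) :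
  symm (pure_tensor dot (u \o s)) = symm (pure_tensor dot u).
Proof.
apply/funext => x; rewrite /symm; congr (_ * _).
have inv_inj : injective (fun t : 'S_n => (s^-1 * t)%g) by exact: mulgI.
rewrite [RHS](reindex_inj inv_inj); apply: eq_bigr => t _.
rewrite /pure_tensor [RHS](reindex_perm s); apply: eq_bigr => l _ /=.
by rewrite permM permK.
Qed.

(** [multi_tensor] enumerates the multiset in its own order, and [size m] equals [n] only
    propositionally. A predicate [Q] on all lengths avoids casting functionals. *)
Lemma multi_tensor_ind (I : choiceType) (e : I -> E) n (s : 'I_n -> I) (m : {mset I}%mset)
    (Q : forall n, functional E n -> Prop) :
  perm_eq m (codom s) -> Q (size m) (multi_tensor dot e m) ->
  Q n (symm (pure_tensor dot (e \o s))).
Proof.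
move=> m_s; have sz : size m = n by rewrite (perm_size m_s) size_codom card_ord.
move: s m_s; case: n / sz => s m_s.
have /tuple_permP[t tE] : perm_eq (in_tuple m) (mktuple s) by [].
suff -> : multi_tensor dot e m = symm (pure_tensor dot (e \o s)) by [].
rewrite -(symm_pure_perm _ t) /multi_tensor; congr (symm (pure_tensor dot _)).
apply/funext => l /=; congr e.
have -> : in_tuple m = [tuple tnth (mktuple s) (t i) | i < size m] by apply: val_inj.
by rewrite !tnth_mktuple.
Qed.

Lemma seq_mset_codom (I : choiceType) n (s : 'I_n -> I) k :
  seq_mset (codom s) k = (\sum_l (s l == k))%N.
Proof.
rewrite mset_seqE /codom /image_mem count_map -sum1_count big_enum_cond /=.
by rewrite [LHS]big_mkcond; apply: eq_bigr => l _ /=; case: eqP.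
Qed.

Lemma prod_finsupp_seq_mset (I : choiceType) n (A : {fset I}) (s : 'I_n -> A)
    (R : comPzSemiRingType) (F : I -> nat -> R) : (forall k, F k 0%N = 1) ->
  \prod_(k <- finsupp (seq_mset (codom (val \o s)))) F k (seq_mset (codom (val \o s)) k) =
  \prod_(k : A) F (val k) (\sum_l (s l == k))%N.
Proof.
move=> F0; set m := seq_mset _.
have m_A : (finsupp m `<=` A)%fset.
  apply/fsubsetP => k; rewrite msuppE (perm_mem (perm_eq_seq_mset _)) => /codomP[l ->].
  exact: valP.
rewrite (big_fset_incl _ m_A) /=; last first.
  by move=> k _ km; rewrite fsfun_dflt.
rewrite big_seq_fsetE; apply: eq_bigr => k _; congr F.
by rewrite seq_mset_codom; apply: eq_bigr => l _; rewrite val_eqE.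
Qed.

End MultiTensor.

Lemma cvg_hermite_args (R : realType) n (x r : nat -> R) (x0 r0 : R) :
  x @ \oo --> x0 -> r @ \oo --> r0 ->
  hermite n (x m) (r m) @[m --> \oo] --> hermite n x0 r0.
Proof.
move=> x_cvg r_cvg; elim/ltn_ind: n => -[|n] IH; first exact: cvg_cst.
under eq_fun do rewrite hermiteS; rewrite hermiteS.
apply: cvgB; first by apply: cvgM => //; exact: IH.
apply: cvgM; first by apply: cvgM => //; exact: cvg_cst.
by apply: IH; rewrite ltnS leq_pred.
Qed.

Section AlmostEverywhereLinear.
Context (d : measure_display) (T : measurableType d) (R : realType).
Variables (P : probability T R) (K : pzRingType) (A : Type).
Variables (S : set (A -> K)) (L : (A -> K) -> T -> K).
Hypothesis L_linear : forall a f g, S f -> S g ->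
  {ae P, forall w, L (fun x => a * f x + g x) w = a * L f w + L g w}.
Hypothesis S_linear : forall a f g, S f -> S g -> S (fun x => a * f x + g x).
Hypothesis S0 : S (fun=> 0).

Lemma ae_linear_sum (I : Type) (r : seq I) (c : I -> K) (f : I -> A -> K) :
  (forall i, S (f i)) ->
  S (fun x => \sum_(i <- r) c i * f i x) /\
  {ae P, forall w, L (fun x => \sum_(i <- r) c i * f i x) w = \sum_(i <- r) c i * L (f i) w}.
Proof.
move=> Sf; elim: r => [|i r [Sr IH]].
  under eq_fun do rewrite big_nil; split => //.
  have := L_linear (-1) S0 S0; apply: filterS => w.
  rewrite (_ : (fun x => _) = fun=> 0); last by apply/funext => x; rewrite mulr0 addr0.
  by rewrite mulN1r addNr big_nil.
under eq_fun do rewrite big_cons; split; first exact: S_linear.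
have := L_linear (c i) (Sf i) Sr; apply: filterS2 IH => w.
by rewrite big_cons => <- ->.
Qed.

End AlmostEverywhereLinear.

(** * The real integral of a pure power *)

Section RealIntegral.
Context (d : measure_display) (T : measurableType d) (R : realType).
Variables (P : probability T R) (V : lmodType R) (dot : V -> V -> R).
Hypothesis dot_real : real_dot dot.
Variables (X Y : V -> {RV P >-> R}).
Hypotheses (X_isonormal : isonormal dot X) (Y_isonormal : isonormal dot Y).
Variable He : nat -> R -> R.
Hypothesis He_hermite : hermite_polynomials He.
Variables (I : countType) (eta : I -> (V * V)%type).
Hypothesis eta_cons : complete_orthonormal (dsum_dot dot) eta.
Variable In : forall n, functional (V * V)%type n -> T -> R.
Hypothesis In_integral : wiener_ito dot X Y He eta In.

Notation D := (dsum_dot dot).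
Notation W := (sum_process X Y).
Let D_real : real_dot D := dsum_real_dot dot_real.
Let D_setting := real_setting D_real.

Lemma sum_process_sum (J : finType) (c : J -> R) (v : J -> (V * V)%type) :
  {ae P, forall w, W (\sum_k c k *: v k) w = \sum_k c k * W (v k) w}.
Proof.
have sum1 : (\sum_k c k *: v k).1 = \sum_k c k *: (v k).1 by exact: (big_morph fst).
have sum2 : (\sum_k c k *: v k).2 = \sum_k c k *: (v k).2 by exact: (big_morph snd).
have hX := isonormal_sum dot_real X_isonormal c (fun k => (v k).1).
have hY := isonormal_sum dot_real Y_isonormal c (fun k => (v k).2).
apply: filterS2 hX hY => w; rewrite -sum1 -sum2 /sum_process => -> ->.
by rewrite -big_split /=; apply: eq_bigr => k _; rewrite mulrDr.
Qed.

Lemma In_lin_comb n (J : finType) (c : J -> R) (f : J -> functional (V * V)%type n) :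
  (forall j, real_symmetric_power D (f j)) ->
  real_symmetric_power D (fun x => \sum_j c j * f j x) /\
  {ae P, forall w, In (fun x => \sum_j c j * f j x) w = \sum_j c j * In (f j) w}.
Proof.
apply: ae_linear_sum.
- by move=> a g h gS hS; exact: (wiener_ito_linear In_integral a gS hS).
- by move=> a g h gS hS; exact: (symmetric_power_linear D_setting a gS hS).
exact: (symmetric_power_zero D_setting n).
Qed.

Lemma In_basis n (A : {fset I}) (s : 'I_n -> A) :
  {ae P, forall w, In (symm (pure_tensor D (eta \o val \o s))) w =
    \prod_(k : A) hermite (\sum_l (s l == k))%N (W (eta (val k)) w) 1}.
Proof.
apply: (@multi_tensor_ind _ _ D _ eta n (val \o s) (seq_mset (codom (val \o s)))
  (fun m f => {ae P, forall w, In f w =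
    \prod_(k : A) hermite (\sum_l (s l == k))%N (W (eta (val k)) w) 1})).
  exact: perm_eq_seq_mset.
apply: filterS (wiener_ito_hermite In_integral (seq_mset (codom (val \o s)))) => w ->.
rewrite -(@prod_finsupp_seq_mset _ _ A s _ (fun k m => hermite m (W (eta k) w) 1)) //.
by apply: eq_bigr => k _; rewrite (hermite_polynomialsE He_hermite).
Qed.

(** The addition formula sums the contributions of the words; the unit variances of the basis
    vectors add up to [D v v]. *)
Lemma In_pure_span n (A : {fset I}) (c : A -> R) :
  let v := \sum_k c k *: eta (val k) in
  {ae P, forall w, In (pure_tensor D (fun _ : 'I_n => v)) w = hermite n (W v w) (D v v)}.
Proof.
move=> v; rewrite (pure_lin_comb D_setting n c (eta \o val)).
have := (@In_lin_comb n _ (fun s : {ffun 'I_n -> A} => \prod_l c (s l))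
  (fun s => symm (pure_tensor D ((eta \o val) \o s)))
  (fun s => symm_pure_symmetric_power D_setting _)).2.
have : {ae P, forall w, forall s : {ffun 'I_n -> A},
    In (symm (pure_tensor D (eta \o val \o s))) w =
    \prod_(k : A) hermite (\sum_l (s l == k))%N (W (eta (val k)) w) 1}.
  by apply: filter_forall => s; exact: In_basis.
have := sum_process_sum c (eta \o val).
apply: filterS3 => w Wv basis ->.
under eq_bigr do rewrite basis.
rewrite -(word_sumE c n (fun m => \prod_(k : A) hermite (m k) (W (eta (val k)) w) 1)).
rewrite word_sum_hermite Wv; congr hermite.
rewrite (norm_lin_comb D_real (fset_orthonormal eta_cons (S := A))).
by apply: eq_bigr => k _; rewrite mulr1.
Qed.

(** Projections are self-adjoint, so the approximants of [hs_density] are again pure powers. *)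
Lemma pure_fproj n (A : {fset I}) (v : (V * V)%type) (x : 'I_n -> (V * V)%type) :
  pure_tensor D (fun=> v) (fproj D eta A \o x) = pure_tensor D (fun=> fproj D eta A v) x.
Proof.
apply: eq_bigr => l _ /=; rewrite /fproj /orthoproj (dot_sumr D_real) (dot_suml D_real).
apply: eq_bigr => k _; rewrite (dotZr D_real) (dotZl D_real) [D (eta _) _](dotC D_real).
exact: mulrC.
Qed.

Lemma In_pure n (v : (V * V)%type) :
  {ae P, forall w, In (pure_tensor D (fun _ : 'I_n => v)) w = hermite n (W v w) (D v v)}.
Proof.
(* The division offsets the factor n! of the isometry. *)
pose eps m : R := (2^-1) ^+ m / (n`!)%:R.
have fact_gt0 : 0 < (n`!)%:R :> R by rewrite ltr0n fact_gt0.
have half_gt0 m : 0 < (2^-1 : R) ^+ m by rewrite exprn_gt0 // invr_gt0.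
have eps_gt0 m : 0 < eps m by rewrite divr_gt0.
have v_pow := @symmetric_power_pure _ _ _ _ _ _ D_setting n v.
have [[v_lin v_fin] _] := v_pow.
have /choice[S1 HS1] := fun m => hs_density D_real eta_cons v_lin v_fin (eps_gt0 m).
have /choice[S2 HS2] := fun m => fproj_cvg D_real eta_cons v (half_gt0 m).
(* [S1] controls the kernel, hence the integral; [S2] controls the vector, hence [W]. *)
pose S m := (S1 m `|` S2 m)%fset.
pose u m := fproj D eta (S m) v.
have hs_le m : (real_norm2 D (fun x => (-1 * pure_tensor D (fun _ : 'I_n => u m) x +
    pure_tensor D (fun _ : 'I_n => v) x)%R) <= (eps m)%:E)%E.
  rewrite (_ : (fun x => _) = (fun x => pure_tensor D (fun _ : 'I_n => v) x -
      pure_tensor D (fun _ : 'I_n => v) (fproj D eta (S m) \o x))).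
    by apply: HS1; exact: fsubsetUl.
  by apply/funext => x; rewrite pure_fproj mulN1r addrC.
have dist_le m : D (v - u m) (v - u m) <= (2^-1) ^+ m by apply: HS2; exact: fsubsetUr.
have dist_eq m : D (u m) (u m) = D v v - D (v - u m) (v - u m).
  rewrite (norm_sub_orthoproj D_real (fset_orthonormal eta_cons (S := S m))).
  by rewrite subKr (norm_lin_comb D_real (fset_orthonormal eta_cons (S := S m))).
have half_cvg : (2^-1 : R) ^+ m @[m --> \oo] --> (0 : R).
  by apply: cvg_expr; rewrite ger0_norm ?invf_lt1 ?ltr1n // invr_ge0.
have norm_cvg : D (u m) (u m) @[m --> \oo] --> D v v.
  under eq_fun do rewrite dist_eq.
  suff : D v v - D (v - u m) (v - u m) @[m --> \oo] --> D v v - 0 by rewrite subr0.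
  apply: cvgB; first exact: cvg_cst.
  apply: (squeeze_cvgr _ (cvg_cst (0 : R)) half_cvg); apply: nearW => m.
  by rewrite dist_le real_dot_ge0.
have ae_pure : {ae P, forall w, forall m,
    In (pure_tensor D (fun _ : 'I_n => u m)) w = hermite n (W (u m) w) (D (u m) (u m))}.
  by apply: ae_foralln => m; exact: In_pure_span.
(* [W] is handled through [X] and [Y], the coordinate maps [pr] being contractions. *)
have cvg_X (Z : V -> {RV P >-> R}) (pr : (V * V)%type -> V) : isonormal dot Z ->
    (forall x, dot (pr x) (pr x) <= D x x) -> (forall x y, pr (x - y) = pr x - pr y) ->
    {ae P, forall w, Z (pr (u m)) w @[m --> \oo] --> Z (pr v) w}.
  move=> Z_iso prD prB.
  have : {ae P, forall w, (Z (pr v) w - Z (pr (u m)) w) @[m --> \oo] --> (0 : R)}.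
    apply: (@ae_cvg0 _ _ _ P (fun m w => Z (pr v) w - Z (pr (u m)) w)) => [m|m].
      exact: measurable_funB.
    by rewrite (isonormal_norm dot_real Z_iso) lee_fin -prB (le_trans (prD _)).
  apply: filterS => w cvg0.
  suff : Z (pr v) w - (Z (pr v) w - Z (pr (u m)) w) @[m --> \oo] --> Z (pr v) w - 0.
    by rewrite subr0; under eq_fun do rewrite subKr.
  by apply: cvgB cvg0; exact: cvg_cst.
have D1 x : dot x.1 x.1 <= D x x by rewrite lerDl (real_dot_ge0 dot_real).
have D2 x : dot x.2 x.2 <= D x x by rewrite lerDr (real_dot_ge0 dot_real).
have cvg1 := cvg_X X fst X_isonormal D1 (fun=> fun=> erefl).
have cvg2 := cvg_X Y snd Y_isonormal D2 (fun=> fun=> erefl).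
have u_pow m := @symmetric_power_pure _ _ _ _ _ _ D_setting n (u m).
have ae_lin : {ae P, forall w, forall m,
    In (fun x => -1 * pure_tensor D (fun _ : 'I_n => u m) x + pure_tensor D (fun=> v) x) w =
    -1 * In (pure_tensor D (fun _ : 'I_n => u m)) w + In (pure_tensor D (fun _ : 'I_n => v)) w}.
  by apply: ae_foralln => m; exact: (wiener_ito_linear In_integral _ (u_pow m) v_pow).
have ae_diff : {ae P, forall w, In (fun x => -1 * pure_tensor D (fun _ : 'I_n => u m) x +
    pure_tensor D (fun=> v) x) w @[m --> \oo] --> (0 : R)}.
  have diff_pow m := symmetric_power_linear D_setting (-1) (u_pow m) v_pow.
  apply: ae_cvg0 => m; first exact: (wiener_ito_measurable In_integral (diff_pow m)).
  rewrite (wiener_ito_isometry In_integral (diff_pow m)).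
  apply: (@le_trans _ _ ((n`!)%:R%:E * (eps m)%:E)%E).
    by rewrite lee_wpmul2l ?hs_le // lee_fin.
  by rewrite -EFinM lee_fin /eps mulrC divfK // gt_eqF.
have lim : {ae P, forall w, W (u m) w @[m --> \oo] --> W v w}.
  by apply: filterS2 cvg1 cvg2 => w; exact: cvgD.
apply: filterS2 (filterI ae_pure lim) (filterI ae_lin ae_diff) => w [pureE W_cvg] [linE diff0].
apply/eqP; rewrite -subr_eq0; apply/eqP.
have herm_cvg := @cvg_hermite_args _ n _ _ _ _ W_cvg norm_cvg.
have lim0 : - hermite n (W (u m) w) (D (u m) (u m)) + In (pure_tensor D (fun _ : 'I_n => v)) w
    @[m --> \oo] --> - hermite n (W v w) (D v v) + In (pure_tensor D (fun _ : 'I_n => v)) w.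
  by apply: cvgD; [exact: cvgN|exact: cvg_cst].
rewrite addrC -(cvg_lim (@Rhausdorff R) lim0); apply: cvg_lim => //.
by under eq_fun do rewrite -pureE -mulN1r -linE.
Qed.

End RealIntegral.

(** * The complex integrals of pure powers finite in the basis *)

Section ComplexIntegral.
Context (d : measure_display) (T : measurableType d) (R : realType).
Variables (P : probability T R) (V : lmodType R) (dot : V -> V -> R).
Hypothesis dot_real : real_dot dot.
Variables (X Y : V -> {RV P >-> R}).
Hypotheses (X_isonormal : isonormal dot X) (Y_isonormal : isonormal dot Y).
Variables (He : nat -> R -> R) (J : nat -> nat -> R[i] -> R[i]).
Hypothesis He_hermite : hermite_polynomials He.
Hypothesis J_hermite : complex_hermite_polynomials J.
Variables (M : countType) (xi : M -> complexification V).
Hypothesis xi_on : Defs.orthonormal (complex_dot dot) xi.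
Variable Ipq : forall p q, functional (complexification V) (p + q) -> T -> R[i].
Hypothesis Ipq_integral : complex_wiener_ito dot X Y J xi Ipq.

Notation D := (dsum_dot dot).
Notation cdot := (complex_dot dot).
Notation Z := (complex_isonormal X Y).
Let D_real : real_dot D := dsum_real_dot dot_real.
Let C_setting := complex_setting dot_real.

Lemma complex_process_sum (U : V -> {RV P >-> R}) (I : finType) (c : I -> R[i])
    (h : I -> complexification V) : isonormal dot U ->
  {ae P, forall w, complex_process U (\sum_k c k *: h k) w =
    \sum_k c k * complex_process U (h k) w}.
Proof.
move=> U_iso.
have sum1 : (\sum_k c k *: h k).1 = \sum_(p : I * bool)
    (if p.2 then - complex.Im (c p.1) else complex.Re (c p.1)) *:
    (if p.2 then (h p.1).2 else (h p.1).1).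
  rewrite (big_morph fst (id1 := 0) (op1 := +%R)) //.
  rewrite -(pair_bigA _ (fun k (b : bool) => (if b then - complex.Im (c k) else complex.Re (c k)) *:
    (if b then (h k).2 else (h k).1))) /=.
  by apply: eq_bigr => k _; rewrite big_bool /= scaleNr addrC.
have sum2 : (\sum_k c k *: h k).2 = \sum_(p : I * bool)
    (if p.2 then complex.Im (c p.1) else complex.Re (c p.1)) *:
    (if p.2 then (h p.1).1 else (h p.1).2).
  rewrite (big_morph snd (id1 := 0) (op1 := +%R)) //.
  rewrite -(pair_bigA _ (fun k (b : bool) => (if b then complex.Im (c k) else complex.Re (c k)) *:
    (if b then (h k).1 else (h k).2))) /=.
  by apply: eq_bigr => k _; rewrite big_bool /= addrC.
have := isonormal_sum dot_real U_iso
  (fun p : I * bool => if p.2 then - complex.Im (c p.1) else complex.Re (c p.1))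
  (fun p => if p.2 then (h p.1).2 else (h p.1).1).
have := isonormal_sum dot_real U_iso
  (fun p : I * bool => if p.2 then complex.Im (c p.1) else complex.Re (c p.1))
  (fun p => if p.2 then (h p.1).1 else (h p.1).2).
apply: filterS2 => w; rewrite -sum1 -sum2 /complex_process => -> ->.
rewrite -(pair_bigA _ (fun k (b : bool) => (if b then - complex.Im (c k) else complex.Re (c k)) *
  U (if b then (h k).2 else (h k).1) w)) /=.
rewrite -(pair_bigA _ (fun k (b : bool) => (if b then complex.Im (c k) else complex.Re (c k)) *
  U (if b then (h k).1 else (h k).2) w)) /=.
apply/eqP; rewrite eq_complex /= Re_sum Im_sum; apply/andP; split; apply/eqP;
  apply: eq_bigr => k _; rewrite big_bool; case: (c k) => a b /=; ring.
Qed.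

Lemma complex_isonormal_sum (I : finType) (c : I -> R[i]) (h : I -> complexification V) :
  {ae P, forall w, Z (\sum_k c k *: h k) w = \sum_k c k * Z (h k) w}.
Proof.
have := complex_process_sum c h X_isonormal; have := complex_process_sum c h Y_isonormal.
apply: filterS2 => w; rewrite /complex_isonormal => -> ->.
rewrite mulr_sumr -big_split mulr_suml; apply: eq_bigr => k _ /=; ring.
Qed.

Lemma Ipq_lin_comb p q (I : finType) (c : I -> R[i])
    (f : I -> functional (complexification V) (p + q)) :
  (forall j, complex_bisymmetric_power cdot (f j)) ->
  complex_bisymmetric_power cdot (fun x => \sum_j c j * f j x) /\
  {ae P, forall w, Ipq (fun x => \sum_j c j * f j x) w = \sum_j c j * Ipq (f j) w}.
Proof.
apply: ae_linear_sum.
- by move=> a g h gS hS; exact: (complex_wiener_ito_linear Ipq_integral a gS hS).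
- by move=> a g h gS hS; exact: (bisymmetric_power_linear C_setting a gS hS).
exact: (bisymmetric_power_zero C_setting p q).
Qed.

(** By homogeneity the two normalizing factors cancel and turn the variance 2 of [J] into 1. *)
Lemma J_normalized m n (z : R[i]) :
  (Num.sqrt 2)%:C ^- (m + n) * J m n ((Num.sqrt 2)%:C * z) =
  chermite m n z (conjc z) 1.
Proof.
set s : R[i] := (Num.sqrt 2)%:C.
have s2 : s * s = 2 by rewrite -rmorphM -expr2 sqr_sqrtr // rmorph_nat.
have s0 : s != 0 by apply/eqP => s0; have := s2; rewrite s0 mul0r => /esym/eqP; rewrite pnatr_eq0.
rewrite (complex_hermite_polynomialsE He_hermite J_hermite).
have -> : chermite m n (s * z) (Num.conj (s * z)) 2 = chermite m n (s * z) (s * conjc z) (s * s *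
  1).
  rewrite mulr1 s2; congr chermite.
  by case: z => a b; apply/eqP; rewrite eq_complex /=; apply/andP; split; apply/eqP; ring.
by rewrite chermite_homog -exprD mulKf // expf_neq0.
Qed.

Lemma Ipq_basis p q (A : {fset M}) (s : 'I_p -> A) (t : 'I_q -> A) :
  {ae P, forall w, Ipq (tensor_product (symm (pure_tensor cdot (xi \o val \o s)))
      (symm (pure_tensor cdot ((fun k => cconj (xi k)) \o val \o t)))) w =
    \prod_(k : A) chermite (\sum_l (s l == k))%N (\sum_l (t l == k))%N
      (Z (xi (val k)) w) (conjc (Z (xi (val k)) w)) 1}.
Proof.
set m := seq_mset (codom (val \o s)); set n := seq_mset (codom (val \o t)).
pose F w := \prod_(k : A) chermite (\sum_l (s l == k))%N (\sum_l (t l == k))%N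
      (Z (xi (val k)) w) (conjc (Z (xi (val k)) w)) 1.
apply: (@multi_tensor_ind _ _ cdot _ (fun k => cconj (xi k)) q (val \o t) n
  (fun q g => {ae P, forall w, Ipq (tensor_product (symm (pure_tensor cdot (xi \o val \o s))) g) w =
     F w})); first exact: perm_eq_seq_mset.
apply: (@multi_tensor_ind _ _ cdot _ xi p (val \o s) m
  (fun p f => {ae P, forall w, Ipq (tensor_product f
     (multi_tensor cdot (fun k => cconj (xi k)) n)) w = F w})); first exact: perm_eq_seq_mset.
apply: filterS (complex_wiener_ito_hermite Ipq_integral m n) => w ->.
have supp_A (r : nat) (u : 'I_r -> A) : (finsupp (seq_mset (codom (val \o u))) `<=` A)%fset.
  apply/fsubsetP => k; rewrite msuppE (perm_mem (perm_eq_seq_mset _)) => /codomP[l ->].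
  exact: valP.
have mn_A : (finsupp m `|` finsupp n `<=` A)%fset by rewrite fsubUset !supp_A.
rewrite (big_fset_incl _ mn_A) /=; last first.
  move=> k _; rewrite in_fsetU negb_or => /andP[km kn].
  by rewrite !fsfun_dflt // J_normalized.
rewrite big_seq_fsetE; apply: eq_bigr => k _.
rewrite J_normalized /m /n !seq_mset_codom.
by congr chermite; apply: eq_bigr => l _; rewrite /= val_eqE.
Qed.

(** One word is used for each tensor factor; the second carries conjugate coefficients, so the
    variances add up to the squared length of [u]. *)
Lemma Ipq_pure_span p q (A : {fset M}) (c : A -> R[i]) :
  let u := \sum_k c k *: xi (val k) in
  {ae P, forall w, Ipq (tensor_product (pure_tensor cdot (fun _ : 'I_p => u))
      (pure_tensor cdot (fun _ : 'I_q => cconj u))) w =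
    chermite p q (Z u w) (conjc (Z u w)) (D u u)%:C}.
Proof.
move=> u.
have uE : cconj u = \sum_k conjc (c k) *: cconj (xi (val k)).
  rewrite /u (big_morph (@cconj R V) (id1 := 0) (op1 := +%R)).
  - apply: eq_bigr => k _; rewrite /cconj; case: (c k) => a b; apply/eqP; rewrite xpair_eqE /=.
    by rewrite !scaleNr !scalerN opprK opprD !eqxx.
  - by move=> x y; apply/eqP; rewrite xpair_eqE /= opprD !eqxx.
  by rewrite /cconj /= oppr0.
pose f (st : {ffun 'I_p -> A} * {ffun 'I_q -> A}) :=
  tensor_product (symm (pure_tensor cdot ((xi \o val) \o st.1)))
    (symm (pure_tensor cdot (((fun k => cconj (xi k)) \o val) \o st.2))).
pose cc (st : {ffun 'I_p -> A} * {ffun 'I_q -> A}) :=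
  (\prod_l c (st.1 l)) * (\prod_l conjc (c (st.2 l))).
have -> : tensor_product (pure_tensor cdot (fun _ : 'I_p => u))
      (pure_tensor cdot (fun _ : 'I_q => cconj u)) = (fun x => \sum_st cc st * f st x).
  rewrite uE (pure_lin_comb C_setting p c (xi \o val)).
  rewrite (pure_lin_comb C_setting q (fun k => conjc (c k)) ((fun k => cconj (xi k)) \o val)).
  apply/funext => x; rewrite /tensor_product mulr_suml.
  rewrite -(pair_bigA _ (fun s t => cc (s, t) * f (s, t) x)) /=.
  apply: eq_bigr => s _; rewrite mulr_sumr; apply: eq_bigr => t _.
  by rewrite /cc /f /tensor_product /=; ring.
have f_pow st : complex_bisymmetric_power cdot (f st).
  exact: (tensor_product_symm_pure C_setting).
have basis : {ae P, forall w, forall st : {ffun 'I_p -> A} * {ffun 'I_q -> A}, Ipq (f st) w =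
    \prod_(k : A) chermite (\sum_l (st.1 l == k))%N (\sum_l (st.2 l == k))%N
      (Z (xi (val k)) w) (conjc (Z (xi (val k)) w)) 1}.
  by apply: filter_forall => st; exact: Ipq_basis.
apply: filterS3 basis (Ipq_lin_comb cc f_pow).2 (complex_isonormal_sum c (xi \o val)) => w basis
  -> ZE.
under eq_bigr do rewrite basis.
pose G m m' := \prod_(k : A) chermite (m k) (m' k)
  (Z (xi (val k)) w) (conjc (Z (xi (val k)) w)) 1.
transitivity (word_sum c p (fun m => word_sum (fun k => conjc (c k)) q (fun m' => G m m'))).
  rewrite word_sumE -(pair_bigA _ (fun s t => cc (s, t) *
     G (fun k => \sum_l (s l == k))%N (fun k => \sum_l (t l == k))%N)) /=.
  apply: eq_bigr => s _; rewrite word_sumE mulr_sumr; apply: eq_bigr => t _.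
  by rewrite /cc mulrA.
rewrite word_sum_chermite ZE rmorph_sum; congr chermite.
  by apply: eq_bigr => k _; exact/esym/rmorphM.
have -> : (D u u)%:C = cdot u u.
  by rewrite /complex_dot [dot u.1 u.2](dotC dot_real) subrr.
have dot0l' y : cdot 0 y = 0.
  by have := setting_dotl C_setting (-1) 0 0 y; rewrite scaler0 addr0 mulN1r addNr.
have dot0r' y : cdot y 0 = 0.
  by have := setting_dotr C_setting (-1) 0 0 y; rewrite scaler0 addr0 rmorphN1 mulN1r addNr.
have suml y : cdot u y = \sum_k c k * cdot (xi (val k)) y.
  by rewrite /u; elim/big_rec2: _ => // k _ z _ <-; rewrite (setting_dotl C_setting).
have sumr y : cdot y u = \sum_k conjc (c k) * cdot y (xi (val k)).
  by rewrite /u; elim/big_rec2: _ => // k _ z _ <-; rewrite (setting_dotr C_setting).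
rewrite suml; apply: eq_bigr => k _; rewrite sumr (bigD1 k) //= xi_on eqxx big1 => [|j jk].
  by rewrite addr0 !mulr1.
by rewrite xi_on val_eqE eq_sym (negbTE jk) mulr0.
Qed.

End ComplexIntegral.

Lemma multilinear_expand (R : realType) (V : lmodType R) n (f : functional V n) (I : finType)
    (c : 'I_n -> I -> R) (u : I -> V) : @antilinear R idfun V n f ->
  f (fun l => \sum_k c l k *: u k) =
  \sum_(s : {ffun 'I_n -> I}) (\prod_l c l (s l)) * f (u \o s).
Proof.
elim: n f c => [|n IH] f c f_lin.
  rewrite (sum_ffun0 (fun s => (\prod_l c l (s l)) * f (u \o s))
    (fun i => False_rect _ (notF (valP i)))) big_ord0 mul1r.
  by congr f; exact: fun_ord0.
rewrite (sum_fcons (fun s => (\prod_l c l (s l)) * f (u \o s))).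
rewrite -(fcons_eta (fun l => \sum_k c l k *: u k)) multilinear_cons_sum //.
apply: eq_bigr => k _.
rewrite (IH (fun x => f (fcons (u k) x)) (fun l => c (lift ord0 l))); last exact: multilinear_slice.
rewrite mulr_sumr; apply: eq_bigr => s _; rewrite big_ord_recl fcons0 comp_fcons mulrA.
by congr (_ * _ * _); apply: eq_bigr => l _; rewrite fconsS.
Qed.

(** * The chaos expansion of a real integral *)

Section ChaosExpansion.
Context (d : measure_display) (T : measurableType d) (R : realType).
Variables (P : probability T R) (V : lmodType R) (dot : V -> V -> R).
Hypothesis dot_real : real_dot dot.
Variables (X Y : V -> {RV P >-> R}).
Hypotheses (X_isonormal : isonormal dot X) (Y_isonormal : isonormal dot Y).
Variables (He : nat -> R -> R) (J : nat -> nat -> R[i] -> R[i]).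
Hypothesis He_hermite : hermite_polynomials He.
Hypothesis J_hermite : complex_hermite_polynomials J.
Variables (N : countType) (eta : N -> (V * V)%type).
Hypothesis eta_cons : complete_orthonormal (dsum_dot dot) eta.
Variables (M : countType) (xi : M -> complexification V).
Hypothesis xi_cons : complete_orthonormal (complex_dot dot) xi.
Variable In : forall n, functional (V * V)%type n -> T -> R.
Hypothesis In_integral : wiener_ito dot X Y He eta In.
Variable Ipq : forall p q, functional (complexification V) (p + q) -> T -> R[i].
Hypothesis Ipq_integral : complex_wiener_ito dot X Y J xi Ipq.
Variable p : nat.

Notation D := (dsum_dot dot).
Notation cdot := (complex_dot dot).
Notation W := (sum_process X Y).
Notation Z := (complex_isonormal X Y).
Let D_real : real_dot D := dsum_real_dot dot_real.
Let D_setting := real_setting D_real.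
Let C_setting := complex_setting dot_real.

(** Complex conjugation, seen as a real-linear map of the direct sum. *)
Definition flip_snd (x : (V * V)%type) : (V * V)%type := (x.1, - x.2).

Definition has_chaos_expansion (g : functional (V * V)%type p) : Prop :=
  real_symmetric_power D g /\
  {ae P, forall w, (In g w)%:C =
     \sum_(k < p.+1) Ipq (chaos_kernel g (fun=> 0) k) w}.

Lemma Ipq_scale k q a (f : functional (complexification V) (k + q)) :
  complex_bisymmetric_power cdot f ->
  {ae P, forall w, Ipq (fun x => a * f x) w = a * Ipq f w}.
Proof.
move=> f_pow; have := (Ipq_lin_comb dot_real Ipq_integral (fun _ : 'I_1 => a) (fun=> f_pow)).2.
apply: filterS => w; rewrite big_ord1 => <-; congr (Ipq _ w).
by apply/funext => x; rewrite big_ord1.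
Qed.

Lemma isonormalN (U : V -> {RV P >-> R}) x : isonormal dot U ->
  {ae P, forall w, U (- x) w = - U x w}.
Proof.
move=> U_iso; have := isonormal_sum dot_real U_iso (fun _ : 'I_1 => -1) (fun=> x).
by rewrite big_ord1 scaleN1r; apply: filterS => w ->; rewrite big_ord1 mulN1r.
Qed.

(** The hypothesis makes the complex integrals exactly computable; nothing is asked of [v] in the
    basis [eta], as [In_pure] covers every vector. *)
Lemma chaos_expansion_pure (A : {fset M}) (c : A -> R[i]) (v : (V * V)%type) :
  flip_snd v = \sum_k c k *: xi (val k) -> has_chaos_expansion (pure_tensor D (fun=> v)).
Proof.
move=> vE; split; first exact: (symmetric_power_pure D_setting).
pose u : complexification V := flip_snd v.
have u_conj : cconj u = v by rewrite /cconj /u /= opprK; case: (v).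
have span : {ae P, forall w, forall k : 'I_p.+1,
    Ipq (tensor_product (pure_tensor cdot (fun _ : 'I_k => u))
      (pure_tensor cdot (fun _ : 'I_(p - k) => (v : complexification V)))) w =
    chermite k (p - k) (Z u w) (conjc (Z u w)) (D v v)%:C}.
  apply: filter_forall => k.
  have := Ipq_pure_span dot_real X_isonormal Y_isonormal He_hermite J_hermite xi_cons.1
    Ipq_integral k (p - k) c.
  rewrite /= -vE -/u u_conj (_ : D u u = D v v) //.
  by rewrite /dsum_dot /= (dotNl dot_real) (dotNr dot_real) opprK.
have scale : {ae P, forall w, forall k : 'I_p.+1,
    Ipq (chaos_kernel (pure_tensor D (fun=> v)) (fun=> 0) k) w =
    (kernel_coef R k)%:C * Ipq (tensor_product (pure_tensor cdot (fun _ : 'I_k => u))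
      (pure_tensor cdot (fun _ : 'I_(p - k) => (v : complexification V)))) w}.
  apply: filter_forall => k; rewrite chaos_kernel_pure //; apply: Ipq_scale.
  have symmE n z : pure_tensor cdot (fun _ : 'I_n => z) = symm (pure_tensor cdot (fun=> z)).
    by rewrite symm_id // => s x; rewrite pure_perm.
  by rewrite (symmE k u) (symmE (p - k)%N v); exact: (tensor_product_symm_pure C_setting).
have := In_pure dot_real X_isonormal Y_isonormal He_hermite eta_cons In_integral p v.
have := isonormalN v.2 Y_isonormal.
apply: filterS3 (filterI span scale) => w [spanE scaleE] YN InE.
rewrite InE hermite_rmorph.
pose s : R[i] := (Num.sqrt 2)%:C.
have s2 : s ^+ 2 = 2 by rewrite -rmorphXn sqr_sqrtr // rmorph_nat.
have s0 : s != 0 by rewrite -sqrf_eq0 s2 pnatr_eq0.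
(* The sign of the second component leaves [Y] only almost surely, whence [YN]. *)
have ZE : Z u w + conjc (Z u w) = s * (W v w)%:C.
  have -> : Z u w = ((X u.1 w - Y u.2 w) +i* (X u.2 w + Y u.1 w)) / s.
    by congr (_ / _); apply/eqP; rewrite eq_complex /=; apply/andP; split; apply/eqP; ring.
  have -> : s^-1 = (Num.sqrt 2 / 2)%:C.
    apply: (mulfI s0); rewrite divff // -rmorphM mulrA -expr2 sqr_sqrtr //.
    by rewrite divff ?rmorph1 ?pnatr_eq0.
  rewrite /s /sum_process /u /= YN; apply/eqP; rewrite eq_complex /=.
  by apply/andP; split; apply/eqP; field.
rewrite (eq_bigr (fun k : 'I_p.+1 => s ^- p * ('C(p, k)%:R *
    chermite k (p - k) (Z u w) (conjc (Z u w)) (D v v)%:C))); last first.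
  move=> k _; rewrite scaleE spanE mulrA; congr (_ * _).
  rewrite /kernel_coef rmorphM fmorphV rmorphXn; congr (_ * _).
  have -> : (p`!)%:R / ((k`!)%:R * ((p - k)`!)%:R) = 'C(p, k)%:R :> R.
    by rewrite -(bin_fact (leq_ord k)) !natrM mulfK //.
  by rewrite rmorph_nat.
(* With the doubled variance written as [s ^+ 2 * (D v v)%:C], homogeneity releases [s ^+ p], which
   cancels the factor 2^(-p/2) of the kernels. *)
rewrite -mulr_sumr sum_chermite ZE -s2 hermite_homog mulKf //.
by rewrite expf_neq0.
Qed.

Lemma has_chaos_expansion_linear a g h :
  has_chaos_expansion g -> has_chaos_expansion h ->
  has_chaos_expansion (fun x => a * g x + h x).
Proof.
move=> [g_pow gE] [h_pow hE]; split; first exact: symmetric_power_linear.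
have kernel_pow (f : functional (V * V)%type p) k : real_symmetric_power D f ->
    complex_bisymmetric_power cdot (chaos_kernel f (fun=> 0) k).
  by move=> f_pow; apply: chaos_kernel_bisymmetric => //; exact: (symmetric_power_zero D_setting p).
have kE : {ae P, forall w, forall k : 'I_p.+1,
    Ipq (chaos_kernel (fun x => a * g x + h x) (fun=> 0) k) w =
    a%:C * Ipq (chaos_kernel g (fun=> 0) k) w + Ipq (chaos_kernel h (fun=> 0) k) w}.
  apply: filter_forall => k.
  rewrite (_ : chaos_kernel (fun x => a * g x + h x) (fun=> 0) k = fun x =>
    a%:C * chaos_kernel g (fun=> 0) k x + chaos_kernel h (fun=> 0) k x).
    exact: (complex_wiener_ito_linear Ipq_integral _ (kernel_pow _ _ g_pow) (kernel_pow _ _ h_pow)).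
  by apply/funext => x; rewrite chaos_kernel_linear.
have InE := wiener_ito_linear In_integral a g_pow h_pow.
apply: filterS3 (filterI gE hE) kE InE => w [gEw hEw] kEw ->.
rewrite rmorphD rmorphM /= gEw hEw mulr_sumr -big_split /=.
by apply: eq_bigr => k _; rewrite kEw.
Qed.

Lemma has_chaos_expansion_zero : has_chaos_expansion (fun=> 0).
Proof.
have pure0 : has_chaos_expansion (pure_tensor D (fun=> 0)).
  apply: (chaos_expansion_pure (A := fset0) (c := fun=> 0)).
  by rewrite big1 => [|k _]; rewrite ?scale0r // /flip_snd /= oppr0.
have := has_chaos_expansion_linear (-1) pure0 pure0.
by rewrite (_ : (fun x => _) = fun=> 0) //; apply/funext => x; rewrite mulN1r addNr.
Qed.

Lemma has_chaos_expansion_sum (I : Type) (r : seq I) (c : I -> R)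
    (f : I -> functional (V * V)%type p) : (forall i, has_chaos_expansion (f i)) ->
  has_chaos_expansion (fun x => \sum_(i <- r) c i * f i x).
Proof.
move=> f_exp; elim: r => [|i r IH].
  by under eq_fun do rewrite big_nil; exact: has_chaos_expansion_zero.
by under eq_fun do rewrite big_cons; exact: has_chaos_expansion_linear.
Qed.

(** The defect of the identity is linear and vanishes at each approximant, so at [g] it equals the
    defect at the error, whose integrals tend to 0 almost surely. *)
Lemma has_chaos_expansion_limit g : real_symmetric_power D g ->
  (forall eps : R, 0 < eps -> exists h, has_chaos_expansion h /\
    (real_norm2 D (fun x => (-1 * h x + g x)%R) <= eps%:E)%E) ->
  has_chaos_expansion g.
Proof.
move=> g_pow g_lim; split => //.
have /choice[C HC] := fun k : 'I_p.+1 => chaos_kernel_hs_le dot_real k.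
have C0 k : 0 <= C k := (HC k).1.
pose b (k : 'I_p.+1) : R := (k`! * (p - k)`!)%:R * C k.
have b0 k : 0 <= b k by rewrite mulr_ge0.
(* It dominates the norm bounds of all the integrals at once; the summand 1 makes it positive. *)
pose B : R := 1 + (p`!)%:R + \sum_k b k.
have B_fact : (p`!)%:R <= B.
  by rewrite /B addrAC lerDr addr_ge0 // sumr_ge0.
have B_b k : b k <= B.
  by rewrite /B (bigD1 k) //= addrCA lerDl !addr_ge0 // sumr_ge0.
have B_gt0 : 0 < B by rewrite /B -addrA ltr_pwDl // addr_ge0 // sumr_ge0.
have half_gt0 m : 0 < (2^-1 : R) ^+ m by rewrite exprn_gt0 // invr_gt0.
pose eps m : R := (2^-1) ^+ m / B.
have eps_gt0 m : 0 < eps m by rewrite divr_gt0.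
have eps_le (r : R) m : 0 <= r -> r <= B -> r * eps m <= (2^-1) ^+ m.
  by move=> r0 rB; rewrite /eps mulrA ler_pdivrMr // mulrC ler_wpM2l // ltW.
have /choice[h Hh] := fun m => g_lim _ (eps_gt0 m).
pose E m x : R := -1 * h m x + g x.
have E_pow m : real_symmetric_power D (E m).
  exact: (symmetric_power_linear D_setting (-1) (Hh m).1.1 g_pow).
have zero_pow := symmetric_power_zero D_setting p.
have kernel_pow f k : real_symmetric_power D f ->
    complex_bisymmetric_power cdot (chaos_kernel f (fun _ : 'I_p -> _ => 0) k).
  by move=> f_pow; exact: chaos_kernel_bisymmetric.
have In_cvg : {ae P, forall w, In (E m) w @[m --> \oo] --> (0 : R)}.
  apply: ae_cvg0 => m; first exact: (wiener_ito_measurable In_integral (E_pow m)).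
  rewrite (wiener_ito_isometry In_integral (E_pow m)).
  apply: (@le_trans _ _ ((p`!)%:R%:E * (eps m)%:E)%E).
    by rewrite lee_wpmul2l ?(Hh m).2 // lee_fin.
  by rewrite -EFinM lee_fin eps_le.
(* [ae_cvg0] concerns real functions; [part] stands for the real or the imaginary part. *)
have part_cvg (part : R[i] -> R) : (forall z, `|part z| <= Normc.normc z) ->
    (forall (k : 'I_p.+1) f, complex_bisymmetric_power cdot f ->
      measurable_fun setT (fun w => part (@Ipq k (p - k) f w))) ->
    {ae P, forall w, forall k : 'I_p.+1,
      part (Ipq (chaos_kernel (E m) (fun=> 0) k) w) @[m --> \oo] --> (0 : R)}.
  move=> part_le part_meas; apply: filter_forall => k.
  apply: (@ae_cvg0 _ _ _ P (fun m w => part (Ipq (chaos_kernel (E m) (fun=> 0) k) w))) => m.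
    by apply: part_meas; exact: kernel_pow.
  have k_pow := kernel_pow _ k (E_pow m).
  have [Re_meas Im_meas] := complex_wiener_ito_measurable Ipq_integral k_pow.
  apply: (@le_trans _ _ (\int[P]_w (Normc.normc (Ipq (chaos_kernel (E m) (fun=> 0%R) k) w) ^+
    2)%:E)%E).
    apply: ge0_le_integral => //.
    - by move=> w _; rewrite lee_fin sqr_ge0.
    - by apply/measurable_EFinP; apply: measurable_funX; exact: part_meas.
    - apply/measurable_EFinP; under eq_fun do rewrite normc_sqr.
      by apply: measurable_funD; exact: measurable_funX.
    by move=> w _; rewrite lee_fin -[leLHS]real_normK ?num_real // lerXn2r ?nnegrE ?normc_ge0.
  rewrite (complex_wiener_ito_isometry Ipq_integral k_pow).
  apply: (@le_trans _ _ ((k`! * (p - k)`!)%:R%:E * ((C k)%:E * (eps m)%:E))%E).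
    rewrite lee_wpmul2l ?lee_fin //; apply: le_trans ((HC k).2 _ (E_pow m).1.1) _.
    by rewrite lee_wpmul2l ?lee_fin // (Hh m).2.
  by rewrite -!EFinM lee_fin mulrA; exact: eps_le (b0 k) (B_b k).
have Re_cvg := part_cvg (@complex.Re R) (@Re_le_normc R)
  (fun k f f_pow => (complex_wiener_ito_measurable Ipq_integral f_pow).1).
have Im_cvg := part_cvg (@complex.Im R) (@Im_le_normc R)
  (fun k f f_pow => (complex_wiener_ito_measurable Ipq_integral f_pow).2).
have InE : {ae P, forall w, forall m, In (E m) w = -1 * In (h m) w + In g w}.
  by apply: ae_foralln => m; exact: (wiener_ito_linear In_integral (-1) (Hh m).1.1 g_pow).
have IpqE : {ae P, forall w, forall m, forall k : 'I_p.+1,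
    Ipq (chaos_kernel (E m) (fun=> 0) k) w =
    (-1)%:C * Ipq (chaos_kernel (h m) (fun=> 0) k) w + Ipq (chaos_kernel g (fun=> 0) k) w}.
  apply: ae_foralln => m; apply: filter_forall => k.
  rewrite (_ : chaos_kernel (E m) (fun=> 0) k = fun x =>
    (-1)%:C * chaos_kernel (h m) (fun=> 0) k x + chaos_kernel g (fun=> 0) k x).
    exact: (complex_wiener_ito_linear Ipq_integral _ (kernel_pow _ _ (Hh m).1.1) (kernel_pow _ _
      g_pow)).
  by apply/funext => x; rewrite chaos_kernel_linear.
have hE : {ae P, forall w, forall m, (In (h m) w)%:C =
    \sum_(k < p.+1) Ipq (chaos_kernel (h m) (fun=> 0) k) w}.
  by apply: ae_foralln => m; exact: (Hh m).1.2.
apply: filterS3 (filterI Re_cvg Im_cvg) (filterI In_cvg InE) (filterI IpqE hE).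
move=> w [Re_cvg_w Im_cvg_w] [In_cvg_w InE_w] [IpqE_w hE_w].
pose err := (In g w)%:C - \sum_(k < p.+1) Ipq (chaos_kernel g (fun=> 0) k) w.
have errE m : err = (In (E m) w)%:C - \sum_(k < p.+1) Ipq (chaos_kernel (E m) (fun=> 0) k) w.
  rewrite InE_w (eq_bigr _ (fun k _ => IpqE_w m k)) big_split /= -mulr_sumr -hE_w.
  by rewrite /err !rmorphD !rmorphM /= !rmorphN1; ring.
have sum_cvg (F : nat -> 'I_p.+1 -> R) : (forall k, F m k @[m --> \oo] --> (0 : R)) ->
    \sum_k F m k @[m --> \oo] --> (0 : R).
  move=> F_cvg; elim: (index_enum _) => [|k r IH].
    by under eq_fun do rewrite big_nil; exact: cvg_cst.
  under eq_fun do rewrite big_cons.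
  suff : F m k + \sum_(j <- r) F m j @[m --> \oo] --> (0 + 0 : R) by rewrite addr0.
  exact: cvgD.
have Re_err : complex.Re err = 0.
  have : In (E m) w - \sum_k complex.Re (Ipq (chaos_kernel (E m) (fun=> 0) k) w)
      @[m --> \oo] --> (0 - 0 : R) by apply: cvgB => //; exact: sum_cvg.
  under eq_fun => m do rewrite -Re_sum -[X in X - _]/(complex.Re (In (E m) w)%:C) -raddfB -errE.
  move=> /(cvg_lim (@Rhausdorff R)); rewrite subr0 => <-.
  by apply/esym/cvg_lim => //; exact: cvg_cst.
have Im_err : complex.Im err = 0.
  have : 0 - \sum_k complex.Im (Ipq (chaos_kernel (E m) (fun=> 0) k) w)
      @[m --> \oo] --> (0 - 0 : R) by apply: cvgB; [exact: cvg_cst|exact: sum_cvg].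
  under eq_fun => m do rewrite -Im_sum -[X in X - _]/(complex.Im (In (E m) w)%:C) -raddfB -errE.
  move=> /(cvg_lim (@Rhausdorff R)); rewrite subr0 => <-.
  by apply/esym/cvg_lim => //; exact: cvg_cst.
apply/eqP; rewrite -subr_eq0 -/err eq_complex.
by rewrite Re_err Im_err !eqxx.
Qed.

(** The realification of [xi], conjugated so that [flip_snd] leads back to xi_k and i xi_k, as
    [chaos_expansion_pure] demands. *)
Definition real_basis (k : M * bool) : (V * V)%type :=
  flip_snd (if k.2 then mul_i (xi k.1) else xi k.1).

Lemma flip_sndD : {morph flip_snd : x y / x + y}.
Proof. by move=> x y; rewrite /flip_snd /= opprD. Qed.

Lemma flip_snd0 : flip_snd 0 = 0.
Proof. by rewrite /flip_snd /= oppr0. Qed.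

Lemma flip_sndK : involutive flip_snd.
Proof. by case=> x y; rewrite /flip_snd /= opprK. Qed.

Lemma flip_sndZ a x : flip_snd (a *: x) = a *: flip_snd x.
Proof. by rewrite /flip_snd /= -scalerN. Qed.

Lemma dsum_dot_flip x y : D (flip_snd x) (flip_snd y) = D x y.
Proof. by rewrite /dsum_dot /= (dotNl dot_real) (dotNr dot_real) opprK. Qed.

Lemma complex_scaleE (c : R[i]) (x : complexification V) :
  (c *: x : complexification V) = complex.Re c *: (x : V * V) + complex.Im c *: mul_i x :> (V * V).
Proof. by apply/eqP; rewrite xpair_eqE /= scalerN !eqxx. Qed.

Lemma real_basis_complete : complete_orthonormal D real_basis.
Proof.
split.
  by move=> k l; rewrite /real_basis dsum_dot_flip (orthonormal_realify dot_real xi_cons.1).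
move=> x eps eps0.
have eps0C : 0 < eps%:C by rewrite ltcR.
have [s [c /= lt_eps]] := xi_cons.2 (flip_snd x) _ eps0C.
exists [seq (k, b) | k <- s, b <- [:: false; true]].
exists (fun k => if k.2 then complex.Im (c k.1) else complex.Re (c k.1)).
set r' := x - _; set r := flip_snd x - _ in lt_eps.
have -> : r' = flip_snd r; last first.
  by rewrite dsum_dot_flip; move: lt_eps; rewrite ltcE => /andP[_].
rewrite /r' /r -[x in LHS]flip_sndK flip_sndD; congr (_ + _).
rewrite big_allpairs_dep -[RHS]opprK; congr (- _).
have -> : - flip_snd (- \sum_(k <- s) c k *: xi k) = flip_snd (\sum_(k <- s) c k *: xi k).
  by rewrite -scaleN1r -flip_sndZ scaleN1r opprK.
rewrite (big_morph flip_snd flip_sndD flip_snd0); apply: eq_bigr => k _.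
by rewrite !big_cons big_nil /= addr0 complex_scaleE flip_sndD !flip_sndZ.
Qed.

(** Several positions may use the same element of [xi]; their coefficients are added up to obtain
    one per element. *)
Lemma lin_comb_fset (I : finType) (B : pred I) (c : I -> R[i]) (k : I -> M) :
  exists (A : {fset M}) (c' : A -> R[i]),
    \sum_(i | B i) c i *: xi (k i) = \sum_(j : A) c' j *: xi (val j).
Proof.
pose A : {fset M} := [fset j in codom k]%fset.
have kA i : k i \in A by rewrite inE codom_f.
exists A, (fun j => \sum_(i | B i && ([` kA i]%fset == j)) c i).
rewrite (partition_big (fun i => [` kA i]%fset) xpredT) //=.
apply: eq_bigr => j _; rewrite scaler_suml; apply: eq_bigr => i /andP[_ /eqP <-].
by [].
Qed.

Theorem chaos_expansion g : real_symmetric_power D g -> has_chaos_expansion g.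
Proof.
move=> g_pow; have [[g_lin g_fin] g_sym] := g_pow.
apply: has_chaos_expansion_limit => // eps eps0.
have [A HA] := hs_density D_real real_basis_complete g_lin g_fin eps0.
pose h x := g (fproj D real_basis A \o x).
exists h; split; last first.
  rewrite (_ : (fun x => _) = fun x => g x - g (fproj D real_basis A \o x)); first exact: HA.
  by apply/funext => x; rewrite /h mulN1r addrC.
pose u (s : {ffun 'I_p -> A}) := (real_basis \o val) \o s.
(* [h] inherits the symmetry of [g], so its expansion over basis words may be symmetrized, ready for
   polarization. *)
have -> : h = fun x => \sum_s g (u s) * symm (pure_tensor D (u s)) x.
  apply/funext => x; rewrite -symm_sum -[in LHS](symm_id (f := h)); last first.
    by move=> t z; rewrite /h -[RHS](g_sym t).
  congr (symm _ x); apply/funext => z.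
  rewrite /h (multilinear_expand (fun l k => D (z l) (real_basis (val k)))) //.
  apply: eq_bigr => s _; rewrite mulrC; congr (_ * _); apply: eq_bigr => l _.
  by rewrite (dotC D_real).
apply: has_chaos_expansion_sum => s; rewrite (polarization D_setting).
apply: has_chaos_expansion_sum => B.
have [A' [c' E]] := lin_comb_fset (fun l : 'I_p => l \in B)
  (fun l => if (val (s l)).2 then 'i%C else 1) (fun l => (val (s l)).1).
apply: (chaos_expansion_pure (A := A') (c := c')); rewrite -E.
rewrite (big_morph flip_snd flip_sndD flip_snd0); apply: eq_bigr => l _.
rewrite /u /= /real_basis flip_sndK complex_scaleE.
by case: (val (s l)).2; rewrite /= ?scale0r ?scale1r ?add0r ?addr0.
Qed.

End ChaosExpansion.

Lemma inner_product_real_dot (R : realType) (H : completeNormedModType R) (dot : H -> H -> R) :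
  inner_product dot -> real_dot dot.
Proof.
move=> dot_inner; split.
- exact: dot_sym.
- exact: dot_linear.
- by move=> x; rewrite (dot_norm dot_inner) sqr_ge0.
by move=> x; rewrite (dot_norm dot_inner) => /eqP; rewrite sqrf_eq0 normr_eq0 => /eqP.
Qed.

Theorem theorem4p3
  (R : realType) (H : completeNormedModType R) (dot : H -> H -> R)
  (dot_inner : inner_product dot) (H_separable : separable_space H)
  (d : measure_display) (T : measurableType d) (P : probability T R)
  (X Y : H -> {RV P >-> R})
  (X_isonormal : isonormal dot X) (Y_isonormal : isonormal dot Y)
  (XY_independent : independent_processes X Y)
  (He : nat -> R -> R) (He_hermite : hermite_polynomials He)
  (J : nat -> nat -> R[i] -> R[i]) (J_hermite : complex_hermite_polynomials J)
  (N : countType) (eta : N -> (H * H)%type)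
  (eta_cons : complete_orthonormal (dsum_dot dot) eta)
  (M : countType) (xi : M -> complexification H)
  (xi_cons : complete_orthonormal (complex_dot dot) xi)
  (In : forall n, functional (H * H)%type n -> T -> R)
  (In_integral : wiener_ito dot X Y He eta In)
  (Ipq : forall p q, functional (complexification H) (p + q) -> T -> R[i])
  (Ipq_integral : complex_wiener_ito dot X Y J xi Ipq)
  (p : nat) (p_ge1 : (1 <= p)%N)
  (g1 g2 : functional (H * H)%type p)
  (g1_sym : real_symmetric_power (dsum_dot dot) g1)
  (g2_sym : real_symmetric_power (dsum_dot dot) g2) :
  (forall k : 'I_p.+1,
     complex_bisymmetric_power (complex_dot dot) (chaos_kernel g1 g2 k)) /\
  {ae P, forall w,
     (In p g1 w)%:C + 'i%C * (In p g2 w)%:C =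
     \sum_(k < p.+1) Ipq k (p - k)%N (chaos_kernel g1 g2 k) w}.
Proof.
have dot_real := inner_product_real_dot dot_inner.
split; first by move=> k; exact: chaos_kernel_bisymmetric.
have zero_pow := symmetric_power_zero (real_setting (dsum_real_dot dot_real)) p.
have expand g : real_symmetric_power (dsum_dot dot) g -> {ae P, forall w, (In p g w)%:C =
    \sum_(k < p.+1) Ipq k (p - k)%N (chaos_kernel g (fun=> 0) k) w}.
  move=> g_pow; exact: (chaos_expansion dot_real X_isonormal Y_isonormal He_hermite
    J_hermite eta_cons xi_cons In_integral Ipq_integral g_pow).2.
(* Complex linearity of [Ipq] separates [g1] from [g2], so the expansion of a real integral is used
   twice. *)
have splitE : {ae P, forall w, forall k : 'I_p.+1, Ipq k (p - k)%N (chaos_kernel g1 g2 k) w =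
    'i%C * Ipq k (p - k)%N (chaos_kernel g2 (fun=> 0) k) w +
    Ipq k (p - k)%N (chaos_kernel g1 (fun=> 0) k) w}.
  apply: filter_forall => k.
  rewrite (_ : chaos_kernel g1 g2 k = fun x => 'i%C * chaos_kernel g2 (fun=> 0) k x +
    chaos_kernel g1 (fun=> 0) k x); last by apply/funext => x; exact: chaos_kernel_split.
  exact: (complex_wiener_ito_linear Ipq_integral _
    (chaos_kernel_bisymmetric dot_real k g2_sym zero_pow)
    (chaos_kernel_bisymmetric dot_real k g1_sym zero_pow)).
apply: filterS3 (expand _ g1_sym) (expand _ g2_sym) splitE => w -> -> splitE.
by rewrite (eq_bigr _ (fun k _ => splitE k)) big_split /= -mulr_sumr addrC.
Qed.
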